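(* Let $N,d\ge1$ be integers and let $B^{H,K}=\{B^{H,K}(t),\,t\in\mathbb{R}_+^N\}$ be an $(N,d)$-bifractional Brownian sheet with parameters $H=(H_1,\dots,H_N)\in(0,1)^N$ and $K=(K_1,\dots,K_N)\in(0,1]^N$. If $d<\sum_{j=1}^N\frac{1}{H_jK_j}$, then for any $N$-dimensional closed interval $I\subset(0,\infty)^N$, $B^{H,K}$ has a local time $L(x,I)$, $x\in\mathbb{R}^d$. Moreover, the local time admits the following $L^2$-representation: $$L(x,I)=(2\pi)^{-d}\int_{\mathbb{R}^d}e^{-i\langle y,x\rangle}\int_I e^{i\langle y,B^{H,K}(s)\rangle}\,ds\,dy,\qquad x\in\mathbb{R}^d.$$
   Context: For $H\in(0,1)^N$ and $K\in(0,1]^N$, the $(N,d)$-bifractional Brownian sheet $B^{H,K}=\{B^{H,K}(t),\,t\in\mathbb{R}_+^N\}$ is the centered Gaussian random field in $\mathbb{R}^d$ with i.i.d. components, each with covariance function $$\mathbb{E}\big(B_1^{H,K}(s)B_1^{H,K}(t)\big)=\prod_{j=1}^N\frac1{2^{K_j}}\Big[(s_j^{2H_j}+t_j^{2H_j})^{K_j}-|t_j-s_j|^{2H_jK_j}\Big].$$ The local time $L(x,I)$ on a closed interval $I$ is the density with respect to Lebesgue measure on $\mathbb{R}^d$ (when it exists, almost surely) of the occupation measure $\mu_I(A)=\int_I\mathbf{1}_A(B^{H,K}(s))\,ds$, $A\in\mathcal{B}(\mathbb{R}^d)$. ''$L^2$-representation'' means that, almost surely, the function $y\mapsto\int_Ie^{i\langle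 y,B^{H,K}(s)\rangle}ds$ is in $L^2(\mathbb{R}^d)$ and the outer integral in $y$ is understood as its inverse Fourier transform in the $L^2(\mathbb{R}^d)$ (Plancherel) sense. *)

(* Defs.v *)
From HB Require Import structures.
From mathcomp Require Import all_boot all_order all_algebra.
From mathcomp Require Import complex.
From mathcomp Require Import all_classical all_reals all_analysis.

Set Implicit Arguments.
Unset Strict Implicit.
Unset Printing Implicit Defensive.

Import Order.TTheory GRing.Theory Num.Theory.
Import numFieldNormedType.Exports.

Local Open Scope classical_set_scope.
Local Open Scope ring_scope.

(* Borel subsets of R^n: the library's sigma-algebra on tuples is generated by
   the coordinate maps. *)
Notation Rvec R n := (n.-tuple (measurableTypeR R)).

Section lebesgue_measure_on_tuples.
Context (R : realType).

Definition vcons n (p : measurableTypeR R * Rvec R n) : Rvec R n.+1 :=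
  [tuple of p.1 :: p.2].

Lemma measurable_vcons n : measurable_fun setT (@vcons n).
Proof. by apply: measurable_cons. Qed.

Section vcons_measure.
Context (n : nat) (mu : {sigma_finite_measure set (Rvec R n) -> \bar R}).

Definition vcons_measure : set (Rvec R n.+1) -> \bar R :=
  pushforward (@lebesgue_measure R \x mu)%E (@vcons n).

Let vcons_measure0 : vcons_measure set0 = 0%E.
Proof. by rewrite /vcons_measure /pushforward preimage_set0 measure0. Qed.

Let vcons_measure_ge0 A : (0 <= vcons_measure A)%E.
Proof. by rewrite /vcons_measure /pushforward; exact: measure_ge0. Qed.

Let vcons_measure_sigma_additive : semi_sigma_additive vcons_measure.
Proof.
rewrite /vcons_measure; apply: measure_semi_sigma_additive.
exact: measurable_vcons.
Qed.

HB.instance Definition _ := isMeasure.Build _ _ _ vcons_measure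
  vcons_measure0 vcons_measure_ge0 vcons_measure_sigma_additive.


Lemma vcons_measure_sigma_finite : sigma_finite setT vcons_measure.
Proof.
have [F FT mF] : sigma_finite setT (@lebesgue_measure R \x mu)%E.
  have /sigma_finiteP[F [TF ndF Foo]] := sigma_finiteT (@lebesgue_measure R).
  have /sigma_finiteP[G [TG ndG Goo]] := sigma_finiteT mu.
  exists (fun k => F k `*` G k).
    rewrite -setXTT TF TG predeqE => -[x y]; split.
      move=> [/= [k _ Fkx] [l _ Gly]]; exists (maxn k l) => //; split.
      - by move: x Fkx; exact/subsetPset/ndF/leq_maxl.
      - by move: y Gly; exact/subsetPset/ndG/leq_maxr.
    by move=> [k _ []/= ? ?]; split; exists k.
  move=> k; have [? ?] := Foo k; have [? ?] := Goo k.
  split; first exact: measurableX.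
  by rewrite product_measure1E// lte_mul_pinfty// ge0_fin_numE.
pose u (t : Rvec R n.+1) : measurableTypeR R * Rvec R n :=
  (tnth t ord0, [tuple of behead t]).
have mu_ : measurable_fun setT u.
  apply/measurable_fun_pairP; split.
    exact: measurable_tnth.
  exact: measurable_behead.
have uK p : u (vcons p) = p.
  by case: p => x t; rewrite /u /vcons; congr (_, _) => //; exact/val_inj.
exists (fun k => u @^-1` F k).
  by rewrite -preimage_bigcup -FT preimage_setT.
move=> k; have [mFk Fk] := mF k; split.
  by rewrite -[_ @^-1` _]setTI; exact: mu_.
rewrite /vcons_measure /pushforward -comp_preimage.
by rewrite (_ : u \o _ = id) //; apply/funext => p /=; rewrite uK.
Qed.

HB.instance Definition _ := Measure_isSigmaFinite.Build _ _ _
  vcons_measure vcons_measure_sigma_finite.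

End vcons_measure.

(* Lebesgue measure on R^n as an iterated product, transported along
   R * R^m = R^m.+1; see lebesgue_n_box. *)
Fixpoint lebesgue_n n : {sigma_finite_measure set (Rvec R n) -> \bar R} :=
  if n is m.+1 return {sigma_finite_measure set (Rvec R n) -> \bar R}
  then vcons_measure (lebesgue_n m)
  else @dirac _ (Rvec R 0) [tuple] R.

Definition box n (a b : Rvec R n) : set (Rvec R n) :=
  [set t | forall j, tnth a j <= tnth t j <= tnth b j].

Lemma measurable_box n (a b : Rvec R n) : measurable (box a b).
Proof.
rewrite (_ : box a b =
    \bigcap_(j in [set: 'I_n]) ((@tnth n _)^~ j @^-1` `[tnth a j, tnth b j])).
  apply: fin_bigcap_measurable => // j _.
  by rewrite -[_ @^-1` _]setTI; apply: measurable_tnth.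
apply/seteqP; split => [t tab j _|t tab j].
  by rewrite /= in_itv /=; exact: tab.
by have := tab j I; rewrite /= in_itv.
Qed.

Lemma lebesgue_n_box n (a b : Rvec R n) :
  (forall j, tnth a j <= tnth b j) ->
  lebesgue_n n (box a b) = (\prod_(j < n) (tnth b j - tnth a j))%:E.
Proof.
elim: n a b => [|n IH] a b ab.
  rewrite big_ord0 /= /dirac indicE mem_set//.
  by case.
rewrite big_ord_recl /= /vcons_measure /pushforward.
pose a' : Rvec R n := [tuple of behead a].
pose b' : Rvec R n := [tuple of behead b].
have tE (c : Rvec R n.+1) j : tnth c (lift ord0 j) = tnth [tuple of behead c] j.
  by rewrite {1}(tuple_eta c) tnthS.
have vE x (t : Rvec R n) j : tnth (vcons (x, t)) (lift ord0 j) = tnth t j.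
  by rewrite /vcons tnthS.
rewrite (_ : _ @^-1` _ = `[tnth a ord0, tnth b ord0] `*` box a' b').
  rewrite product_measure1E //; last exact: measurable_box.
  rewrite IH; last by move=> j; rewrite -!tE.
  rewrite EFinM; congr (_ * _)%E; last first.
    by congr EFin; apply: eq_bigr => j _; rewrite -!tE.
  rewrite [LHS](lebesgue_measure_itv `[tnth a ord0, tnth b ord0]) /= lte_fin.
  have := ab ord0; rewrite le_eqVlt => /predU1P[->|->].
    by rewrite ltxx subrr.
  by rewrite EFinB.
apply/seteqP; split => [[x t] /= tab|[x t] /= [xab tab] j].
  split; first by have := tab ord0; rewrite in_itv.
  by move=> j; have := tab (lift ord0 j); rewrite vE !tE.
case: (unliftP ord0 j) => [k ->|->]; last by move: xab; rewrite in_itv.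
by rewrite vE !tE; exact: tab.
Qed.
End lebesgue_measure_on_tuples.

Arguments lebesgue_n {R} n.

Definition Rplus (R : realType) n : set (Rvec R n) :=
  [set t | forall j, 0 <= tnth t j].
Arguments Rplus R n : clear implicits.

Definition dotv (R : realType) n (x y : Rvec R n) : R :=
  \sum_(i < n) tnth x i * tnth y i.

Section gaussian_fields.
Context (R : realType) (dO : measure_display) (Omega : measurableType dO).
Context (P : probability Omega R).

(* Point masses are Gaussian; they are treated apart because [normal_prob m 0]
   is by convention a uniform law. *)
Definition gaussian_rv (X : Omega -> R) : Prop :=
  exists m s : R, 0 <= s /\
    forall A : set (measurableTypeR R), measurable A ->
      P (X @^-1` A) = if s == 0 then \d_m A else normal_prob m s A.

Context (N d : nat) (B : Rvec R N -> {RV P >-> Rvec R d}).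

Definition component (i : 'I_d) (t : Rvec R N) : Omega -> R :=
  fun w => tnth (B t w) i.

Definition marginal (i : 'I_d) m (t : 'I_m -> Rvec R N) : Omega -> Rvec R m :=
  fun w => [tuple component i (t k) w | k < m].

Definition gaussian_field : Prop :=
  forall m (t : 'I_m -> Rvec R N) (c : 'I_m -> Rvec R d),
    (forall k, Rplus R N (t k)) ->
    gaussian_rv (fun w => \sum_(k < m) dotv (c k) (B (t k) w)).

Definition centered_field : Prop :=
  forall i t, Rplus R N t -> ('E_P[component i t] = 0)%E.

(* Independence of the processes B_0, ..., B_(d-1); a common list of times and
   the choice A_i = setT cover arbitrary finite-dimensional cylinders and
   subfamilies. *)
Definition independent_components : Prop :=
  forall m (t : 'I_m -> Rvec R N) (A : 'I_d -> set (Rvec R m)),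
    (forall k, Rplus R N (t k)) -> (forall i, measurable (A i)) ->
    P (\bigcap_(i in [set: 'I_d]) (marginal i t @^-1` A i)) =
    (\prod_(i < d) P (marginal i t @^-1` A i))%E.

Definition identically_distributed_components : Prop :=
  forall (i j : 'I_d) m (t : 'I_m -> Rvec R N) (A : set (Rvec R m)),
    (forall k, Rplus R N (t k)) -> measurable A ->
    P (marginal i t @^-1` A) = P (marginal j t @^-1` A).

(* Joint measurability in (t, omega), without which occupation measures of
   sample paths are not defined; it holds for continuous fields. *)
Definition measurable_field : Prop :=
  measurable_fun (Rplus R N `*` [set: Omega])
    (fun p : Rvec R N * Omega => B p.1 p.2).

Definition bifractional_cov (H K : 'I_N -> R) (s t : Rvec R N) : R :=
  \prod_(j < N)
    ((2 `^ K j)^-1 *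
     ((tnth s j `^ (2 * H j) + tnth t j `^ (2 * H j)) `^ K j
      - `|tnth t j - tnth s j| `^ (2 * H j * K j))).

Record bifractional_brownian_sheet (H K : 'I_N -> R) : Prop := {
  bbs_measurable : measurable_field ;
  bbs_gaussian : gaussian_field ;
  bbs_centered : centered_field ;
  bbs_independent : independent_components ;
  bbs_identical : identically_distributed_components ;
  bbs_covariance : forall i s t, Rplus R N s -> Rplus R N t ->
    ('E_P[component i s \* component i t] = (bifractional_cov H K s t)%:E)%E }.

Definition occupation_measure (I : set (Rvec R N)) (w : Omega)
    (A : set (Rvec R d)) : \bar R :=
  (\int[lebesgue_n N]_(s in I) (\1_A (B s w))%:E)%E.

Definition is_local_time (I : set (Rvec R N)) (L : Rvec R d -> Omega -> R) :=
  {ae P, forall w,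
    [/\ measurable_fun [set: Rvec R d] (L ^~ w),
        forall x, 0 <= L x w &
        forall A, measurable A -> occupation_measure I w A =
          (\int[lebesgue_n d]_(x in A) (L x w)%:E)%E] }.

End gaussian_fields.

Section fourier.
Context (R : realType).
Local Open Scope complex_scope.

Definition expi (u : R) : R[i] := cos u +i* sin u.

(* Meaningful when the real and imaginary parts of f are integrable on D. *)
Definition cintegral (dT : measure_display) (T : measurableType dT)
    (mu : {measure set T -> \bar R}) (D : set T) (f : T -> R[i]) : R[i] :=
  (\int[mu]_(x in D) complex.Re (f x)) +i* (\int[mu]_(x in D) complex.Im (f x)).

Context (d : nat).
Implicit Types f g h : Rvec R d -> R[i].

Definition cLnorm (p : \bar R) f : \bar R :=
  ('N[lebesgue_n d]_p[EFin \o @ComplexField.Normc.normc R \o f])%E.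

Definition in_cLp (p : \bar R) f : Prop :=
  [/\ measurable_fun [set: Rvec R d] (fun x => complex.Re (f x)),
      measurable_fun [set: Rvec R d] (fun x => complex.Im (f x)) &
      (cLnorm p f < +oo)%E].

Definition inv_fourier f (x : Rvec R d) : R[i] :=
  ((2 * pi) ^- d)%:C *
  cintegral (lebesgue_n d) setT (fun y => expi (- dotv y x) * f y).

(* g is the value at f of the continuous extension of inv_fourier from
   L^1 /\ L^2 to L^2. *)
Definition is_L2_inv_fourier f g : Prop :=
  [/\ in_cLp 2%:E f, in_cLp 2%:E g &
    forall h : nat -> Rvec R d -> R[i],
      (forall n, in_cLp 1%:E (h n) /\ in_cLp 2%:E (h n)) ->
      cLnorm 2%:E (fun y => h n y - f y) @[n --> \oo] --> 0%E ->
      cLnorm 2%:E (fun x => inv_fourier (h n) x - g x) @[n --> \oo] --> 0%E].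

End fourier.

(* Main.v *)
Require Import Defs.
From HB Require Import structures.
From mathcomp Require Import all_boot all_order all_algebra.
From mathcomp Require Import complex.
From mathcomp Require Import all_classical all_reals all_analysis.
From mathcomp Require Import measurable_realfun ring lra.

(* Fix a box and let nu be Lebesgue measure restricted to it.  For one sample
   path X the Fourier transform of the occupation measure is
   phi(y) = int e^{i<y,X_t>} nu(dt).  If phi is square integrable, then the
   inverse transforms of phi(y) exp(-|e y|^2/2) are nonnegative mollifications
   of the occupation measure, form an L^2-Cauchy family as e -> 0 by
   Plancherel's inequality, and converge to a density of the occupation measure;
   the same inequality shows that this density is the L^2 inverse transform of
   phi.

   Almost surely phi is square integrable: the increment B(s) - B(t) is a
   centered Gaussian vector with independent coordinates of variance V(s,t), so
     E int |phi|^2 = int int E e^{i<y,B(s)-B(t)>} = C int int V(s,t)^{-d/2}.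
   On the box V(s,t) >= c_j |s_j - t_j|^{2 H_j K_j} for every j; the geometric
   mean of these bounds with weights proportional to 1/(H_j K_j) gives
   V^{-d/2} <= C prod_j |s_j - t_j|^{-beta} with
   beta = d / sum_j 1/(H_j K_j) < 1, which is integrable. *)

Set Implicit Arguments.
Unset Strict Implicit.
Unset Printing Implicit Defensive.

Import Order.TTheory GRing.Theory Num.Theory.
Import numFieldNormedType.Exports.

Local Open Scope classical_set_scope.
Local Open Scope ring_scope.

(** * Gaussian integrals on the real line *)

(** Gaussian damping makes it integrable, and since a Gaussian transforms into a Gaussian, damping
    in frequency is convolution with a positive kernel in space; this positivity yields a
    nonnegative density. Everything is reduced to pairs of real cosine and sine integrals.
    Plancherel enters only as an upper bound, with any constant: it controls both the Cauchy
    property and the error of inverse transforms, so a lost factor 2 is harmless. The representation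
    is asserted for every local time; the bound is therefore proved for one constructed density and
    moved to all others by almost everywhere uniqueness. The c_j are positive because the box stays
    away from the axes: ratios of j-th coordinates are at least a_j / b_j > 0, so differences of x^h
    are smaller than |y - x|^h by a definite factor. The exponent beta is the same for all j because
    the weight 1/(H_j K_j) cancels the exponent 2 H_j K_j, and beta < 1 is exactly the hypothesis on
    d. *)

Section gaussian_integrals.
Context {R : realType}.
Notation mu := (@lebesgue_measure R).

(** The fundamental theorem of calculus on growing symmetric intervals leaves boundary terms, which
    the decay [|x - m| |F x| <= M] sends to 0. All Gaussian integrations by parts below go through
    this lemma. *)
Lemma Rintegral_derive_eq0 (F f : R -> R) (m M : R) :
  (forall x, is_derive x (1 : R) F (f x)) -> continuous f ->
  mu.-integrable setT (EFin \o f) ->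
  (forall x, `|x - m| * `|F x| <= M) -> \int[mu]_x f x = 0.
Proof.
move=> dF cf intf FM.
have fF n : (\int[mu]_(x in `[(- n.+1%:R)%R, n.+1%:R]) (f x)%:E =
    (F n.+1%:R - F (- n.+1%:R))%:E)%E.
  rewrite EFinB (@continuous_FTC2 _ f F) //.
  - by rewrite (@lt_trans _ _ 0)// ?ltr0n// oppr_lt0 ltr0n.
  - exact: continuous_subspaceT.
  - have cF : continuous F.
      move=> x; apply/differentiable_continuous/derivable1_diffP.
      by have [] := dF x.
    split => [x _||]; first by have [] := dF x.
    + exact/cvg_at_right_filter/cF.
    + exact/cvg_at_left_filter/cF.
  - by move=> x _; rewrite derive1E; have [_ ->] := dF x.
have M0 : 0 <= M by apply: le_trans (FM m); rewrite subrr normr0 mul0r.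
(* The sign [(-1) ^+ e] treats both endpoints at once. *)
have Fy (e : bool) : F ((-1) ^+ e * n.+1%:R) @[n --> \oo] --> (0 : R).
  apply/norm_cvg0P/cvgrPdist_le => r r0; near=> n.
  rewrite sub0r normrN !normr_id.
  have nr : `|m| + M / r + 1 <= n%:R by near: n; exact: nbhs_infty_ger.
  set y := _ * _.
  have ny : M / r < `|y - m|.
    have : `|y| <= `|y - m| + `|m| by rewrite -{1}(subrK m y) ler_normD.
    have -> : `|y| = n%:R + 1.
      by rewrite /y normrM normrX normrN1 expr1n mul1r ger0_norm// natr1.
    by lra.
  have y0 : 0 < `|y - m| by rewrite (le_lt_trans _ ny)// divr_ge0// ltW.
  rewrite -(ler_pM2l y0) (le_trans (FM _))//.
  by rewrite -ler_pdivrMr// ltW.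
have : (fun n => \int[mu]_x (f \_ `[(- n.+1%:R)%R, n.+1%:R] x)%:E)%E @ \oo -->
    (\int[mu]_x (f x)%:E)%E.
  apply: (@dominated_cvg _ _ _ mu setT measurableT
    (fun n x => (f \_ `[(- n.+1%:R)%R, n.+1%:R] x)%:E)
    (EFin \o f) (abse \o (EFin \o f))).
  - move=> n; apply/measurable_EFinP.
    apply/(measurable_restrictT f) => //; apply: measurable_funTS.
    exact: continuous_measurable_fun.
  - move=> x _; apply: cvg_EFin; first exact: nearW.
    apply: cvg_near_cst; near=> n; rewrite /= patchE mem_set//= in_itv/=.
    rewrite -ler_norml (@le_trans _ _ n%:R)// ?ler_nat//.
    by near: n; exact: nbhs_infty_ger.
  - by [].
  - by move/integrable_abse : intf.
  - move=> n x _; rewrite lee_fin patchE; case: ifPn => // _.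
    by rewrite normr0.
rewrite (_ : (fun n => _) = (fun n => (F n.+1%:R - F (- n.+1%:R))%:E)); last first.
  apply/funext => n; rewrite -fF [RHS]integral_mkcond.
  by apply: eq_integral => x _; rewrite restrict_EFin.
move=> fl; rewrite /Rintegral.
have -> : (\int[mu]_x (f x)%:E = 0)%E; last by [].
apply: cvg_unique fl _ => //; apply: cvg_EFin; first exact: nearW.
rewrite -(subrr 0); apply: cvgB.
- by have := Fy false; under eq_fun do rewrite expr0 mul1r.
- by have := Fy true; under eq_fun do rewrite expr1 mulN1r.
Unshelve. all: by end_near. Qed.

Variables (m s : R).
Hypothesis s0 : 0 < s.
Local Notation g := (normal_pdf m s).
Let sn0 : s != 0. Proof. by rewrite gt_eqF. Qed.

Lemma is_derive_normal_pdf (x : R) :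
  is_derive x (1 : R) g (- (x - m) / s ^+ 2 * g x).
Proof.
rewrite normal_pdfE// /normal_fun.
apply: is_derive_eq.
rewrite /GRing.scale/= !(mulr0, addr0, add0r, subr0, mulr1).
rewrite -[_ *+ 2]mulr_natr; field. by [].
Qed.

(** Doubling the standard deviation leaves a spare factor [exp(-3v/8)] with [v = (x - m)^2 / s^2],
    since 1/2 - 1/8 = 3/8; and [v exp(-3v/8) <= 8/3] because [1 + z <= exp z]. *)
Lemma sqr_normal_pdf_le (x : R) : (x - m) ^+ 2 * g x <=
  8 / 3 * s ^+ 2 * normal_peak s / normal_peak (2 * s) * normal_pdf m (2 * s) x.
Proof.
have s20 : 2 * s != 0 by rewrite mulf_neq0.
rewrite normal_pdfE// normal_pdfE//.
rewrite [leRHS]mulrA divfK ?gt_eqF ?normal_peak_gt0//.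
rewrite mulrCA (mulrAC _ (normal_peak s)) (mulrC _ (normal_peak s)).
rewrite ler_pM2l ?normal_peak_gt0//.
rewrite /normal_fun. set w := (x - m) ^+ 2.
have -> : - w / (s ^+ 2 *+ 2) = - w / ((2 * s) ^+ 2 *+ 2) - 3 / 8 * (w / s ^+ 2).
  by field.
rewrite expRD mulrCA [leRHS]mulrC ler_pM2l ?expR_gt0//.

have w0 : 0 <= w / s ^+ 2 by rewrite divr_ge0// sqr_ge0.
rewrite expRN ler_pdivrMr ?expR_gt0//.
have -> : w = s ^+ 2 * (w / s ^+ 2) by rewrite mulrC divfK// expf_neq0.
rewrite (mulrAC (s ^+ 2)) mulfV ?expf_neq0// mul1r.
have := expR_ge1Dx (3 / 8 * (w / s ^+ 2)); set v := w / _ in w0 *.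
have s2 : 0 < s ^+ 2 by rewrite exprn_gt0.
nra.
Qed.

End gaussian_integrals.

Lemma integrable_dominated d (T : measurableType d) (R : realType)
    (mu : {measure set T -> \bar R}) (f h : T -> R) :
  measurable_fun setT f -> (forall x, `|f x| <= h x) ->
  mu.-integrable setT (EFin \o h) -> mu.-integrable setT (EFin \o f).
Proof.
move=> mf fh; apply: le_integrable => //; first exact/measurable_EFinP.
by move=> x _; rewrite lee_fin (le_trans (fh _))// ler_norm.
Qed.

Lemma integrable_EFinD d (T : measurableType d) (R : realType)
    (mu : {measure set T -> \bar R}) (f h : T -> R) :
  mu.-integrable setT (EFin \o f) -> mu.-integrable setT (EFin \o h) ->
  mu.-integrable setT (EFin \o (fun x => f x + h x)).
Proof. exact: integrableD. Qed.

Lemma integrable_EFinZ d (T : measurableType d) (R : realType)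
    (mu : {measure set T -> \bar R}) (c : R) (f : T -> R) :
  mu.-integrable setT (EFin \o f) ->
  mu.-integrable setT (EFin \o (fun x => c * f x)).
Proof. by move=> /(integrableZl measurableT c). Qed.

Lemma derivable_continuous (R : realType) (f : R -> R) :
  (forall x, derivable f x 1) -> continuous f.
Proof. by move=> df x; apply/differentiable_continuous/derivable1_diffP. Qed.

Section normal_moments.
Context {R : realType}.
Variables (m s : R).
Hypothesis s0 : 0 < s.
Notation mu := (@lebesgue_measure R).
Local Notation g := (normal_pdf m s).
Let sn0 : s != 0. Proof. by rewrite gt_eqF. Qed.

Let measurable_g : measurable_fun setT g.
Proof. exact: measurable_normal_pdf. Qed.

Lemma integrable_normal_pdf_sqr :
  mu.-integrable setT (EFin \o (fun x => (x - m) ^+ 2 * g x)).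
Proof.
apply: (@integrable_dominated _ (measurableTypeR R) R mu _ (fun x =>
  8 / 3 * s ^+ 2 * normal_peak s / normal_peak (2 * s) * normal_pdf m (2 * s) x)).
- apply: measurable_funM => //; apply: measurable_funX; exact: measurable_funB.
- move=> x; rewrite ger0_norm; last by rewrite mulr_ge0 ?sqr_ge0 ?normal_pdf_ge0.
  exact: sqr_normal_pdf_le.
- exact/integrable_EFinZ/integrable_normal_pdf.
Qed.

Lemma integrable_normal_pdf_lin (h : R -> R) :
  measurable_fun setT h -> (forall x, `|h x| <= 1) ->
  mu.-integrable setT (EFin \o (fun x => (x - m) * h x * g x)).
Proof.
move=> mh h1; apply: (@integrable_dominated _ (measurableTypeR R) R mu _
    (fun x => g x + (x - m) ^+ 2 * g x)).
- apply: measurable_funM => //; apply: measurable_funM => //.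
  exact: measurable_funB.
- move=> x; rewrite !normrM (ger0_norm (normal_pdf_ge0 _ _ _)).
  rewrite -{2}[g x]mul1r -mulrDl ler_wpM2r ?normal_pdf_ge0//.
  rewrite -real_normK ?num_real//.
  have := h1 x; have := normr_ge0 (h x); have := normr_ge0 (x - m).
  move: `|x - m| `|h x| => a b; nra.
- apply: integrable_EFinD; [exact: integrable_normal_pdf|].
  exact: integrable_normal_pdf_sqr.
Qed.

Lemma integrable_normal_pdf_bounded (h : R -> R) :
  measurable_fun setT h -> (forall x, `|h x| <= 1) ->
  mu.-integrable setT (EFin \o (fun x => h x * g x)).
Proof.
move=> mh h1; apply: (@integrable_dominated _ (measurableTypeR R) R mu _ g).
- exact: measurable_funM.
- move=> x; rewrite !normrM (ger0_norm (normal_pdf_ge0 _ _ _)).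
  by rewrite ler_piMl// normal_pdf_ge0.
- exact: integrable_normal_pdf.
Qed.

(** Supplies the decay constant of the boundary terms for the primitive [(x - m) * g];
    [lin_normal_pdf_ub] does so for [g] and for a sine times [g]. *)
Lemma sqr_normal_pdf_ub : exists M, forall x : R, (x - m) ^+ 2 * g x <= M.
Proof.
exists (8 / 3 * s ^+ 2 * normal_peak s / normal_peak (2 * s) *
  normal_peak (2 * s)) => x.
apply: le_trans (sqr_normal_pdf_le _ s0 _) _.
rewrite ler_wpM2l ?normal_pdf_ub ?mulf_neq0//.
apply: divr_ge0; last exact: normal_peak_ge0.
apply: mulr_ge0; last exact: normal_peak_ge0.
by apply: mulr_ge0; [exact: divr_ge0|exact: sqr_ge0].
Qed.

Lemma lin_normal_pdf_ub : exists M, forall x : R, `|x - m| * g x <= M.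
Proof.
have [M HM] := sqr_normal_pdf_ub; exists (normal_peak s + M) => x.
apply: (@le_trans _ _ (g x + (x - m) ^+ 2 * g x)); last first.
  by rewrite lerD// normal_pdf_ub.
rewrite -{2}[g x]mul1r -mulrDl ler_wpM2r ?normal_pdf_ge0//.
rewrite -real_normK ?num_real//; move: `|x - m| => a; nra.
Qed.

Lemma Rintegral_normal_pdf : \int[mu]_x g x = 1.
Proof. by rewrite /Rintegral integral_normal_pdf. Qed.

Lemma Rintegral_normal_pdf_lin : \int[mu]_x ((x - m) * g x) = 0.
Proof.
have ilin : mu.-integrable setT (EFin \o (fun x => (x - m) * g x)).
  have := @integrable_normal_pdf_lin (cst 1).
  by under eq_fun do rewrite mulr1; apply => // x; rewrite normr1.
have [M HM] := lin_normal_pdf_ub.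
have dF (x : R) : is_derive x (1 : R) g (- s ^- 2 * ((x - m) * g x)).
  apply: is_derive_eq; first exact: is_derive_normal_pdf.
  by field.

have : \int[mu]_x (- s ^- 2 * ((x - m) * g x)) = 0.
  apply: (Rintegral_derive_eq0 dF (m := m) (M := M)).
  - apply: derivable_continuous => x.
    by have dg := is_derive_normal_pdf m s0 x; apply: ex_derive.
  - exact: integrable_EFinZ.
  - by move=> x; rewrite (ger0_norm (normal_pdf_ge0 _ _ _)).
rewrite RintegralZl// => /eqP; rewrite mulf_eq0 oppr_eq0 invr_eq0.
by rewrite expf_eq0/= (negPf sn0)/= => /eqP.
Qed.

(** The derivative of [(x - m) * g] is [g - s^-2 (x - m)^2 g], and its integral vanishes. *)
Lemma Rintegral_normal_pdf_sqr : \int[mu]_x ((x - m) ^+ 2 * g x) = s ^+ 2.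
Proof.
have isqr := integrable_normal_pdf_sqr.
have [M HM] := sqr_normal_pdf_ub.
have dF (x : R) : is_derive x (1 : R) (fun x => (x - m) * g x)
    (g x + - s ^- 2 * ((x - m) ^+ 2 * g x)).
  apply: is_derive_eq; first by apply: is_deriveM; exact: is_derive_normal_pdf.
  by rewrite /GRing.scale/=; field.
have : \int[mu]_x (g x + - s ^- 2 * ((x - m) ^+ 2 * g x)) = 0.
  apply: (Rintegral_derive_eq0 dF (m := m) (M := M)).
  - apply: derivable_continuous => x.
    by have dg := is_derive_normal_pdf m s0 x; apply: ex_derive.
  - apply: integrable_EFinD; first exact: integrable_normal_pdf.
    exact: integrable_EFinZ.
  - move=> x; rewrite normrM (ger0_norm (normal_pdf_ge0 _ _ _)) mulrA.
    by rewrite -normrM -expr2 ger0_norm ?sqr_ge0.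
rewrite RintegralD//; [|exact: integrable_normal_pdf|exact: integrable_EFinZ].
rewrite RintegralZl// Rintegral_normal_pdf => /eqP.
rewrite mulNr subr_eq0 => /eqP e.
by rewrite -[RHS]mulr1 e mulrA mulfV ?mul1r// expf_neq0.
Qed.

Variable c : R.
Let cosg (u x : R) := cos (u * (x - m) + c) * g x.
Let sing (u x : R) := (x - m) * sin (u * (x - m) + c) * g x.

Let measurable_phase (u : R) : measurable_fun setT (fun x : R => u * (x - m) + c).
Proof.
by apply: measurable_funD => //; apply: measurable_funM => //;
  exact: measurable_funB.
Qed.

Let integrable_cosg u : mu.-integrable setT (EFin \o cosg u).
Proof.
apply: integrable_normal_pdf_bounded => [|x]; last first.
  by rewrite ler_norml cos_geN1 cos_le1.
by apply: measurableT_comp => //; apply: continuous_measurable_fun;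
  exact: continuous_cos.
Qed.

Let integrable_sing u : mu.-integrable setT (EFin \o sing u).
Proof.
apply: integrable_normal_pdf_lin => [|x]; last first.
  by rewrite ler_norml sin_geN1 sin_le1.
by apply: measurableT_comp => //; apply: continuous_measurable_fun;
  exact: continuous_sin.
Qed.

(** Integration by parts with the primitive [sin(u (x - m) + c) * g], whose derivative combines the
    two integrands. *)
Let Rintegral_sing u : \int[mu]_x sing u x = s ^+ 2 * u * \int[mu]_x cosg u x.
Proof.
have [M HM] := lin_normal_pdf_ub.
have dF (x : R) : is_derive x (1 : R) (fun x => sin (u * (x - m) + c) * g x)
    (u * cosg u x + - s ^- 2 * sing u x).
  have dg := is_derive_normal_pdf m s0 x.
  apply: is_derive_eq.
  rewrite /cosg /sing /GRing.scale/=.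
  by field.
have : \int[mu]_x (u * cosg u x + - s ^- 2 * sing u x) = 0.
  apply: (Rintegral_derive_eq0 dF (m := m) (M := M)).
  - apply: derivable_continuous => x; rewrite /cosg/sing.
    by have dg := is_derive_normal_pdf m s0 x; apply: ex_derive.
  - by apply: integrable_EFinD; exact: integrable_EFinZ.
  - move=> x; rewrite normrM (ger0_norm (normal_pdf_ge0 _ _ _)) mulrA.
    rewrite (le_trans _ (HM x))// ler_wpM2r ?normal_pdf_ge0//.
    by rewrite ler_piMr// ler_norml sin_geN1 sin_le1.
rewrite RintegralD//; [|exact: integrable_EFinZ|exact: integrable_EFinZ].
rewrite !RintegralZl// => /eqP.
rewrite mulNr subr_eq0 => /eqP e.
by rewrite -mulrA e mulrA mulfV ?mul1r// expf_neq0.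
Qed.

(* As a function of u the integral solves f' = - s^2 u f, by Gaussian integration
   by parts; the phase c covers cosine and sine at once. *)
Lemma Rintegral_normal_pdf_cos (u : R) :
  \int[mu]_x (cos (u * (x - m) + c) * g x) = cos c * expR (- (s * u) ^+ 2 / 2).
Proof.
have dphi (v : R) : is_derive v (1 : R) (fun u => \int[mu]_x cosg u x)
    (- (s ^+ 2 * v * \int[mu]_x cosg v x)).
  have dcos (y x : R) : is_derive y (1 : R) (cosg ^~ x) (- sing y x).
    apply: is_derive_eq; rewrite /sing /GRing.scale/=.
        by ring.
  (* [G] dominates the derivative in [u] for all [u] at once, as [|x - m| <= 1 + (x - m)^2]; this
     justifies differentiating under the integral. *)
  pose G x : R := (1 + (x - m) ^+ 2) * g x.
  have Iv : `]v - 1, v + 1[%classic v by rewrite /= in_itv/=; apply/andP; split; lra.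
  have intc (y : R) : `]v - 1, v + 1[%classic y -> mu.-integrable setT (EFin \o cosg y).
    by move=> _; exact: integrable_cosg.
  have dd (y x : R) : `]v - 1, v + 1[%classic y -> setT x -> derivable (cosg ^~ x) y 1.
    by move=> _ _; have [] := dcos y x.
  have G0 (x : R) : 0 <= G x.
    by rewrite mulr_ge0 ?normal_pdf_ge0// addr_ge0 ?sqr_ge0.
  have iG : mu.-integrable setT (EFin \o G).
    rewrite /G; under eq_fun do rewrite mulrDl mul1r.
    apply: integrable_EFinD; first exact: integrable_normal_pdf.
    exact: integrable_normal_pdf_sqr.
  have bd (y x : R) : `]v - 1, v + 1[%classic y -> setT x ->
      `|partial1of2 cosg y x| <= G x.
    move=> _ _; rewrite partial1of2E; have [_ ->] := dcos y x.
    rewrite normrN /sing !normrM (ger0_norm (normal_pdf_ge0 _ _ _)).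
    rewrite ler_wpM2r ?normal_pdf_ge0//.
    rewrite -[(x - m) ^+ 2]real_normK ?num_real//.
    have : `|sin (y * (x - m) + c)| <= 1 by rewrite ler_norml sin_geN1 sin_le1.
    have := normr_ge0 (x - m); have := normr_ge0 (sin (y * (x - m) + c)).
    move: `|x - m| `|sin _| => a b; nra.
  have := derivable_under_integral measurableT Iv intc dd G0 iG bd.
  have := differentiation_under_integral measurableT Iv intc dd G0 iG bd.
  rewrite derive1E => e d; apply: DeriveDef => //.
  rewrite e -Rintegral_sing -mulN1r -RintegralZl//.
  apply: eq_Rintegral => x _; rewrite partial1of2E mulN1r.
  by have [_ ->] := dcos v x.
(* Integrating factor [exp((s u)^2 / 2)]: the product is constant, and its value at [u = 0] is
   [cos c]. *)
have dcst (v : R) : is_derive v (1 : R)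
    (fun u => (\int[mu]_x cosg u x) * expR ((s * u) ^+ 2 / 2)) 0.
  have := dphi v; set phi := (fun u => \int[mu]_x cosg u x) => dp.
  rewrite -/(phi v) in dp.
  apply: is_derive_eq; rewrite /GRing.scale/= -/(phi v).
  by field.
have := is_derive_0_is_cst u 0 dcst.
rewrite mulr0 expr0n mul0r expR0 mulr1.
rewrite -/(cosg u) => /(congr1 ( *%R^~ (expR (- (s * u) ^+ 2 / 2)))).
rewrite -mulrA -expRD mulNr subrr expR0 mulr1 => ->.
congr (_ * _); rewrite /cosg.
under eq_Rintegral do rewrite mul0r add0r.
rewrite RintegralZl//; last exact: integrable_normal_pdf.
by rewrite Rintegral_normal_pdf mulr1.
Qed.

End normal_moments.

(** * Fubini's theorem and Gaussian kernels on R^n *)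

Section real_fubini.
Context d1 d2 (T1 : measurableType d1) (T2 : measurableType d2) (R : realType).
Variable m1 : {sigma_finite_measure set T1 -> \bar R}.
Variable m2 : {sigma_finite_measure set T2 -> \bar R}.

(** The inner integral of Fubini's theorem may be infinite on a null set, where [fine] returns 0.
    Almost everywhere nothing changes, so iterated real-valued integrals make sense. *)
Lemma integral_fine d (T : measurableType d) (mu : {measure set T -> \bar R})
    (F : T -> \bar R) : mu.-integrable setT F ->
  (\int[mu]_x (fine (F x))%:E = \int[mu]_x F x)%E.
Proof.
move=> iF; apply: ae_eq_integral => //.
- apply/measurable_EFinP; apply: measurableT_comp => //.
  exact: measurable_int iF.
- exact: measurable_int iF.
- move/integrable_ae : iF => /(_ measurableT); apply: filterS => x /= Fx Tx.
  by rewrite fineK// Fx.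
Qed.

Lemma integrable_fine d (T : measurableType d) (mu : {measure set T -> \bar R})
    (F : T -> \bar R) : mu.-integrable setT F ->
  mu.-integrable setT (EFin \o (fun x => fine (F x))).
Proof.
move=> iF; apply: le_integrable (iF) => //.
- apply/measurable_EFinP; apply: measurableT_comp => //.
  exact: measurable_int iF.
- by move=> x _ /=; case: (F x) => //= [|]; rewrite normr0 leey.
Qed.

Section integrable_kernel.
Variable f : T1 * T2 -> R.
Hypothesis intf : (m1 \x m2)%E.-integrable setT (EFin \o f).

Let integrable_fubini_swap : m2.-integrable setT (fubini_G m1 (EFin \o f)).
Proof.
have mf : measurable_fun setT (EFin \o f) by exact: measurable_int intf.
have ms : measurable_fun setT (fun z : T2 * T1 => (z.2, z.1)).
  by apply/measurable_fun_pairP; split; [exact: measurable_snd|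
    exact: measurable_fst].
apply: (@integrable_fubini_F _ _ _ _ _ m2 m1 (fun z => (f (z.2, z.1))%:E)).
apply/integrable12ltyP; first exact: (measurableT_comp mf ms).
by move/(integrable21ltyP m1 m2 mf) : intf.
Qed.

Lemma integrable_Rintegral1 :
  m1.-integrable setT (EFin \o (fun x => \int[m2]_y f (x, y))).
Proof. exact/integrable_fine/(integrable_fubini_F intf). Qed.

Lemma integrable_Rintegral2 :
  m2.-integrable setT (EFin \o (fun y => \int[m1]_x f (x, y))).
Proof. exact/integrable_fine/integrable_fubini_swap. Qed.

Lemma Rintegral_fubini1 :
  \int[m1]_x \int[m2]_y f (x, y) = \int[(m1 \x m2)%E]_z f z.
Proof.
congr fine; rewrite -(integral12_prod_meas1 intf).
by rewrite -[RHS]integral_fine//; exact: integrable_fubini_F.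
Qed.

Lemma Rintegral_fubini2 :
  \int[m2]_y \int[m1]_x f (x, y) = \int[(m1 \x m2)%E]_z f z.
Proof.
congr fine; rewrite -(integral21_prod_meas1 intf).
by rewrite -[RHS]integral_fine//; exact: integrable_fubini_swap.
Qed.

Lemma Rintegral_fubini :
  \int[m1]_x \int[m2]_y f (x, y) = \int[m2]_y \int[m1]_x f (x, y).
Proof. by rewrite Rintegral_fubini1 Rintegral_fubini2. Qed.

End integrable_kernel.

Lemma integrable_prod_dominated (f : T1 * T2 -> R) (a : T1 -> R) (b : T2 -> R) :
  measurable_fun setT f -> (forall x y, `|f (x, y)| <= a x * b y) ->
  m1.-integrable setT (EFin \o a) -> m2.-integrable setT (EFin \o b) ->
  (m1 \x m2)%E.-integrable setT (EFin \o f).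
Proof.
move=> mf fab ia ib; apply/integrable12ltyP; first exact/measurable_EFinP.
have ma : measurable_fun setT a by exact/measurable_EFinP/(measurable_int _ ia).
have mb : measurable_fun setT b by exact/measurable_EFinP/(measurable_int _ ib).
pose B := (\int[m2]_y `|b y|%:E)%E.
have B0 : (0 <= B)%E by apply: integral_ge0 => y _; rewrite lee_fin.
have By : (B < +oo)%E by move/integrableP : ib => [].
apply: (@le_lt_trans _ _ (\int[m1]_x (`|a x|%:E * B))%E); last first.
  rewrite ge0_integralZr//.
  - apply: lte_mul_pinfty => //; first exact: integral_ge0.
    rewrite ge0_fin_numE; first by move/integrableP : ia => [].
    exact: integral_ge0.
  - by apply/measurable_EFinP; exact: measurableT_comp.
have mx x : measurable_fun setT (fun y => f (x, y)).
  by apply: (measurableT_comp mf); exact: pair1_measurable.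
apply: ge0_le_integral => //.
- by move=> x _; exact: integral_ge0.
- apply: (measurable_fun_fubini_tonelli_F (abse \o (EFin \o f))) => //=.
  by apply: measurableT_comp => //; exact/measurable_EFinP.
- apply: emeasurable_funM => //.
  by apply/measurable_EFinP; exact: measurableT_comp.
- move=> x _; rewrite /B -ge0_integralZl//.
  + apply: ge0_le_integral => //.
    * by apply: measurableT_comp => //; exact/measurable_EFinP.
    * by apply: emeasurable_funM => //; apply/measurable_EFinP; exact: measurableT_comp.
    * move=> y _; rewrite lee_fin -normrM (le_trans (fab _ _))// ler_norm//.
  + by apply/measurable_EFinP; exact: measurableT_comp.
Qed.

Lemma Rintegral_prodM (f : T1 -> R) (g : T2 -> R) :
  m1.-integrable setT (EFin \o f) -> m2.-integrable setT (EFin \o g) ->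
  \int[(m1 \x m2)%E]_z (f z.1 * g z.2) = \int[m1]_x f x * \int[m2]_y g y.
Proof.
move=> intf intg.
have mf : measurable_fun setT f by exact/measurable_EFinP/(measurable_int _ intf).
have mg : measurable_fun setT g by exact/measurable_EFinP/(measurable_int _ intg).
rewrite -(@Rintegral_fubini1 (fun z => f z.1 * g z.2)).
  rewrite -RintegralZr//; apply: eq_Rintegral => x _ /=.
  by rewrite RintegralZl.
apply: (@integrable_prod_dominated _ (fun x => `|f x|) (fun x => `|g x|)).
- by apply: measurable_funM; exact: measurableT_comp.
- by move=> x y; rewrite normrM.
- by move/integrable_abse : intf.
- by move/integrable_abse : intg.
Qed.

End real_fubini.

Section gaussian_kernel.
Context {R : realType}.

Lemma measurable_cos : measurable_fun setT (@cos R).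
Proof. by apply: continuous_measurable_fun; exact: continuous_cos. Qed.

Lemma measurable_sin : measurable_fun setT (@sin R).
Proof. by apply: continuous_measurable_fun; exact: continuous_sin. Qed.

Lemma tnth_vcons0 n x (t : Rvec R n) : tnth (vcons (x, t)) ord0 = x.
Proof. by []. Qed.

Lemma tnth_vconsS n x (t : Rvec R n) j :
  tnth (vcons (x, t)) (lift ord0 j) = tnth t j.
Proof. by rewrite /vcons tnthS. Qed.

Lemma ge0_integral_lebesgue_nS n (f : Rvec R n.+1 -> \bar R) :
  measurable_fun setT f -> (forall x, (0 <= f x)%E) ->
  (\int[lebesgue_n n.+1]_x f x =
   \int[lebesgue_measure]_x \int[lebesgue_n n]_t f (vcons (x, t)))%E.
Proof.
move=> mf f0; rewrite /= ge0_integral_pushforward//; last exact: measurable_vcons.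
rewrite preimage_setT fubini_tonelli1//.
- by apply: measurableT_comp => //; exact: measurable_vcons.
- by move=> x; exact: f0.
Qed.

(** Tonelli, one coordinate at a time. Values in the extended reals allow infinite factors, as in
    the computation for hyperplanes. *)
Lemma integral_lebesgue_n_prod n (f : 'I_n -> R -> R) :
  (forall j, measurable_fun setT (f j)) -> (forall j x, 0 <= f j x) ->
  (\int[lebesgue_n n]_x (\prod_(j < n) f j (tnth x j))%:E =
   \prod_(j < n) \int[@lebesgue_measure R]_x (f j x)%:E)%E.
Proof.
elim: n f => [|n IH] f mf f0.
  rewrite big_ord0; under eq_integral do rewrite big_ord0.
  by rewrite integral_cst//= diracT mule1.
have mtn m j : measurable_fun setT (fun x : Rvec R m => tnth x j).
  exact: measurable_tnth.
rewrite ge0_integral_lebesgue_nS.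
- rewrite big_ord_recl -IH//.
  under eq_integral => x _.
    under eq_integral => t _.
      rewrite big_ord_recl tnth_vcons0 EFinM.
      under eq_bigr do rewrite tnth_vconsS.
      over.
    rewrite ge0_integralZl//=.
      over.
    + apply/measurable_EFinP/measurable_prod => j _.
      exact: (measurableT_comp (mf (lift ord0 j)) (mtn n j)).
    + by move=> t _; rewrite lee_fin prodr_ge0.
    + by rewrite lee_fin.
  rewrite ge0_integralZr//=.
  + apply/measurable_EFinP; exact: mf.
  + by move=> x _; rewrite lee_fin.
  + by apply: integral_ge0 => t _; rewrite lee_fin prodr_ge0.
- apply/measurable_EFinP/measurable_prod => j _.
  exact: (measurableT_comp (mf j) (mtn n.+1 j)).
- by move=> x; rewrite lee_fin prodr_ge0.
Qed.

Lemma integrable_vcons n (f : Rvec R n.+1 -> R) :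
  (lebesgue_n n.+1).-integrable setT (EFin \o f) ->
  (@lebesgue_measure R \x lebesgue_n n)%E.-integrable setT
     (EFin \o (f \o @vcons R n)).
Proof.
move=> /integrableP[mf]; rewrite /= ge0_integral_pushforward//=.
- move=> fy; apply/integrableP; split => //.
  by apply: (measurableT_comp mf); exact: measurable_vcons.
- exact: measurable_vcons.
- move/measurable_EFinP : mf => mf.
  by apply/measurable_EFinP; exact: measurableT_comp.
Qed.

Lemma Rintegral_lebesgue_nS n (f : Rvec R n.+1 -> R) :
  (lebesgue_n n.+1).-integrable setT (EFin \o f) ->
  \int[lebesgue_n n.+1]_x f x =
  \int[lebesgue_measure]_x \int[lebesgue_n n]_t f (vcons (x, t)).
Proof.
move=> intf; have intfv := integrable_vcons intf.
rewrite (Rintegral_fubini1 intfv) /Rintegral; congr fine.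
rewrite /= (@integral_pushforward _ _ _ _ _ _ _ _ _ (EFin \o f))//.
- exact: measurable_vcons.
- exact: measurable_int intf.
Qed.

(** Unnormalized Gaussian [exp(-|s x|^2 / 2)], written as a product so that integrals split over the
    coordinates. The parameter is the inverse of the standard deviation: a small [s] is a mild
    damping, and [s^-1] is the scale on the Fourier side. *)
Definition gaussn n (s : R) (x : Rvec R n) : R :=
  \prod_(j < n) expR (- (s * tnth x j) ^+ 2 / 2).

(* The integral of [gaussn s] over R: [normal_peak s^-1] normalizes the normal
   density of standard deviation [s^-1]. *)
Definition gaussn_mass (s : R) : R := (normal_peak s^-1)^-1.

(** [gaussn_mass s] is [sqrt(2 pi) / s], so masses at dual scales multiply to [2 pi]. This cancels
    the [(2 pi)^-n] of the inverse transform and makes the damped Plancherel bound independent of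
    the damping. *)
Lemma gaussn_massM (s : R) : 0 < s -> gaussn_mass s * gaussn_mass s^-1 = 2 * pi.
Proof.
move=> s0; rewrite /gaussn_mass invrK -invfM /normal_peak -invfM invrK.
have pi0 := @pi_gt0 R.
rewrite -sqrtrM; last by rewrite mulrn_wge0// mulr_ge0 ?sqr_ge0 ?pi_ge0.
rewrite (_ : (_ *+ 2) * (_ *+ 2) = (2 * pi) ^+ 2).
  by rewrite sqrtr_sqr ger0_norm// mulr_ge0// ltW.
move: (pi) => p; field.
by rewrite gt_eqF.
Qed.

Lemma gaussn_mass_gt0 (s : R) : 0 < s -> 0 < gaussn_mass s.
Proof. by move=> s0; rewrite invr_gt0 normal_peak_gt0// invr_neq0// gt_eqF. Qed.

Lemma expR_normal_pdf (s m x : R) : 0 < s ->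
  expR (- (s * (x - m)) ^+ 2 / 2) = gaussn_mass s * normal_pdf m s^-1 x.
Proof.
move=> s0; have sn0 : s != 0 by rewrite gt_eqF.
rewrite normal_pdfE ?invr_neq0// /gaussn_mass mulrA mulVf ?mul1r; last first.
  by rewrite gt_eqF// normal_peak_gt0// invr_neq0.
by rewrite /normal_fun; congr expR; rewrite -mulr_natr; field.
Qed.

Lemma integral_expR_sqr (s m : R) : 0 < s ->
  (\int[@lebesgue_measure R]_x (expR (- (s * (x - m)) ^+ 2 / 2))%:E =
    (gaussn_mass s)%:E)%E.
Proof.
move=> s0; under eq_integral do rewrite expR_normal_pdf// EFinM.
rewrite integralZl//; last exact: integrable_normal_pdf.
by rewrite integral_normal_pdf mule1.
Qed.

Lemma measurable_expR_sqr (s m : R) :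
  measurable_fun setT (fun x : R => expR (- (s * (x - m)) ^+ 2 / 2)).
Proof.
apply: measurableT_comp => //; apply: measurable_funM => //.
apply: measurableT_comp => //; apply: measurable_funX => //.
by apply: measurable_funM => //; exact: measurable_funB.
Qed.

Definition vsub n (x y : Rvec R n) : Rvec R n :=
  [tuple tnth x j - tnth y j | j < n].

Lemma tnth_vsub n (x y : Rvec R n) j : tnth (vsub x y) j = tnth x j - tnth y j.
Proof. by rewrite tnth_mktuple. Qed.

Lemma dotv_vsubl n (x y z : Rvec R n) : dotv (vsub x y) z = dotv x z - dotv y z.
Proof.
rewrite /dotv -sumrB; apply: eq_bigr => j _.
by rewrite tnth_vsub mulrBl.
Qed.

Lemma dotvC n (x y : Rvec R n) : dotv x y = dotv y x.
Proof. by apply: eq_bigr => j _; rewrite mulrC. Qed.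

Lemma gaussn_ge0 n s (x : Rvec R n) : 0 <= gaussn s x.
Proof. by apply: prodr_ge0 => j _; exact: expR_ge0. Qed.

Lemma gaussn_le1 n s (x : Rvec R n) : gaussn s x <= 1.
Proof.
apply: prodr_ile1 => j _; rewrite expR_ge0/= -[leRHS]expR0 ler_expR.
by rewrite mulNr oppr_le0 divr_ge0// sqr_ge0.
Qed.

Lemma gaussn_vsubC n s (x y : Rvec R n) : gaussn s (vsub x y) = gaussn s (vsub y x).
Proof.
apply: eq_bigr => j _; rewrite !tnth_vsub -opprB mulrN sqrrN//.
Qed.

Lemma integral_gaussn_vsub n (s : R) (z : Rvec R n) : 0 < s ->
  (\int[lebesgue_n n]_x (gaussn s (vsub x z))%:E = (gaussn_mass s ^+ n)%:E)%E.
Proof.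
move=> s0.
under eq_integral => x _.
  rewrite /gaussn; under eq_bigr do rewrite tnth_vsub; over.
rewrite (@integral_lebesgue_n_prod n
  (fun j x => expR (- (s * (x - tnth z j)) ^+ 2 / 2))).
- under eq_bigr do rewrite integral_expR_sqr//.
  by rewrite -(big_morph EFin EFinM erefl) prodr_const card_ord.
- by move=> j; exact: measurable_expR_sqr.
- by move=> j x; exact: expR_ge0.
Qed.

Lemma measurable_gaussn n (s : R) : measurable_fun setT (@gaussn n s).
Proof.
apply: measurable_prod => j _; have := @measurable_expR_sqr s 0.
under eq_fun do rewrite subr0.
by move=> /measurableT_comp; apply; exact: measurable_tnth.
Qed.

Lemma gaussn_vcons n s x (t : Rvec R n) :
  gaussn s (vcons (x, t)) = expR (- (s * x) ^+ 2 / 2) * gaussn s t.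
Proof.
rewrite /gaussn big_ord_recl tnth_vcons0; congr *%R.
by apply: eq_bigr => j _; rewrite tnth_vconsS.
Qed.

Lemma gaussn_behead n s (u : Rvec R n.+1) :
  gaussn s u = expR (- (s * tnth u ord0) ^+ 2 / 2) * gaussn s [tuple of behead u].
Proof. by rewrite {1}(tuple_eta u) (gaussn_vcons s _ [tuple of behead u]). Qed.

Lemma dotv_vcons n (u : Rvec R n.+1) x (t : Rvec R n) :
  dotv u (vcons (x, t)) = tnth u ord0 * x + dotv [tuple of behead u] t.
Proof.
rewrite /dotv big_ord_recl tnth_vcons0; congr +%R.
apply: eq_bigr => j _; rewrite tnth_vconsS.
by rewrite {1}(tuple_eta u) tnthS.
Qed.

Lemma vsub0 n (x : Rvec R n) : vsub x [tuple 0 | _ < n] = x.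
Proof. by apply: eq_from_tnth => j; rewrite tnth_vsub tnth_mktuple subr0. Qed.

Lemma integrable_gaussn n (s : R) : 0 < s ->
  (lebesgue_n n).-integrable setT (EFin \o @gaussn n s).
Proof.
move=> s0; apply/integrableP; split.
  by apply/measurable_EFinP; exact: measurable_gaussn.
under eq_integral do rewrite /= ger0_norm ?gaussn_ge0// -[X in gaussn _ X]vsub0.
by rewrite integral_gaussn_vsub// ltry.
Qed.

Lemma measurable_dotv n (u : Rvec R n) : measurable_fun setT (dotv u).
Proof.
apply: measurable_sum => j _; apply: measurable_funM => //.
exact: measurable_tnth.
Qed.

Lemma integrable_gaussn_cos n (s : R) (u : Rvec R n) (c : R) : 0 < s ->
  (lebesgue_n n).-integrable setT
    (EFin \o (fun x => cos (dotv u x + c) * gaussn s x)).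
Proof.
move=> s0; apply: integrable_dominated (integrable_gaussn n s0).
- apply: measurable_funM; last exact: measurable_gaussn.
  apply: (measurableT_comp measurable_cos).
  by apply: measurable_funD => //; exact: measurable_dotv.
- move=> x; rewrite normrM (ger0_norm (gaussn_ge0 _ _)).
  by rewrite ler_piMl ?gaussn_ge0// ler_norml cos_geN1 cos_le1.
Qed.

(** The phase [c] makes the induction run: for a fixed first coordinate [x], the integral over the
    others has phase [tnth u ord0 * x + c]. The choice [c = - pi / 2] also covers the sine. *)
Lemma Rintegral_gaussn_cos n (s : R) (u : Rvec R n) (c : R) : 0 < s ->
  \int[lebesgue_n n]_x (cos (dotv u x + c) * gaussn s x) =
  cos c * gaussn_mass s ^+ n * gaussn s^-1 u.
Proof.
move=> s0; elim: n u c => [|n IH] u c.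
  rewrite expr0 mulr1 /gaussn big_ord0 mulr1.
  under eq_Rintegral do rewrite /dotv !big_ord0 add0r mulr1.
  by rewrite /Rintegral integral_cst// [X in (_ * X)%E]diracT mule1.
rewrite Rintegral_lebesgue_nS.
  transitivity (\int[lebesgue_measure]_x
     (gaussn_mass s ^+ n * gaussn s^-1 [tuple of behead u] *
       (cos (tnth u ord0 * (x - 0) + c) * expR (- (s * (x - 0)) ^+ 2 / 2)))).
    apply: eq_Rintegral => x _; rewrite !subr0.
    under eq_Rintegral => t _.
      rewrite dotv_vcons (addrC (_ * x)) -addrA gaussn_vcons mulrCA; over.
    rewrite RintegralZl//; first by rewrite IH; ring.
    exact: integrable_gaussn_cos.
  have icos : (@lebesgue_measure R).-integrable setT (EFin \o (fun x =>
      cos (tnth u ord0 * (x - 0) + c) * normal_pdf 0 s^-1 x)).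
    apply: integrable_normal_pdf_bounded => [|x].
      apply: (measurableT_comp measurable_cos).
      apply: measurable_funD => //; apply: measurable_funM => //.
      exact: measurable_funB.
    by rewrite ler_norml cos_geN1 cos_le1.
  transitivity (\int[lebesgue_measure]_x
     (gaussn_mass s ^+ n * gaussn s^-1 [tuple of behead u] * gaussn_mass s *
       (cos (tnth u ord0 * (x - 0) + c) * normal_pdf 0 s^-1 x))).
    by apply: eq_Rintegral => x _; rewrite expR_normal_pdf//; ring.
  rewrite RintegralZl// Rintegral_normal_pdf_cos ?invr_gt0//.
  by rewrite (gaussn_behead _ u) [gaussn_mass s ^+ n.+1]exprS; ring.
exact: integrable_gaussn_cos.
Qed.

End gaussian_kernel.

(** * Plancherel's inequality *)

Section general_integration.
Context d (T : measurableType d) (R : realType) (mu : {measure set T -> \bar R}).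

(** Used each time a damping or a truncation is removed under a uniform bound. *)
Lemma fatou_cvg_le (f_ : nat -> T -> \bar R) (f : T -> \bar R) (M : \bar R) :
  (forall k, measurable_fun setT (f_ k)) -> (forall k x, 0 <= f_ k x)%E ->
  (forall x, f_ ^~ x @ \oo --> f x) ->
  (forall k, \int[mu]_x f_ k x <= M)%E -> (\int[mu]_x f x <= M)%E.
Proof.
move=> mf f0 ff fM.
have := @fatou _ _ _ mu setT measurableT f_ mf (fun n x _ => f0 n x).
rewrite (eq_integral f) => [h|x _]; last first.
  exact: (cvg_limn_einf_sup (ff x)).1.
apply: (le_trans h); rewrite limn_einf_lim; apply: lime_le; first exact: is_cvg_einfs.
apply: nearW => n; apply: le_trans (fM n).
by apply: ereal_inf_lbound; exists n => //=.
Qed.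

Lemma integral_le_dominated (f h : T -> R) :
  measurable_fun setT f -> measurable_fun setT h -> (forall x, `|f x| <= h x) ->
  (\int[mu]_x (f x)%:E <= \int[mu]_x (h x)%:E)%E.
Proof.
move=> mf mh fh; apply: le_trans (lee_abs _) _.
apply: le_trans; first by apply: le_abse_integral => //; exact/measurable_EFinP.
apply: ge0_le_integral => //.
- by apply/measurable_EFinP; exact: measurableT_comp.
- exact/measurable_EFinP.
- by move=> x _; rewrite lee_fin.
Qed.

Lemma Rintegral_EFin (f : T -> R) : mu.-integrable setT (EFin \o f) ->
  (\int[mu]_x f x)%:E = (\int[mu]_x (f x)%:E)%E.
Proof. by move=> intf; rewrite fineK//; exact: integrable_fin_num. Qed.

Lemma integrable_EFinB (f h : T -> R) :
  mu.-integrable setT (EFin \o f) -> mu.-integrable setT (EFin \o h) ->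
  mu.-integrable setT (EFin \o (fun x => f x - h x)).
Proof. exact: integrableB. Qed.

Lemma integrable_measurable (f : T -> R) :
  mu.-integrable setT (EFin \o f) -> measurable_fun setT f.
Proof. by move=> /measurable_int/measurable_EFinP. Qed.

End general_integration.

(** Tonelli gives measurability for the positive and the negative part separately, and [fine] of the
    difference is measurable. *)
Lemma measurable_Rintegral_param d1 d2 (T1 : measurableType d1)
    (T2 : measurableType d2) (R : realType)
    (m2 : {sigma_finite_measure set T2 -> \bar R}) (g : T1 * T2 -> R) :
  measurable_fun setT g -> measurable_fun setT (fun x => \int[m2]_y g (x, y)).
Proof.
move=> mg; have mEg : measurable_fun setT (EFin \o g) by exact/measurable_EFinP.
have -> : (fun x => \int[m2]_y g (x, y)) = fun x =>
    fine ((fubini_F m2 (EFin \o g)^\+ x - fubini_F m2 (EFin \o g)^\- x)%E).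
  apply/funext => x; congr fine; rewrite integralE /fubini_F.
  by congr (_ - _)%E; apply: eq_integral => y _; rewrite /= ?funeposE ?funenegE.
apply: measurableT_comp => //; apply: emeasurable_funB.
- apply: measurable_fun_fubini_tonelli_F => //; exact: measurable_funepos.
- apply: measurable_fun_fubini_tonelli_F => //; exact: measurable_funeneg.
Qed.

Section measurable_vectors.
Context d (T : measurableType d) (R : realType) (n : nat).
Implicit Types f g : T -> Rvec R n.

Lemma measurable_dotv2 f g : measurable_fun setT f -> measurable_fun setT g ->
  measurable_fun setT (fun t => dotv (f t) (g t)).
Proof.
move=> /measurable_fun_tnthP mf /measurable_fun_tnthP mg.
apply: measurable_sum => j; apply: measurable_funM; [exact: mf|exact: mg].
Qed.

Lemma measurable_vsub2 f g : measurable_fun setT f -> measurable_fun setT g ->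
  measurable_fun setT (fun t => vsub (f t) (g t)).
Proof.
move=> /measurable_fun_tnthP mf /measurable_fun_tnthP mg.
apply/measurable_fun_tnthP => j.
rewrite (_ : _ \o _ = fun t => tnth (f t) j - tnth (g t) j).
  by apply: measurable_funB; [exact: mf|exact: mg].
by apply/funext => t /=; rewrite tnth_vsub.
Qed.

End measurable_vectors.

Lemma cvg_gaussn (R : realType) n (x : Rvec R n) :
  gaussn k.+1%:R^-1 x @[k --> \oo] --> (1 : R).
Proof.
have cg : continuous (fun e : R => gaussn e x).
  rewrite /gaussn; apply: (@continuous_big R 'I_n *%R 1 predT).
    by move=> z; apply: cvgM; [exact: cvg_fst|exact: cvg_snd].
  move=> j _; apply: derivable_continuous => e; exact: ex_derive.
have g0 : gaussn 0 x = 1.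
  by apply: big1 => j _; rewrite mul0r expr0n/= oppr0 mul0r expR0.
rewrite -[X in _ --> X]g0.
apply: (cvg_comp _ (fun e : R => gaussn e x)); last exact: cg.
exact: cvg_harmonic.
Qed.

Lemma integrable_mul_gaussn d (T : measurableType d) (R : realType) (n : nat)
    (mu : {measure set T -> \bar R}) (X : T -> Rvec R n) (f : T -> R) (e : R) :
  measurable_fun setT X -> mu.-integrable setT (EFin \o f) ->
  mu.-integrable setT (EFin \o (fun z => f z * gaussn e (X z))).
Proof.
move=> mX intf; have mf := integrable_measurable intf.
apply: (@integrable_dominated _ _ _ _ _ (fun t => `|f t|)).
- by apply: measurable_funM => //; exact: (measurableT_comp (measurable_gaussn _)).
- move=> z; rewrite normrM (ger0_norm (gaussn_ge0 _ _)).
  by rewrite ler_piMr// gaussn_le1.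
- by move/integrable_abse : intf.
Qed.

Section trigonometric_transforms.
Context d (T : measurableType d) (R : realType) (n : nat).
Variables (nu : {sigma_finite_measure set T -> \bar R}) (X : T -> Rvec R n).
Hypothesis mX : measurable_fun setT X.

(** Together with [sin_transform], a common form of three transforms: [f = 1] and [X] a path give
    the transform of the occupation measure; [X = id] and Lebesgue measure give the ordinary Fourier
    transform; [X = diff_pair] on the product space gives a squared modulus. *)
Definition cos_transform (f : T -> R) (x : Rvec R n) : R :=
  \int[nu]_t (cos (dotv (X t) x) * f t).

Definition sin_transform (f : T -> R) (x : Rvec R n) : R :=
  \int[nu]_t (sin (dotv (X t) x) * f t).

Variable f : T -> R.
Hypothesis intf : nu.-integrable setT (EFin \o f).

Let mf : measurable_fun setT f. Proof. exact: integrable_measurable intf. Qed.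

Let mdot x : measurable_fun setT (fun t => dotv (X t) x).
Proof. exact: measurable_dotv2. Qed.

Lemma integrable_cos_mul (x : Rvec R n) :
  nu.-integrable setT (EFin \o (fun t => cos (dotv (X t) x) * f t)).
Proof.
apply: (@integrable_dominated _ _ _ _ _ (fun t => `|f t|)).
- by apply: measurable_funM => //; exact: (measurableT_comp measurable_cos).
- by move=> t; rewrite normrM ler_piMl// ler_norml cos_geN1 cos_le1.
- by move/integrable_abse : intf.
Qed.

Lemma integrable_sin_mul (x : Rvec R n) :
  nu.-integrable setT (EFin \o (fun t => sin (dotv (X t) x) * f t)).
Proof.
apply: (@integrable_dominated _ _ _ _ _ (fun t => `|f t|)).
- by apply: measurable_funM => //; exact: (measurableT_comp measurable_sin).
- by move=> t; rewrite normrM ler_piMl// ler_norml sin_geN1 sin_le1.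
- by move/integrable_abse : intf.
Qed.

Lemma cos_sin_transform_ub (x : Rvec R n) :
  `|cos_transform f x| <= \int[nu]_t `|f t| /\
  `|sin_transform f x| <= \int[nu]_t `|f t|.
Proof.
have inf : nu.-integrable setT (EFin \o (fun t => `|f t|)).
  by move/integrable_abse : intf.
split.
- apply: (le_trans (le_normr_Rintegral _ (integrable_cos_mul x))) => //.
  apply: le_Rintegral => //; first by move/integrable_abse : (integrable_cos_mul x).
  by move=> t _; rewrite normrM ler_piMl// ler_norml cos_geN1 cos_le1.
- apply: (le_trans (le_normr_Rintegral _ (integrable_sin_mul x))) => //.
  apply: le_Rintegral => //; first by move/integrable_abse : (integrable_sin_mul x).
  by move=> t _; rewrite normrM ler_piMl// ler_norml sin_geN1 sin_le1.
Qed.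

Let mdot2 : measurable_fun setT (fun z : Rvec R n * T => dotv (X z.2) z.1).
Proof. by apply: measurable_dotv2 => //; exact: measurableT_comp. Qed.

Lemma measurable_cos_transform : measurable_fun setT (cos_transform f).
Proof.
apply: (@measurable_Rintegral_param _ _ _ _ _ nu
  (fun z => cos (dotv (X z.2) z.1) * f z.2)).
by apply: measurable_funM; [exact: (measurableT_comp measurable_cos)|
  exact: measurableT_comp].
Qed.

Lemma measurable_sin_transform : measurable_fun setT (sin_transform f).
Proof.
apply: (@measurable_Rintegral_param _ _ _ _ _ nu
  (fun z => sin (dotv (X z.2) z.1) * f z.2)).
by apply: measurable_funM; [exact: (measurableT_comp measurable_sin)|
  exact: measurableT_comp].
Qed.

Let F (e : R) (z : T * Rvec R n) := cos (dotv (X z.1) z.2) * f z.1 * gaussn e z.2.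

Let integrable_F (e : R) : 0 < e ->
  (nu \x lebesgue_n n)%E.-integrable setT (EFin \o F e).
Proof.
move=> e0; apply: (@integrable_prod_dominated _ _ _ _ _ _ _ (F e)
  (fun z => `|f z|) (@gaussn R n e)).
- apply: measurable_funM; last first.
    by apply: (measurableT_comp (measurable_gaussn _)).
  apply: measurable_funM; last exact: (measurableT_comp mf).
  apply: (measurableT_comp measurable_cos); apply: measurable_dotv2 => //.
  exact: (measurableT_comp mX).
- move=> z x; rewrite /F/= !normrM (ger0_norm (gaussn_ge0 _ _)).
  rewrite ler_wpM2r ?gaussn_ge0// ler_piMl//.
  by rewrite ler_norml cos_geN1 cos_le1.
- by move/integrable_abse : intf.
- exact: integrable_gaussn.
Qed.

Let cos_transform_gaussn (e : R) (x : Rvec R n) :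
  cos_transform f x * gaussn e x = \int[nu]_z F e (z, x).
Proof. by rewrite -RintegralZr//; exact: integrable_cos_mul. Qed.

Lemma integrable_cos_transform_gaussn (e : R) : 0 < e ->
  (lebesgue_n n).-integrable setT
    (EFin \o (fun x => cos_transform f x * gaussn e x)).
Proof.
move=> e0; have := integrable_Rintegral2 (integrable_F e0).
by congr (_.-integrable _ _); apply/funext => x /=; rewrite cos_transform_gaussn.
Qed.

(** Fubini, then the Gaussian transform at the point [X z]: damping with parameter [e] in frequency
    becomes an average of Gaussians of width [e] in space, visibly nonnegative for [f = 1]. *)
Lemma Rintegral_cos_transform_gaussn (e : R) : 0 < e ->
  \int[lebesgue_n n]_x (cos_transform f x * gaussn e x) =
  gaussn_mass e ^+ n * \int[nu]_z (f z * gaussn e^-1 (X z)).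
Proof.
move=> e0; under eq_Rintegral do rewrite cos_transform_gaussn.
rewrite -(Rintegral_fubini (integrable_F e0)) -RintegralZl//; last first.
  exact: integrable_mul_gaussn.
apply: eq_Rintegral => z _.
transitivity (f z * \int[lebesgue_n n]_x (cos (dotv (X z) x + 0) * gaussn e x)).
  rewrite -RintegralZl//; last exact: integrable_gaussn_cos.
  by apply: eq_Rintegral => x _; rewrite /F/= addr0; ring.
by rewrite Rintegral_gaussn_cos// cos0; ring.
Qed.

Let Fs (e : R) (z : T * Rvec R n) := sin (dotv (X z.1) z.2) * f z.1 * gaussn e z.2.

Let integrable_Fs (e : R) : 0 < e ->
  (nu \x lebesgue_n n)%E.-integrable setT (EFin \o Fs e).
Proof.
move=> e0; apply: (@integrable_prod_dominated _ _ _ _ _ _ _ (Fs e)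
  (fun z => `|f z|) (@gaussn R n e)).
- apply: measurable_funM; last first.
    by apply: (measurableT_comp (measurable_gaussn _)).
  apply: measurable_funM; last exact: (measurableT_comp mf).
  apply: (measurableT_comp measurable_sin); apply: measurable_dotv2 => //.
  exact: (measurableT_comp mX).
- move=> z x; rewrite /Fs/= !normrM (ger0_norm (gaussn_ge0 _ _)).
  rewrite ler_wpM2r ?gaussn_ge0// ler_piMl//.
  by rewrite ler_norml sin_geN1 sin_le1.
- by move/integrable_abse : intf.
- exact: integrable_gaussn.
Qed.

Lemma Rintegral_sin_transform_gaussn (e : R) : 0 < e ->
  \int[lebesgue_n n]_x (sin_transform f x * gaussn e x) = 0.
Proof.
move=> e0; transitivity (\int[lebesgue_n n]_x \int[nu]_z Fs e (z, x)).
  apply: eq_Rintegral => x _.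
  by rewrite -RintegralZr//; exact: integrable_sin_mul.
rewrite -(Rintegral_fubini (integrable_Fs e0)).
transitivity (\int[nu]_z (0 : R)); last by rewrite Rintegral_cst// mul0r.
apply: eq_Rintegral => z _.
(* The sine is a cosine of phase [- pi / 2], and the Gaussian integral then carries the factor
   [cos (- pi / 2) = 0]. *)
transitivity (f z * \int[lebesgue_n n]_x (cos (dotv (X z) x + - (pi / 2)) * gaussn e x)).
  rewrite -RintegralZl//; last exact: integrable_gaussn_cos.
  by apply: eq_Rintegral => x _; rewrite /Fs/= cosBpihalf; ring.
by rewrite Rintegral_gaussn_cos// cosN cos_pihalf !(mul0r, mulr0).
Qed.

End trigonometric_transforms.

Section measure_square.
Context d (T : measurableType d) (R : realType).
Variable nu : {sigma_finite_measure set T -> \bar R}.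

(* The product [nu \x nu] has no canonical sigma-finite structure; this alias
   carries one. *)
Definition measure_square : set (T * T) -> \bar R := (nu \x nu)%E.

HB.instance Definition _ := Measure.on measure_square.

Lemma measure_square_sigma_finite : sigma_finite setT measure_square.
Proof.
have /sigma_finiteP[F [TF ndF Foo]] := sigma_finiteT nu.
exists (fun k => F k `*` F k).
  rewrite -setXTT [in LHS]TF predeqE => -[x y]; split.
    move=> [/= [k _ Fkx] [l _ Gly]]; exists (maxn k l) => //; split.
    - by move: x Fkx; exact/subsetPset/ndF/leq_maxl.
    - by move: y Gly; exact/subsetPset/ndF/leq_maxr.
  by move=> [k _ []/= ? ?]; split; exists k.
move=> k; have [? ?] := Foo k; split; first exact: measurableX.
by rewrite /measure_square product_measure1E// lte_mul_pinfty// ge0_fin_numE.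
Qed.

HB.instance Definition _ := Measure_isSigmaFinite.Build _ _ _
  measure_square measure_square_sigma_finite.

End measure_square.

Section squared_transforms.
Context d (T : measurableType d) (R : realType) (n : nat).
Variables (nu : {sigma_finite_measure set T -> \bar R}) (X : T -> Rvec R n).
Hypothesis mX : measurable_fun setT X.
Variable f : T -> R.
Hypothesis intf : nu.-integrable setT (EFin \o f).

Let integrable_prod_self (g : T -> R) : nu.-integrable setT (EFin \o g) ->
  (nu \x nu)%E.-integrable setT (EFin \o (fun z => g z.1 * g z.2)).
Proof.
move=> intg; have mg := integrable_measurable intg.
apply: (@integrable_prod_dominated _ _ _ _ _ _ _ _
  (fun x => `|g x|) (fun x => `|g x|)) => //.
- by apply: measurable_funM; exact: measurableT_comp.
- by move=> *; rewrite normrM.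
- by move/integrable_abse : intg.
- by move/integrable_abse : intg.
Qed.

Definition diff_pair (z : T * T) : Rvec R n := vsub (X z.1) (X z.2).

Lemma measurable_diff_pair : measurable_fun setT diff_pair.
Proof. by apply: measurable_vsub2; exact: (measurableT_comp mX). Qed.

Lemma integrable_diff_pair :
  (measure_square nu).-integrable setT (EFin \o (fun z => f z.1 * f z.2)).
Proof. exact: integrable_prod_self. Qed.

(** By [cos a cos b + sin a sin b = cos (a - b)], a squared modulus is again a cosine transform, of
    differences on the product space. Plancherel's inequality and the second moment of the transform
    of the path both start here. *)
Lemma sqr_cos_sin_transform (x : Rvec R n) :
  cos_transform nu X f x ^+ 2 + sin_transform nu X f x ^+ 2 =
  cos_transform (measure_square nu) diff_pair (fun z => f z.1 * f z.2) x.
Proof.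
have ic := integrable_cos_mul mX intf x.
have isn := integrable_sin_mul mX intf x.
rewrite !expr2 -!Rintegral_prodM// -RintegralD//.
- by apply: eq_Rintegral => z _; rewrite dotv_vsubl cosB; ring.
- exact: (integrable_prod_self ic).
- exact: (integrable_prod_self isn).
Qed.

End squared_transforms.

Section plancherel_inequality.
Context (R : realType) (n : nat).
Variable f : Rvec R n -> R.
Hypothesis intf : (lebesgue_n n).-integrable setT (EFin \o f).

Let mf : measurable_fun setT f. Proof. exact: integrable_measurable intf. Qed.
Let mid : measurable_fun setT (@id (Rvec R n)). Proof. exact: measurable_id. Qed.
Let c := cos_transform (lebesgue_n n) id f.
Let s := sin_transform (lebesgue_n n) id f.
Let mc : measurable_fun setT c. Proof. exact: measurable_cos_transform. Qed.
Let ms : measurable_fun setT s. Proof. exact: measurable_sin_transform. Qed.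
Let mcs : measurable_fun setT (fun x => c x ^+ 2 + s x ^+ 2).
Proof. by apply: measurable_funD; exact: measurable_funX. Qed.

Let integral_sqr_gaussn (e : R) : 0 < e ->
  (\int[(lebesgue_n n \x lebesgue_n n)%E]_z (f z.1 ^+ 2 * gaussn e (vsub z.1 z.2))%:E =
   \int[lebesgue_n n]_y (f y ^+ 2)%:E * (gaussn_mass e ^+ n)%:E)%E.
Proof.
move=> e0.
rewrite (fubini_tonelli1 (fun z => (f z.1 ^+ 2 * gaussn e (vsub z.1 z.2))%:E)).
- rewrite -ge0_integralZr//.
  + apply: eq_integral => y _; rewrite /fubini_F /=.
    under eq_integral do rewrite gaussn_vsubC EFinM.
    rewrite ge0_integralZl//; first by rewrite integral_gaussn_vsub.
    * apply/measurable_EFinP/(measurableT_comp (measurable_gaussn _)).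
      exact: measurable_vsub2.
    * by move=> x _; rewrite lee_fin gaussn_ge0.
    * by rewrite lee_fin sqr_ge0.
  + by apply/measurable_EFinP; exact: measurable_funX.
  + by move=> y _; rewrite lee_fin sqr_ge0.
  + by rewrite lee_fin exprn_ge0// ltW// gaussn_mass_gt0.
- apply/measurable_EFinP/measurable_funM.
    by apply: measurable_funX; exact: measurableT_comp.
  by apply: (measurableT_comp (measurable_gaussn _)); exact: measurable_vsub2.
- by move=> z; rewrite lee_fin mulr_ge0 ?gaussn_ge0// sqr_ge0.
Qed.

Let integral_sqr_gaussn2 (e : R) : 0 < e ->
  (\int[(lebesgue_n n \x lebesgue_n n)%E]_z (f z.2 ^+ 2 * gaussn e (vsub z.1 z.2))%:E =
   \int[lebesgue_n n]_y (f y ^+ 2)%:E * (gaussn_mass e ^+ n)%:E)%E.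
Proof.
move=> e0; rewrite -integral_sqr_gaussn//.
have mg : measurable_fun setT
    (fun z : Rvec R n * Rvec R n => gaussn e (vsub z.1 z.2)).
  by apply: (measurableT_comp (measurable_gaussn _)); exact: measurable_vsub2.
rewrite (fubini_tonelli1 (fun z => (f z.1 ^+ 2 * gaussn e (vsub z.1 z.2))%:E)).
rewrite (fubini_tonelli2 (fun z => (f z.2 ^+ 2 * gaussn e (vsub z.1 z.2))%:E)).
- apply: eq_integral => y _; apply: eq_integral => x _ /=.
  by rewrite gaussn_vsubC.
- apply/measurable_EFinP/measurable_funM => //.
  by apply: measurable_funX; exact: measurableT_comp.
- by move=> z; rewrite lee_fin mulr_ge0 ?gaussn_ge0// sqr_ge0.
- apply/measurable_EFinP/measurable_funM => //.
  by apply: measurable_funX; exact: measurableT_comp.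
- by move=> z; rewrite lee_fin mulr_ge0 ?gaussn_ge0// sqr_ge0.
Qed.

(* Expanding the squared transform gives the integral of f(y) f(z) G(y - z) for a
   Gaussian G, and 2 f(y) f(z) <= f(y)^2 + f(z)^2. *)
Lemma damped_plancherel_le (e : R) : 0 < e ->
  (\int[lebesgue_n n]_x ((c x ^+ 2 + s x ^+ 2) * gaussn e x)%:E <=
   ((2 * pi) ^+ n)%:E * \int[lebesgue_n n]_y (f y ^+ 2)%:E)%E.
Proof.
move=> e0; have ei0 : 0 < e^-1 by rewrite invr_gt0.
have mD : measurable_fun setT (@diff_pair _ _ R n (@id (Rvec R n))).
  exact: measurable_diff_pair.
have iff := integrable_diff_pair intf.
under eq_integral do rewrite sqr_cos_sin_transform//.
rewrite -Rintegral_EFin; last exact: integrable_cos_transform_gaussn.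
rewrite Rintegral_cos_transform_gaussn// -RintegralZl//; last first.
  exact: integrable_mul_gaussn.
rewrite Rintegral_EFin; last exact/integrable_EFinZ/integrable_mul_gaussn.
rewrite /diff_pair /measure_square.
pose k := gaussn_mass e ^+ n; rewrite -/k.
have k0 : 0 <= k by rewrite exprn_ge0// ltW// gaussn_mass_gt0.
pose G (z : Rvec R n * Rvec R n) := gaussn e^-1 (vsub z.1 z.2).
have mG : measurable_fun setT G.
  by apply: (measurableT_comp (measurable_gaussn _)); exact: measurable_vsub2.
have G0 z : 0 <= G z by exact: gaussn_ge0.
pose h (z : Rvec R n * Rvec R n) := k / 2 * (f z.1 ^+ 2 * G z + f z.2 ^+ 2 * G z).
have mf1 : measurable_fun setT (fun z : Rvec R n * Rvec R n => f z.1).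
  exact: measurableT_comp.
have mf2 : measurable_fun setT (fun z : Rvec R n * Rvec R n => f z.2).
  exact: measurableT_comp.
have mh1 : measurable_fun setT (fun z => f z.1 ^+ 2 * G z).
  by apply: measurable_funM => //; exact: measurable_funX.
have mh2 : measurable_fun setT (fun z => f z.2 ^+ 2 * G z).
  by apply: measurable_funM => //; exact: measurable_funX.
have h10 z : 0 <= f z.1 ^+ 2 * G z by rewrite mulr_ge0// sqr_ge0.
have h20 z : 0 <= f z.2 ^+ 2 * G z by rewrite mulr_ge0// sqr_ge0.
have c0 : (0 <= (k / 2)%:E)%E by rewrite lee_fin divr_ge0.
apply: (@le_trans _ _ (\int[(lebesgue_n n \x lebesgue_n n)%E]_z (h z)%:E)%E).
  apply: integral_le_dominated.
  - by do 2!apply: measurable_funM => //; apply: measurable_funM.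
  - by apply: measurable_funM => //; exact: measurable_funD.
  - move=> z; rewrite /h ler_norml; have := G0 z.
    rewrite -/(G z); move: (f z.1) (f z.2) (G z) => x y g g0.
    have := mulr_ge0 (mulr_ge0 k0 g0) (sqr_ge0 (x - y)).
    have := mulr_ge0 (mulr_ge0 k0 g0) (sqr_ge0 (x + y)).
    by move=> p q; apply/andP; split; lra.
under eq_integral do rewrite /h EFinM EFinD.
rewrite ge0_integralZl//.
- rewrite ge0_integralD//.
  + rewrite integral_sqr_gaussn// integral_sqr_gaussn2//.
    rewrite -(gaussn_massM e0) exprMn -/k.
    have : (0 <= \int[lebesgue_n n]_y (f y ^+ 2)%:E)%E.
      by apply: integral_ge0 => y _; rewrite lee_fin sqr_ge0.
    move: (\int[_]_y _)%E => J J0.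
    rewrite -ge0_muleDr ?lee_fin//; try by rewrite exprn_ge0// ltW// gaussn_mass_gt0.
    rewrite muleCA -EFinD -EFinM muleC.
    by rewrite (_ : k / 2 * _ = k * gaussn_mass e^-1 ^+ n)//; field.
  + by move=> z _; rewrite lee_fin.
  + exact/measurable_EFinP.
  + by move=> z _; rewrite lee_fin.
  + exact/measurable_EFinP.
- by apply: emeasurable_funD; exact/measurable_EFinP.
- by move=> z _; rewrite -EFinD lee_fin addr_ge0.
Qed.

(** The damped bound has a constant free of [e], so Fatou's lemma removes the damping. *)
Lemma plancherel_le :
  (\int[lebesgue_n n]_x (c x ^+ 2 + s x ^+ 2)%:E <=
   ((2 * pi) ^+ n)%:E * \int[lebesgue_n n]_y (f y ^+ 2)%:E)%E.
Proof.
apply: (@fatou_cvg_le _ _ _ _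
  (fun k x => ((c x ^+ 2 + s x ^+ 2) * gaussn k.+1%:R^-1 x)%:E)).
- move=> k; apply/measurable_EFinP/measurable_funM => //.
  exact: measurable_gaussn.
- by move=> k x; rewrite lee_fin mulr_ge0 ?gaussn_ge0// addr_ge0 ?sqr_ge0.
- move=> x; apply: cvg_EFin; first exact: nearW.
  rewrite -[X in _ --> X]mulr1; apply: cvgM; first exact: cvg_cst.
  exact: cvg_gaussn.
- by move=> k; apply: damped_plancherel_le; rewrite invr_gt0.
Qed.

End plancherel_inequality.

(** * Square-integrable limits and inverse transforms *)

(** Taking roots, [|u k.+1 - u k| <= sqrt c * 2^-k], so the telescoping series converges
    absolutely. *)
Lemma sqr_le_geometric_cvg (R : realType) (u : nat -> R) (c : R) : 0 <= c ->
  (forall k, 4 ^+ k * (u k.+1 - u k) ^+ 2 <= c) -> cvgn u.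
Proof.
move=> c0 uc.
have ub k : `|telescope u k| <= geometric (Num.sqrt c) 2^-1 k.
  rewrite -(@ler_pXn2r _ 2) ?nnegrE//=.
  rewrite real_normK ?num_real// exprMn sqr_sqrtr// -exprM mulnC exprM.
  rewrite exprVn (_ : 2 ^+ 2 = 4 :> R); last by rewrite -natrX.
  by rewrite exprVn ler_pdivlMr ?exprn_gt0// mulrC /telescope uc.
have : cvgn (series (telescope u)).
  apply: normed_cvg; apply: (@series_le_cvg _ _ (geometric (Num.sqrt c) 2^-1)) => //.
  - by move=> k; exact: normr_ge0.
  - by move=> k /=; rewrite mulr_ge0 ?sqrtr_ge0.
  - apply: is_cvg_geometric_series.
    by rewrite ger0_norm// invf_lt1// ltr1n.
rewrite telescopeK => cu.
have -> : u = (fun n => (u n - u 0%N) + u 0%N) by apply/funext => n; rewrite subrK.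
by apply: is_cvgD => //; exact: is_cvg_cst.
Qed.

Section L2_limit.
Context d (T : measurableType d) (R : realType) (mu : {measure set T -> \bar R}).
Variables (p : nat -> T -> R) (M : R).
Hypothesis M0 : 0 <= M.
Hypothesis mp : forall k, measurable_fun setT (p k).
Hypothesis pM : forall n m, (n <= m)%N ->
  (\int[mu]_x ((p n x - p m x) ^+ 2)%:E <= (M / 8 ^+ n)%:E)%E.

(** After integration, the weight [4^k] against the rate [8^-k] still leaves [M 2^-k]. Hence the
    limit [F] has integral at most [2 M], and [p k x] converges wherever [F x] is finite. *)
Let S n x : R := \sum_(k < n) 4 ^+ k * (p k.+1 x - p k x) ^+ 2.
Let F x := ereal_sup (range (fun n => (S n x)%:E)).

Let S_cvg x : (S n x)%:E @[n --> \oo] --> F x.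
Proof.
apply: ereal_nondecreasing_cvgn => n m nm; rewrite lee_fin.
rewrite /S (big_ord_widen m (fun k => 4 ^+ k * (p k.+1 x - p k x) ^+ 2))//.
rewrite [leRHS](bigID (fun k : 'I_m => (k < n)%N))/= lerDl.
by apply: sumr_ge0 => k _; rewrite mulr_ge0 ?sqr_ge0 ?exprn_ge0.
Qed.

Let mdp k : measurable_fun setT (fun x => (p k.+1 x - p k x) ^+ 2).
Proof. by apply: measurable_funX; exact: measurable_funB. Qed.

Let mS n : measurable_fun setT (S n).
Proof. by apply: measurable_sum => k; apply: measurable_funM. Qed.

Let mF : measurable_fun setT F.
Proof.
apply: (emeasurable_fun_cvg (fun n x => (S n x)%:E)) => [n|x _].
  exact/measurable_EFinP.
exact: S_cvg.
Qed.

Let S_ge0 n x : 0 <= S n x.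
Proof. by apply: sumr_ge0 => k _; rewrite mulr_ge0 ?sqr_ge0 ?exprn_ge0. Qed.

Let F_ge0 x : (0 <= F x)%E.
Proof. by apply: ereal_sup_ubound; exists 0%N => //; rewrite /S big_ord0. Qed.

Let integral_F : (\int[mu]_x F x <= (2 * M)%:E)%E.
Proof.
apply: (@fatou_cvg_le _ _ _ _ (fun n x => (S n x)%:E)) => //.
- by move=> n; exact/measurable_EFinP.
- move=> n; under eq_integral do rewrite /S -sumEFin.
  rewrite ge0_integral_sum//=; last 2 first.
    by move=> k; apply/measurable_EFinP; exact: measurable_funM.
    by move=> k x _; rewrite lee_fin mulr_ge0 ?sqr_ge0 ?exprn_ge0.
  apply: (@le_trans _ _ (\sum_(k < n) (M * 2^-1 ^+ k)%:E)%E).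
    apply: lee_sum => k _; under eq_integral do rewrite EFinM.
    rewrite ge0_integralZl//.
    + apply: (@le_trans _ _ ((4 ^+ k)%:E * (M / 8 ^+ k)%:E)%E).
        apply: lee_pmul => //; first by apply: integral_ge0 => x _; rewrite lee_fin sqr_ge0.
        rewrite (eq_integral (fun x => ((p k x - p k.+1 x) ^+ 2)%:E)); first exact: pM.
        by move=> x _; rewrite -sqrrN opprB.
      rewrite -EFinM lee_fin mulrCA ler_wpM2l//.
      rewrite -exprVn -exprMn (_ : 4 / 8 = 2^-1 :> R)//; by field.
    + exact/measurable_EFinP.
    + by move=> x _; rewrite lee_fin sqr_ge0.
  rewrite sumEFin lee_fin -mulr_sumr mulrC ler_wpM2r//.
  have -> : \sum_(k < n) (2^-1 : R) ^+ k = 2 - 2 * 2^-1 ^+ n.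
    elim: n => [|n IH]; first by rewrite big_ord0 expr0; ring.
    by rewrite big_ord_recr/= IH exprS; field.
  by rewrite lerBlDr lerDl mulr_ge0// exprn_ge0.
Qed.

Let E := [set x | F x < +oo]%E.

Let mE : measurable E.
Proof.
have := measurable_lte measurableT mF (measurable_cst +oo%E).
by rewrite setTI.
Qed.

(** Cutting off where [F] is infinite makes the sequence converge at every point, so the limit is
    measurable and inherits nonnegativity everywhere. *)
Let q k x : R := p k x * \1_E x.

Let mq k : measurable_fun setT (q k).
Proof. by apply: measurable_funM => //; exact: measurable_indic. Qed.

Let q_cvg x : cvgn (q ^~ x).
Proof.
rewrite /q indicE; have [xE|xE] := boolP (x \in E); last first.
  under eq_fun do rewrite mulr0. exact: is_cvg_cst.
under eq_fun do rewrite mulr1.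
have Fx : F x \is a fin_num by rewrite ge0_fin_numE//; exact: set_mem xE.
apply: (@sqr_le_geometric_cvg _ _ (fine (F x))); first exact: fine_ge0.
move=> k; rewrite -lee_fin fineK//.
apply: (@le_trans _ _ (S k.+1 x)%:E); last by apply: ereal_sup_ubound; exists k.+1.
by rewrite lee_fin /S big_ord_recr/= lerDr S_ge0.
Qed.

Lemma L2_limit : exists L : T -> R, [/\ measurable_fun setT L,
  forall n, (\int[mu]_x ((p n x - L x) ^+ 2)%:E <= (M / 8 ^+ n)%:E)%E &
  (forall n x, 0 <= p n x) -> forall x, 0 <= L x].
Proof.
pose L x := limn (q ^~ x).
have qL x : q n x @[n --> \oo] --> L x by exact: q_cvg.
have mL : measurable_fun setT L.
  by apply: (measurable_fun_cvg mq) => x _; exact: qL.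
have aeE : {ae mu, forall x, E x}.
  have iF : mu.-integrable setT F.
    apply/integrableP; split => //.
    under eq_integral do rewrite gee0_abs//.
    exact: le_lt_trans integral_F (ltry _).
  have := integrable_ae measurableT iF; apply: filterS => x /(_ I).
  by rewrite ge0_fin_numE.
exists L; split => // [n|p0 x]; last first.
  apply: limr_ge; first exact: q_cvg.
  by apply: nearW => k; rewrite mulr_ge0// indicE.
have -> : (\int[mu]_x ((p n x - L x) ^+ 2)%:E =
    \int[mu]_x ((q n x - L x) ^+ 2)%:E)%E.
  apply: ae_eq_integral => //.
  - by apply/measurable_EFinP/measurable_funX; exact: measurable_funB.
  - by apply/measurable_EFinP/measurable_funX; exact: measurable_funB.
  - by apply: filterS aeE => x Ex _; rewrite /q indicE mem_set// mulr1.
(* Fatou in the second index carries the Cauchy bound over to the limit. *)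
apply: (@fatou_cvg_le _ _ _ _ (fun m x => ((q n x - q (m + n)%N x) ^+ 2)%:E)).
- by move=> k; apply/measurable_EFinP/measurable_funX; exact: measurable_funB.
- by move=> k x; rewrite lee_fin sqr_ge0.
- move=> x; apply: cvg_EFin; first exact: nearW.
  apply: (@cvg_comp _ _ _ _ (fun z : R => z ^+ 2)); last exact: sqr_continuous.
  apply: cvgB; first exact: cvg_cst.
  by have := qL x; rewrite -(cvg_shiftn n).
- move=> k; apply: le_trans (pM (leq_addl k n)).
  apply: ge0_le_integral => //.
  + by move=> x _; rewrite lee_fin sqr_ge0.
  + by apply/measurable_EFinP/measurable_funX; exact: measurable_funB.
  + by apply/measurable_EFinP/measurable_funX; exact: measurable_funB.
  + move=> x _; rewrite lee_fin /q -mulrBl exprMn ler_piMr ?sqr_ge0//.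
Qed.

End L2_limit.

Lemma integral_le_lincomb d (T : measurableType d) (R : realType)
    (mu : {measure set T -> \bar R}) (f g h : T -> R) (a b : R) :
  measurable_fun setT f -> measurable_fun setT g -> measurable_fun setT h ->
  (forall x, 0 <= f x) -> (forall x, 0 <= g x) -> (forall x, 0 <= h x) ->
  0 <= a -> 0 <= b -> (forall x, f x <= a * g x + b * h x) ->
  (\int[mu]_x (f x)%:E <=
    a%:E * \int[mu]_x (g x)%:E + b%:E * \int[mu]_x (h x)%:E)%E.
Proof.
move=> mf mg mh f0 g0 h0 a0 b0 fgh.
have ag x : (0 <= (a * g x)%:E)%E by rewrite lee_fin mulr_ge0.
have bh x : (0 <= (b * h x)%:E)%E by rewrite lee_fin mulr_ge0.
rewrite -!ge0_integralZl//; try exact/measurable_EFinP;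
  try by move=> x _; rewrite lee_fin.
have Eag : measurable_fun setT (fun x => (a%:E * (g x)%:E)%E).
  by apply: emeasurable_funM => //; exact/measurable_EFinP.
have Ebh : measurable_fun setT (fun x => (b%:E * (h x)%:E)%E).
  by apply: emeasurable_funM => //; exact/measurable_EFinP.
rewrite -ge0_integralD//; try by move=> x _; rewrite -EFinM.
apply: ge0_le_integral => //.
- by move=> x _; rewrite lee_fin.
- exact/measurable_EFinP.
- exact: emeasurable_funD.
- by move=> x _; rewrite -!EFinM -EFinD lee_fin.
Qed.

Lemma ereal_cvg0_near_le (R : realType) (u : nat -> \bar R) (e : R) :
  (u k @[k --> \oo] --> 0)%E -> 0 < e -> \forall k \near \oo, (u k <= e%:E)%E.
Proof.
move=> u0 e0; have e0' : (0 < e%:E)%E by rewrite lte_fin.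
have h : \forall k \near \oo, (u k < e%:E)%E := u0 _ (open_ereal_lt' e0').
by apply: filterS h => k /ltW.
Qed.

Section inverse_transform.
Context (R : realType) (n : nat).
Implicit Types h g : Rvec R n -> R.
Notation lbn := (@lebesgue_n R n).

(* Real and imaginary parts of the inverse Fourier transform of h1 + i h2. *)
Definition ift_re h1 h2 (x : Rvec R n) : R :=
  (2 * pi) ^- n * (cos_transform lbn id h1 x + sin_transform lbn id h2 x).

Definition ift_im h1 h2 (x : Rvec R n) : R :=
  (2 * pi) ^- n * (cos_transform lbn id h2 x - sin_transform lbn id h1 x).

Let mid : measurable_fun setT (@id (Rvec R n)). Proof. exact: measurable_id. Qed.

(** Plancherel's [(2 pi)^n] meets the squared prefactor [(2 pi)^(-2n)]; the factor 2 is lost in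
    [(a + u)^2 <= 2 a^2 + 2 u^2], which separates the contributions of [h1] and [h2]. *)
Definition ift_bound : R := 2 * (2 * pi) ^- n.

Lemma ift_bound_ge0 : 0 <= ift_bound.
Proof. by rewrite mulr_ge0// invr_ge0 exprn_ge0// mulr_ge0// pi_ge0. Qed.

Section fixed_function.
Variables h1 h2 : Rvec R n -> R.
Hypotheses (ih1 : lbn.-integrable setT (EFin \o h1))
           (ih2 : lbn.-integrable setT (EFin \o h2)).

Lemma measurable_ift_re : measurable_fun setT (ift_re h1 h2).
Proof.
apply: measurable_funM => //; apply: measurable_funD.
- exact: measurable_cos_transform.
- exact: measurable_sin_transform.
Qed.

Lemma measurable_ift_im : measurable_fun setT (ift_im h1 h2).
Proof.
apply: measurable_funM => //; apply: measurable_funB.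
- exact: measurable_cos_transform.
- exact: measurable_sin_transform.
Qed.

Lemma ift_le : (\int[lbn]_x (ift_re h1 h2 x ^+ 2 + ift_im h1 h2 x ^+ 2)%:E <=
  ift_bound%:E * \int[lbn]_x (h1 x ^+ 2 + h2 x ^+ 2)%:E)%E.
Proof.
pose p : R := (2 * pi) ^+ n.
have p0 : 0 < p by rewrite exprn_gt0// mulr_gt0// pi_gt0.
have mh1 := integrable_measurable ih1.
have mh2 := integrable_measurable ih2.
have sq1 h : measurable_fun setT h -> forall x, (0 <= (h x ^+ 2)%:E)%E.
  by move=> _ x; rewrite lee_fin sqr_ge0.
pose g h x := cos_transform lbn id h x ^+ 2 + sin_transform lbn id h x ^+ 2.
have g0 h x : 0 <= g h x by rewrite addr_ge0 ?sqr_ge0.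
have mg h : lbn.-integrable setT (EFin \o h) -> measurable_fun setT (g h).
  move=> ih; apply: measurable_funD; apply: measurable_funX.
  - exact: measurable_cos_transform.
  - exact: measurable_sin_transform.
apply: (@le_trans _ _ ((2 / p ^+ 2)%:E * \int[lbn]_x (g h1 x)%:E +
    (2 / p ^+ 2)%:E * \int[lbn]_x (g h2 x)%:E)%E).
  apply: integral_le_lincomb => //.
  - apply: measurable_funD; apply: measurable_funX.
    + exact: measurable_ift_re.
    + exact: measurable_ift_im.
  - exact: mg.
  - exact: mg.
  - by move=> x; rewrite addr_ge0 ?sqr_ge0.
  - by rewrite divr_ge0// sqr_ge0.
  - by rewrite divr_ge0// sqr_ge0.
  - move=> x; rewrite -mulrDr /ift_re /ift_im -/p /g !exprMn exprVn -mulrDr.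
    rewrite [_ / p ^+ 2]mulrC -mulrA ler_wpM2l ?invr_ge0 ?sqr_ge0//.
    move: (cos_transform _ _ _ _) (cos_transform _ _ _ _).
    move: (sin_transform _ _ _ _) (sin_transform _ _ _ _).
    move=> u v a b; have := sqr_ge0 (b - v); have := sqr_ge0 (a + u).
    by rewrite !expr2; lra.
have q0 : (0 <= (2 / p ^+ 2)%:E)%E by rewrite lee_fin divr_ge0// sqr_ge0.
under [X in (_ <= _ * X)%E]eq_integral do rewrite EFinD.
rewrite ge0_integralD//; last 4 first.
  by move=> x _; exact: sq1.
  by apply/measurable_EFinP; exact: measurable_funX.
  by move=> x _; exact: sq1.
  by apply/measurable_EFinP; exact: measurable_funX.
have i0 h : (0 <= \int[lbn]_x (h x ^+ 2)%:E)%E.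
  by apply: integral_ge0 => x _; rewrite lee_fin sqr_ge0.
rewrite (ge0_muleDr _ (i0 h1) (i0 h2)).
have -> : ift_bound%:E = ((2 / p ^+ 2)%:E * p%:E)%E.
  by rewrite -EFinM /ift_bound -/p; congr EFin; field; rewrite gt_eqF.
by rewrite -!muleA leeD// lee_wpmul2l//; exact: plancherel_le.
Qed.

End fixed_function.

Lemma iftB h1 h2 g1 g2 x :
  lbn.-integrable setT (EFin \o h1) -> lbn.-integrable setT (EFin \o h2) ->
  lbn.-integrable setT (EFin \o g1) -> lbn.-integrable setT (EFin \o g2) ->
  ift_re h1 h2 x - ift_re g1 g2 x = ift_re (h1 \- g1) (h2 \- g2) x /\
  ift_im h1 h2 x - ift_im g1 g2 x = ift_im (h1 \- g1) (h2 \- g2) x.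
Proof.
move=> ih1 ih2 ig1 ig2.
have cB h g : lbn.-integrable setT (EFin \o h) -> lbn.-integrable setT (EFin \o g) ->
    cos_transform lbn id (h \- g) x = cos_transform lbn id h x - cos_transform lbn id g x.
  move=> ih ig; rewrite -RintegralB//; [|exact: integrable_cos_mul..].
  by apply: eq_Rintegral => y _ /=; rewrite mulrBr.
have sB h g : lbn.-integrable setT (EFin \o h) -> lbn.-integrable setT (EFin \o g) ->
    sin_transform lbn id (h \- g) x = sin_transform lbn id h x - sin_transform lbn id g x.
  move=> ih ig; rewrite -RintegralB//; [|exact: integrable_sin_mul..].
  by apply: eq_Rintegral => y _ /=; rewrite mulrBr.
by rewrite /ift_re /ift_im !cB// !sB//; split; ring.
Qed.

End inverse_transform.

Section occupation_density.
Context d (T : measurableType d) (R : realType) (n : nat).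
Variables (nu : {sigma_finite_measure set T -> \bar R}) (X : T -> Rvec R n).
Hypothesis mX : measurable_fun setT X.
Hypothesis int1 : nu.-integrable setT (EFin \o (fun=> 1 : R)).
Notation lbn := (@lebesgue_n R n).

Let c := cos_transform nu X (fun=> 1).
Let s := sin_transform nu X (fun=> 1).

Hypothesis L2cs : (\int[lbn]_y (c y ^+ 2 + s y ^+ 2)%:E < +oo)%E.

Let mc : measurable_fun setT c. Proof. exact: measurable_cos_transform. Qed.
Let ms : measurable_fun setT s. Proof. exact: measurable_sin_transform. Qed.

Let gm (e : R) (f : Rvec R n -> R) y := f y * gaussn e y.

Let integrable_bounded_gaussn (e : R) (f : Rvec R n -> R) (m : R) : 0 < e ->
  measurable_fun setT f -> (forall y, `|f y| <= m) ->
  lbn.-integrable setT (EFin \o gm e f).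
Proof.
move=> e0 mf fm; apply: integrable_dominated (integrable_EFinZ m (integrable_gaussn n e0)).
- by apply: measurable_funM => //; exact: measurable_gaussn.
- by move=> y; rewrite normrM (ger0_norm (gaussn_ge0 _ _)) ler_wpM2r ?gaussn_ge0.
Qed.

Let integrable_c e : 0 < e -> lbn.-integrable setT (EFin \o gm e c).
Proof.
move=> e0; apply: (@integrable_bounded_gaussn _ _ (\int[nu]_t `|1|)) => // y.
exact: (cos_sin_transform_ub mX int1 y).1.
Qed.

Let integrable_s e : 0 < e -> lbn.-integrable setT (EFin \o gm e s).
Proof.
move=> e0; apply: (@integrable_bounded_gaussn _ _ (\int[nu]_t `|1|)) => // y.
exact: (cos_sin_transform_ub mX int1 y).2.
Qed.

(* The inverse Fourier transform of the transform of the occupation measure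
   damped by [gaussn e]; this expression makes its positivity visible. *)
Definition smoothed_density (e : R) (x : Rvec R n) : R :=
  (2 * pi) ^- n * gaussn_mass e ^+ n * \int[nu]_t gaussn e^-1 (vsub (X t) x).

Let mXx x : measurable_fun setT (fun t => vsub (X t) x).
Proof. exact: measurable_vsub2. Qed.

(** Shifting the path by [-x] multiplies its transform by [e^{-i<y,x>}]; inverting at [x] thus
    amounts to integrating the transform of the shifted path. *)
Let transform_vsub x y :
  cos_transform nu (fun t => vsub (X t) x) (fun=> 1) y =
    cos (dotv y x) * c y + sin (dotv y x) * s y /\
  sin_transform nu (fun t => vsub (X t) x) (fun=> 1) y =
    cos (dotv y x) * s y - sin (dotv y x) * c y.
Proof.
have ic := integrable_cos_mul mX int1 y.
have isn := integrable_sin_mul mX int1 y.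
split; rewrite /c /s /cos_transform /sin_transform -!RintegralZl//.
- rewrite -RintegralD//; [|exact: integrable_EFinZ..].
  by apply: eq_Rintegral => t _; rewrite dotv_vsubl cosB (dotvC x); ring.
- rewrite -RintegralB//; [|exact: integrable_EFinZ..].
  by apply: eq_Rintegral => t _; rewrite dotv_vsubl sinB (dotvC x); ring.
Qed.

(** For the shifted path the integrated cosine part is a Gaussian average and the integrated sine
    part vanishes, so the damped inverse transform is real and nonnegative. *)
Let ift_damped e x : 0 < e ->
  ift_re (gm e c) (gm e s) x = smoothed_density e x /\
  ift_im (gm e c) (gm e s) x = 0.
Proof.
move=> e0; have ic := integrable_c e0; have isn := integrable_s e0.
have mid : measurable_fun setT (@id (Rvec R n)) by exact: measurable_id.
split.
- rewrite /ift_re /smoothed_density -mulrA; congr *%R.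
  rewrite -RintegralD//; [|exact: integrable_cos_mul|exact: integrable_sin_mul].
  rewrite (_ : \int[nu]_t gaussn e^-1 (vsub (X t) x) =
    \int[nu]_t (1 * gaussn e^-1 (vsub (X t) x))); last first.
    by apply: eq_Rintegral => t _; rewrite mul1r.
  rewrite -Rintegral_cos_transform_gaussn//; apply: eq_Rintegral => y _.
  by rewrite (transform_vsub x y).1 /gm; ring.
- rewrite /ift_im -RintegralB//; [|exact: integrable_cos_mul|exact: integrable_sin_mul].
  rewrite (_ : \int[lbn]_y _ = 0) ?mulr0//.
  rewrite -[RHS](Rintegral_sin_transform_gaussn (mXx x) int1 e0).
  apply: eq_Rintegral => y _; rewrite (transform_vsub x y).2 /gm; ring.
Qed.

Lemma smoothed_density_ge0 e x : 0 < e -> 0 <= smoothed_density e x.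
Proof.
move=> e0; rewrite /smoothed_density mulr_ge0//.
  rewrite mulr_ge0// ?invr_ge0 exprn_ge0//.
  - by rewrite mulr_ge0// pi_ge0.
  - by rewrite ltW// gaussn_mass_gt0.
by apply: Rintegral_ge0 => t _; exact: gaussn_ge0.
Qed.

Let eps k : R := k.+1%:R^-1.

(** Dominated convergence: a factor [g] in [[0, 1]] satisfies [(z g - z)^2 <= z^2], and the undamped
    squares are integrable. *)
Let damped_cvg :
  (\int[lbn]_y ((gm (eps k) c y - c y) ^+ 2 + (gm (eps k) s y - s y) ^+ 2)%:E
    @[k --> \oo] --> 0)%E.
Proof.
rewrite [X in _ --> X](_ : _ = (\int[lbn]_y (cst 0 y))%E); last first.
  by rewrite integral0.
have mG k : measurable_fun setT (fun y : Rvec R n => gaussn (eps k) y).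
  exact: measurable_gaussn.
apply: (@dominated_cvg _ _ _ _ setT measurableT _ _
  (fun y => (c y ^+ 2 + s y ^+ 2)%:E)).
- move=> k; apply/measurable_EFinP; apply: measurable_funD; apply: measurable_funX;
    apply: measurable_funB => //; exact: measurable_funM.
- move=> y _; apply: cvg_EFin; first exact: nearW.
  rewrite [X in _ --> X](_ : _ = (c y * 1 - c y) ^+ 2 + (s y * 1 - s y) ^+ 2); last first.
    by rewrite !mulr1 !subrr expr0n addr0.
  have cg a : (a * gaussn (eps k) y - a) ^+ 2 @[k --> \oo] --> (a * 1 - a) ^+ 2.
    apply: (@cvg_comp _ _ _ _ (fun z : R => z ^+ 2)); last exact: sqr_continuous.
    apply: cvgB; last exact: cvg_cst.
    by apply: cvgM; [exact: cvg_cst|exact: cvg_gaussn].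
  by apply: cvgD; exact: cg.
- by [].
- apply/integrableP; split.
    apply/measurable_EFinP; apply: measurable_funD; exact: measurable_funX.
  under eq_integral do rewrite gee0_abs ?lee_fin ?addr_ge0 ?sqr_ge0//.
  exact: L2cs.
- move=> k y _; rewrite gee0_abs ?lee_fin ?addr_ge0 ?sqr_ge0//.
  have g0 := gaussn_ge0 (eps k) y; have g1 := gaussn_le1 (eps k) y.
  rewrite /gm; move: (gaussn _ _) g0 g1 (c y) (s y) => g g0 g1 a b.
  have H z : (z * g - z) ^+ 2 <= z ^+ 2.
    rewrite (_ : z * g - z = z * (g - 1)); last by ring.
    rewrite exprMn ler_piMr ?sqr_ge0//; nra.
  by rewrite lerD.
Qed.


Let eps_gt0 k : 0 < eps k. Proof. by rewrite invr_gt0. Qed.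

(** The convergence of [damped_cvg] comes without a rate; a subsequence with error [8^-j], as
    [L2_limit] asks for, is selected. The bound [j <= N j] keeps the damping parameters tending to
    0. *)
Let damping_rate : exists N : nat -> nat, forall j, (j <= N j)%N /\
  (\int[lbn]_y ((gm (eps (N j)) c y - c y) ^+ 2 +
     (gm (eps (N j)) s y - s y) ^+ 2)%:E <= (8 ^- j)%:E)%E.
Proof.
have /choice[N HN] : forall j, exists k, (j <= k)%N /\
  (\int[lbn]_y ((gm (eps k) c y - c y) ^+ 2 +
     (gm (eps k) s y - s y) ^+ 2)%:E <= (8 ^- j)%:E)%E; last by exists N.
move=> j; near \oo => k; exists k; split.
  by near: k; exact: nbhs_infty_ge.
near: k; apply: (ereal_cvg0_near_le damped_cvg).
by rewrite invr_gt0 exprn_gt0.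
Unshelve. all: by end_near. Qed.

(** The last clause compares an arbitrary inverse transform with the smoothed densities and lets [j]
    grow. Applied to integrable approximations of [c + i s], it identifies [L] as the L^2 inverse
    transform. *)
Lemma occupation_density_L2 : exists (N : nat -> nat) (L : Rvec R n -> R),
  [/\ forall j, (j <= N j)%N, measurable_fun setT L /\ forall x, 0 <= L x,
    forall j, (\int[lbn]_x ((smoothed_density (eps (N j)) x - L x) ^+ 2)%:E <=
       (4 * ift_bound R n / 8 ^+ j)%:E)%E,
    (\int[lbn]_x (L x ^+ 2)%:E < +oo)%E &
    forall h1 h2, lbn.-integrable setT (EFin \o h1) ->
      lbn.-integrable setT (EFin \o h2) ->
      (\int[lbn]_x ((ift_re h1 h2 x - L x) ^+ 2 + ift_im h1 h2 x ^+ 2)%:E <=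
       (4 * ift_bound R n)%:E *
         \int[lbn]_y ((h1 y - c y) ^+ 2 + (h2 y - s y) ^+ 2)%:E)%E].
Proof.
have [N HN] := damping_rate.
pose t2 : R := 2; have t20 : 0 <= t2 by [].
pose C := ift_bound R n; have C0 : 0 <= C by exact: ift_bound_ge0.
pose h1 j := gm (eps (N j)) c; pose h2 j := gm (eps (N j)) s.
have ih1 j : lbn.-integrable setT (EFin \o h1 j) by exact: integrable_c.
have ih2 j : lbn.-integrable setT (EFin \o h2 j) by exact: integrable_s.
have mh1 j := integrable_measurable (ih1 j).
have mh2 j := integrable_measurable (ih2 j).
pose p j := smoothed_density (eps (N j)).
have pE j : p j = ift_re (h1 j) (h2 j).
  by apply/funext => x; rewrite (ift_damped x (eps_gt0 _)).1.
have p0E j x : ift_im (h1 j) (h2 j) x = 0 by exact: (ift_damped x (eps_gt0 _)).2.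
have mp j : measurable_fun setT (p j) by rewrite pE; exact: measurable_ift_re.
have D_le j : (\int[lbn]_y ((h1 j y - c y) ^+ 2 + (h2 j y - s y) ^+ 2)%:E <=
    (8 ^- j)%:E)%E by exact: (HN j).2.
(* Triangle inequality through the j-th smoothed density. *)
have cmp (k1 k2 : Rvec R n -> R) j : lbn.-integrable setT (EFin \o k1) ->
    lbn.-integrable setT (EFin \o k2) ->
    (\int[lbn]_x ((ift_re k1 k2 x - p j x) ^+ 2 + ift_im k1 k2 x ^+ 2)%:E <=
     C%:E * (t2%:E * \int[lbn]_y ((k1 y - c y) ^+ 2 + (k2 y - s y) ^+ 2)%:E +
             t2%:E * (8 ^- j)%:E))%E.
  move=> ik1 ik2.
  have mk1 := integrable_measurable ik1; have mk2 := integrable_measurable ik2.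
  rewrite (eq_integral (fun x => (ift_re (k1 \- h1 j) (k2 \- h2 j) x ^+ 2 +
      ift_im (k1 \- h1 j) (k2 \- h2 j) x ^+ 2)%:E)); last first.
    move=> x _; have [<- <-] := iftB x ik1 ik2 (ih1 j) (ih2 j).
    by rewrite p0E subr0 pE.
  apply: le_trans; first by apply: ift_le; exact: integrable_EFinB.
  apply: lee_wpmul2l; first by rewrite lee_fin.
  apply: le_trans; last by apply: leeD2l; apply: lee_wpmul2l (D_le j) => //.
  apply: integral_le_lincomb => //.
  - by apply: measurable_funD; apply: measurable_funX; exact: measurable_funB.
  - by apply: measurable_funD; apply: measurable_funX; exact: measurable_funB.
  - by apply: measurable_funD; apply: measurable_funX; exact: measurable_funB.
  - by move=> x; rewrite addr_ge0 ?sqr_ge0.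
  - by move=> x; rewrite addr_ge0 ?sqr_ge0.
  - by move=> x; rewrite addr_ge0 ?sqr_ge0.
  - move=> y /=; move: (k1 y) (k2 y) (h1 j y) (h2 j y) (c y) (s y) => a b a' b' a0 b0.
    have := sqr_ge0 ((a - a0) + (a' - a0)); have := sqr_ge0 ((b - b0) + (b' - b0)).
    by rewrite !expr2; lra.
have pM i j : (i <= j)%N ->
    (\int[lbn]_x ((p i x - p j x) ^+ 2)%:E <= (4 * C / 8 ^+ i)%:E)%E.
  move=> ij; have := cmp _ _ j (ih1 i) (ih2 i).
  under eq_integral do rewrite p0E expr0n addr0 -pE.
  move=> /le_trans; apply.
  apply: (@le_trans _ _ (C%:E * (t2%:E * (8 ^- i)%:E + t2%:E * (8 ^- i)%:E))%E).
    apply: lee_wpmul2l; first by rewrite lee_fin.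
    apply: leeD; apply: lee_wpmul2l => //.
    by rewrite lee_fin lef_pV2 ?posrE ?exprn_gt0// ler_weXn2l// ler1n.
  by rewrite -!EFinM lee_fin /t2; lra.
have [L [mL pL L0]] := L2_limit (mulr_ge0 (ler0n _ 4) C0) mp pM.
have L_ge0 x : 0 <= L x by apply: L0 => j y; exact: smoothed_density_ge0.
have key (k1 k2 : Rvec R n -> R) : lbn.-integrable setT (EFin \o k1) ->
      lbn.-integrable setT (EFin \o k2) ->
      (\int[lbn]_x ((ift_re k1 k2 x - L x) ^+ 2 + ift_im k1 k2 x ^+ 2)%:E <=
       (4 * C)%:E *
         \int[lbn]_y ((k1 y - c y) ^+ 2 + (k2 y - s y) ^+ 2)%:E)%E.
  move=> ik1 ik2.
  have mk1 := integrable_measurable ik1; have mk2 := integrable_measurable ik2.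
  set J := (\int[lbn]_y ((k1 y - c y) ^+ 2 + _)%:E)%E in cmp *.
  have J0 : (0 <= J)%E by apply: integral_ge0 => y _; rewrite lee_fin addr_ge0 ?sqr_ge0.
  (* Triangle inequality through [p j]: [J] gets the coefficient [2 * 2 C], and [8^-j] gets
     [2 * 2 C + 2 * 4 C = 12 C]. *)
  have bd j : (\int[lbn]_x ((ift_re k1 k2 x - L x) ^+ 2 + ift_im k1 k2 x ^+ 2)%:E <=
       (4 * C)%:E * J + (12 * C / 8 ^+ j)%:E)%E.
    apply: (@le_trans _ _ (t2%:E * (C%:E * (t2%:E * J + t2%:E * (8 ^- j)%:E)) +
        t2%:E * (4 * C / 8 ^+ j)%:E)%E).
      apply: le_trans; last first.
        apply: leeD; first by apply: lee_wpmul2l (cmp _ _ j ik1 ik2).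
        by apply: lee_wpmul2l (pL j).
      apply: integral_le_lincomb => //.
      - apply: measurable_funD; apply: measurable_funX.
          by apply: measurable_funB => //; exact: measurable_ift_re.
        exact: measurable_ift_im.
      - apply: measurable_funD; apply: measurable_funX.
          by apply: measurable_funB => //; exact: measurable_ift_re.
        exact: measurable_ift_im.
      - by apply: measurable_funX; exact: measurable_funB.
      - by move=> x; rewrite addr_ge0 ?sqr_ge0.
      - by move=> x; rewrite addr_ge0 ?sqr_ge0.
      - by move=> x; rewrite sqr_ge0.
      - move=> x; move: (ift_re _ _ _) (ift_im _ _ _) (p j x) (L x) => a b q l.
        have := sqr_ge0 ((a - q) - (q - l)); have := sqr_ge0 b.
        by rewrite !expr2; lra.
    have tJ0 : (0 <= t2%:E * J)%E by rewrite mule_ge0// lee_fin.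
    have t80 : (0 <= t2%:E * (8 ^- j)%:E)%E.
      by rewrite -EFinM lee_fin mulr_ge0// invr_ge0 exprn_ge0.
    have CE0 : (0 <= C%:E)%E by rewrite lee_fin.
    rewrite (ge0_muleDr _ tJ0 t80).
    rewrite (ge0_muleDr _ (mule_ge0 CE0 tJ0) (mule_ge0 CE0 t80)).
    rewrite !muleA -!EFinM -addeA -EFinD.
    by apply: leeD; rewrite ?lee_fin; [rewrite (_ : t2 * C * t2 = 4 * C)// /t2; ring|
      rewrite /t2; lra].
  apply/lee_addgt0Pr => e e0.
  near \oo => j; apply: le_trans (bd j) _; apply: leeD2l; rewrite lee_fin.
  near: j.
  have z8 : `|8^-1 : R| < 1 by rewrite ger0_norm// invf_lt1// ltr1n.
  have h : \forall j \near \oo, geometric (12 * C) 8^-1 j < e.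
    exact: cvgr_lt (cvg_geometric (12 * C) z8) _ e0.
  by apply: filterS h => j; rewrite /= exprVn => /ltW.
exists N, L; split => //.
- by move=> j; exact: (HN j).1.
(* [L] is at finite distance from the first smoothed density, whose norm is finite because damping
   only decreases the modulus of the transform. *)
- apply: (@le_lt_trans _ _ (t2%:E * \int[lbn]_x ((p 0%N x - L x) ^+ 2)%:E +
    t2%:E * \int[lbn]_x (p 0%N x ^+ 2)%:E)%E).
    apply: integral_le_lincomb => //.
    + exact: measurable_funX.
    + by apply: measurable_funX; exact: measurable_funB.
    + exact: measurable_funX.
    + by move=> x; exact: sqr_ge0.
    + by move=> x; exact: sqr_ge0.
    + by move=> x; exact: sqr_ge0.
    + move=> x; move: (p _ _) (L x) => a b.
      have := sqr_ge0 ((a - b) + a); by rewrite !expr2; lra.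
  apply: lte_add_pinfty.
    apply: lte_mul_pinfty => //; exact: le_lt_trans (pL 0%N) (ltry _).
  apply: lte_mul_pinfty => //.
  rewrite (eq_integral (fun x => (ift_re (h1 0%N) (h2 0%N) x ^+ 2 +
      ift_im (h1 0%N) (h2 0%N) x ^+ 2)%:E)); last first.
    by move=> x _; rewrite p0E expr0n addr0 pE.
  apply: le_lt_trans; first exact: ift_le.
  apply: lte_mul_pinfty; [by rewrite lee_fin|by []|].
  apply: le_lt_trans L2cs; apply: ge0_le_integral => //.
  + by move=> x _; rewrite lee_fin addr_ge0 ?sqr_ge0.
  + by apply/measurable_EFinP; apply: measurable_funD; exact: measurable_funX.
  + by apply/measurable_EFinP; apply: measurable_funD; exact: measurable_funX.
  + move=> x _; rewrite lee_fin /h1 /h2 /gm !exprMn -mulrDl.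
    rewrite ler_piMr ?addr_ge0 ?sqr_ge0// exprn_ile1 ?gaussn_ge0 ?gaussn_le1//.
Unshelve. all: by end_near. Qed.

End occupation_density.

(** * Densities of occupation measures *)

Section hat_functions.
Context {R : realType}.
Implicit Types (k a b x y e : R).

(** Trapezoid equal to 1 on [[a, b]] and falling off with slope [k]. Being Lipschitz, it is moved by
    Gaussian smoothing by at most [k] times the width; as [k] grows it tends to the indicator of the
    closed interval. *)
Definition hat k a b x : R :=
  Num.max 0 (Num.min 1 (Num.min (1 + k * (x - a)) (1 + k * (b - x)))).

Lemma hat_ge0 k a b x : 0 <= hat k a b x.
Proof. by rewrite /hat le_max lexx. Qed.

Lemma hat_le1 k a b x : hat k a b x <= 1.
Proof. by rewrite /hat ge_max ler01 ge_min lexx. Qed.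

Lemma hat_eq1 k a b x : 0 <= k -> a <= x <= b -> hat k a b x = 1.
Proof.
move=> k0 /andP[ax xb]; rewrite /hat min_l ?max_r// le_min.
by rewrite !lerDl !mulr_ge0 ?subr_ge0.
Qed.

Lemma hat_eq0 k a b x : (1 + k * (x - a) <= 0) || (1 + k * (b - x) <= 0) ->
  hat k a b x = 0.
Proof.
move=> h; rewrite /hat max_l// !ge_min.
by case/orP : h => ->; rewrite !orbT.
Qed.

(** A slope of at least 1 confines the support to a unit enlargement, which gives one dominating
    function for all [k]. *)
Lemma hat_le_indic k a b x : 1 <= k ->
  hat k a b x <= \1_`[a - 1, b + 1] x.
Proof.
move=> k1; rewrite indicE; have [_|] := boolP (x \in _); first exact: hat_le1.
rewrite notin_setE/= in_itv/= => /negP; rewrite negb_and -!ltNge => h.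
rewrite hat_eq0//; case/orP : h => h; apply/orP; [left|right]; nra.
Qed.

Lemma hat_cvg a b x : hat k.+1%:R a b x @[k --> \oo] --> (\1_`[a, b] x : R).
Proof.
rewrite indicE; have [|] := boolP (x \in _) => [/set_mem/=|/negP].
  rewrite in_itv/= => xab; under eq_fun do rewrite hat_eq1//.
  exact: cvg_cst.
move=> h; apply: cvg_near_cst.
have {h} : (x < a) || (b < x).
  rewrite !ltNge -negb_and; apply/negP => xab; apply: h.
  by rewrite inE/= in_itv.
case/orP => h; near=> k; apply: hat_eq0; apply/orP; [left|right].
- have : (a - x)^-1 <= k%:R by near: k; exact: nbhs_infty_ger.
  rewrite -(ler_pM2r (_ : 0 < a - x)) ?subr_gt0// mulVf ?subr_eq0 ?gt_eqF//.
  rewrite -natr1; nra.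
- have : (x - b)^-1 <= k%:R by near: k; exact: nbhs_infty_ger.
  rewrite -(ler_pM2r (_ : 0 < x - b)) ?subr_gt0// mulVf ?subr_eq0 ?gt_eqF//.
  rewrite -natr1; nra.
Unshelve. all: by end_near. Qed.

Lemma dist_min_le e x y x' y' : `|x - x'| <= e -> `|y - y'| <= e ->
  `|Num.min x y - Num.min x' y'| <= e.
Proof.
rewrite !ler_norml => /andP[? ?] /andP[? ?].
by rewrite /Num.min; case: ltP => ?; case: ltP => ?; apply/andP; split; lra.
Qed.

Lemma dist_max_le e x y x' y' : `|x - x'| <= e -> `|y - y'| <= e ->
  `|Num.max x y - Num.max x' y'| <= e.
Proof.
rewrite !ler_norml => /andP[? ?] /andP[? ?].
by rewrite /Num.max; case: ltP => ?; case: ltP => ?; apply/andP; split; lra.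
Qed.

Lemma hat_lipschitz k a b x y : 0 <= k ->
  `|hat k a b x - hat k a b y| <= k * `|x - y|.
Proof.
move=> k0; have e0 : 0 <= k * `|x - y| by rewrite mulr_ge0.
apply: dist_max_le; first by rewrite subrr normr0.
apply: dist_min_le; first by rewrite subrr normr0.
apply: dist_min_le.
- rewrite (_ : _ - _ = k * (x - y)); last by ring.
  by rewrite normrM ger0_norm.
- rewrite (_ : _ - _ = k * (y - x)); last by ring.
  by rewrite normrM ger0_norm// distrC.
Qed.

Lemma measurable_hat k a b : measurable_fun setT (hat k a b).
Proof.
apply: measurable_maxr => //; apply: measurable_minr => //; apply: measurable_minr.
- apply: measurable_funD => //; apply: measurable_funM => //.
  exact: measurable_funB.
- apply: measurable_funD => //; apply: measurable_funM => //.
  exact: measurable_funB.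
Qed.

(** The Lipschitz bound reduces the error to [k] times the mean of [|x - u|], and
    [|x - u| <= (e^2 + |x - u|^2) / (2 e)] reduces that mean to the variance [e^2]. *)
Lemma normal_hat_le k a b (u e : R) : 0 <= k -> 0 < e ->
  `|\int[@lebesgue_measure R]_x (hat k a b x * normal_pdf u e x) - hat k a b u|
  <= k * e.
Proof.
move=> k0 e0; have mh := measurable_hat k a b.
have h1 (x : R) : `|hat k a b x| <= 1 by rewrite ger0_norm ?hat_ge0 ?hat_le1.
have ipdf := @integrable_normal_pdf R u e.
have ih := @integrable_normal_pdf_bounded R u e _ mh h1.
have isq := integrable_normal_pdf_sqr u e0.
have -> : hat k a b u =
    \int[@lebesgue_measure R]_x (hat k a b u * normal_pdf u e x).
  by rewrite RintegralZl// Rintegral_normal_pdf mulr1.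
rewrite -RintegralB//; last exact: integrable_EFinZ.
have iB : (@lebesgue_measure R).-integrable setT (EFin \o (fun x : R =>
    hat k a b x * normal_pdf u e x - hat k a b u * normal_pdf u e x)).
  by apply: integrable_EFinB => //; exact: integrable_EFinZ.
apply: le_trans; first exact: le_normr_Rintegral.
have -> : k * e = \int[@lebesgue_measure R]_x (k * e / 2 * normal_pdf u e x +
    k / (2 * e) * ((x - u) ^+ 2 * normal_pdf u e x)).
  rewrite RintegralD//; [|exact: integrable_EFinZ..].
  rewrite !RintegralZl// Rintegral_normal_pdf Rintegral_normal_pdf_sqr//.
  by field; rewrite gt_eqF.
apply: le_Rintegral => //.
- by move/integrable_abse : iB.
- by apply: integrable_EFinD; exact: integrable_EFinZ.
move=> x _; rewrite -mulrBl normrM (ger0_norm (normal_pdf_ge0 _ _ _)).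
rewrite mulrA -mulrDl ler_wpM2r ?normal_pdf_ge0//.
apply: le_trans (hat_lipschitz _ _ _ _ k0) _.
have -> : k * e / 2 + k / (2 * e) * (x - u) ^+ 2 =
    k * ((e ^+ 2 + `|x - u| ^+ 2) / (2 * e)).
  by rewrite real_normK ?num_real//; field; rewrite gt_eqF.
rewrite ler_wpM2l// ler_pdivlMr ?mulr_gt0//.
by have := sqr_ge0 (e - `|x - u|); rewrite !expr2; lra.
Qed.

End hat_functions.

Section smoothed_density_test.
Context d (T : measurableType d) (R : realType) (n : nat).
Variables (nu : {sigma_finite_measure set T -> \bar R}) (X : T -> Rvec R n).
Hypothesis mX : measurable_fun setT X.
Hypothesis int1 : nu.-integrable setT (EFin \o (fun=> 1 : R)).
Variable phi : 'I_n -> R -> R.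
Hypothesis mphi : forall i, measurable_fun setT (phi i).
Hypothesis phi0 : forall i x, 0 <= phi i x.
Hypothesis phi1 : forall i x, phi i x <= 1.

Definition prodfun (x : Rvec R n) : R := \prod_(i < n) phi i (tnth x i).

Lemma measurable_prodfun : measurable_fun setT prodfun.
Proof.
apply: measurable_prod => i _.
exact: (measurableT_comp (mphi i) (@measurable_tnth _ _ n i)).
Qed.

Lemma prodfun_ge0 x : 0 <= prodfun x.
Proof. by apply: prodr_ge0. Qed.

Lemma prodfun_le1 x : prodfun x <= 1.
Proof. by apply: prodr_ile1 => i _; rewrite phi0 phi1. Qed.

Let nint (e : R) (i : 'I_n) (u : R) : R :=
  \int[@lebesgue_measure R]_x (phi i x * normal_pdf u e x).

(** Tonelli moves the Gaussian from the density onto the test function, where it factors over the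
    coordinates; [(2 pi)^-n] and the two dual masses cancel, leaving normal densities of standard
    deviation [e]. *)
Lemma integral_smoothed_prodfun (e : R) : 0 < e ->
  (\int[lebesgue_n n]_x (prodfun x * smoothed_density nu X e x)%:E =
   \int[nu]_t (\prod_(i < n) nint e i (tnth (X t) i))%:E)%E.
Proof.
move=> e0; have ei0 : 0 < e^-1 by rewrite invr_gt0.
pose K : R := (2 * pi) ^- n * gaussn_mass e ^+ n.
have K0 : 0 <= K.
  rewrite mulr_ge0 ?invr_ge0 ?exprn_ge0 ?mulr_ge0 ?pi_ge0//.
  by rewrite ltW// gaussn_mass_gt0.
have mG : measurable_fun setT
    (fun z : Rvec R n * T => gaussn e^-1 (vsub (X z.2) z.1)).
  apply: (measurableT_comp (measurable_gaussn _)).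
  by apply: measurable_vsub2 => //; exact: (measurableT_comp mX).
have mF : measurable_fun setT (fun z : Rvec R n * T =>
    (K * prodfun z.1 * gaussn e^-1 (vsub (X z.2) z.1))%:E).
  apply/measurable_EFinP/measurable_funM => //; apply: measurable_funM => //.
  exact: (measurableT_comp measurable_prodfun).
transitivity (\int[lebesgue_n n]_x \int[nu]_t
    (K * prodfun x * gaussn e^-1 (vsub (X t) x))%:E)%E.
  apply: eq_integral => x _; rewrite /smoothed_density -/K.
  rewrite mulrCA mulrA EFinM Rintegral_EFin; last first.
    have := integrable_mul_gaussn e^-1 (measurable_vsub2 mX (measurable_cst x)) int1.
    by under eq_fun do rewrite mul1r.
  rewrite -ge0_integralZl//.
  - apply/measurable_EFinP/(measurableT_comp (measurable_gaussn _)).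
    exact: measurable_vsub2.
  - by move=> t _; rewrite lee_fin gaussn_ge0.
  - by rewrite lee_fin mulr_ge0 ?prodfun_ge0.
rewrite (fubini_tonelli _ mF); last first.
  move=> z; rewrite lee_fin; apply: mulr_ge0; last exact: gaussn_ge0.
  by apply: mulr_ge0 => //; exact: prodfun_ge0.
apply: eq_integral => t _.
transitivity (\int[lebesgue_n n]_x (\prod_(i < n)
    (phi i (tnth x i) * normal_pdf (tnth (X t) i) e (tnth x i)))%:E)%E.
  apply: eq_integral => x _; congr EFin.
  rewrite big_split/= gaussn_vsubC /gaussn -/(prodfun x) /K.
  rewrite [X in _ * X = _](eq_bigr (fun j =>
      gaussn_mass e^-1 * normal_pdf (tnth (X t) j) e (tnth x j))); last first.
    by move=> j _; rewrite tnth_vsub expR_normal_pdf// invrK.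
  rewrite big_split/= prodr_const card_ord.
  rewrite [RHS](_ : _ = ((2 * pi) ^- n * (gaussn_mass e * gaussn_mass e^-1) ^+ n) *
     (prodfun x * \prod_(i < n) normal_pdf (tnth (X t) i) e (tnth x i))).
    by rewrite [(gaussn_mass e * _) ^+ n]exprMn -!mulrA; congr (_ * (_ * _)); rewrite mulrCA.
  by rewrite gaussn_massM// mulVf ?mul1r// expf_neq0// mulf_neq0// gt_eqF ?pi_gt0.
rewrite (@integral_lebesgue_n_prod _ n
    (fun i x => phi i x * normal_pdf (tnth (X t) i) e x)).
- rewrite (big_morph EFin EFinM erefl); apply: eq_bigr => i _.
  rewrite /nint Rintegral_EFin//.
  apply: integrable_normal_pdf_bounded => // x.
  by rewrite ger0_norm.
- by move=> i; apply: measurable_funM => //; exact: measurable_normal_pdf.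
- by move=> i x; rewrite mulr_ge0// normal_pdf_ge0.
Qed.

Lemma measurable_nint (e : R) i : 0 < e -> measurable_fun setT (nint e i).
Proof.
move=> e0; apply: (@measurable_Rintegral_param _ _ _ _ _ lebesgue_measure
  (fun z : R * R => phi i z.2 * normal_pdf z.1 e z.2)).
apply: measurable_funM; first exact: (measurableT_comp (mphi i)).
have ei0 : 0 < e^-1 by rewrite invr_gt0.
rewrite (_ : (fun z : R * R => _) = fun z : R * R =>
    (gaussn_mass e^-1)^-1 * expR (- (e^-1 * (z.2 - z.1)) ^+ 2 / 2)); last first.
  apply/funext => z; rewrite expR_normal_pdf// invrK mulrA mulVf ?mul1r//.
  by rewrite gt_eqF// gaussn_mass_gt0.
apply: measurable_funM => //; apply: measurableT_comp => //.
apply: measurable_funM => //; apply: measurableT_comp => //.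
apply: measurable_funX; apply: measurable_funM => //.
exact: measurable_funB.
Qed.

Lemma nint_ge0 e i u : 0 <= nint e i u.
Proof. by apply: Rintegral_ge0 => x _; rewrite mulr_ge0// normal_pdf_ge0. Qed.

Lemma nint_le1 e i u : 0 < e -> nint e i u <= 1.
Proof.
move=> e0; rewrite -(Rintegral_normal_pdf u e).
apply: le_Rintegral => //.
- by apply: integrable_normal_pdf_bounded => // x; rewrite ger0_norm.
- exact: integrable_normal_pdf.
- by move=> x _; rewrite ler_piMl ?normal_pdf_ge0.
Qed.

(** All integrands lie in [[0, 1]] and [nu] is finite, so the constant 1 dominates. *)
Lemma cvg_smoothed_prodfun (e : nat -> R) : (forall k, 0 < e k) ->
  (forall i u, nint (e k) i u @[k --> \oo] --> phi i u) ->
  (\int[lebesgue_n n]_x (prodfun x * smoothed_density nu X (e k) x)%:E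
    @[k --> \oo] --> \int[nu]_t (prodfun (X t))%:E)%E.
Proof.
move=> e0 ce.
under eq_fun do rewrite integral_smoothed_prodfun//.
apply: (@dominated_cvg _ _ _ nu setT measurableT _ _ (fun=> 1%E)).
- move=> k; apply/measurable_EFinP/measurable_prod => i _.
  apply: (measurableT_comp (measurable_nint _ (e0 k))).
  exact: (measurableT_comp (@measurable_tnth _ _ n i) mX).
- move=> t _; apply: cvg_EFin; first exact: nearW.
  apply: (@cvg_big R 'I_n *%R 1 predT) => [z|i _]; last exact: ce.
  by apply: cvgM; [exact: cvg_fst|exact: cvg_snd].
- by [].
- exact: int1.
- move=> k t _; rewrite lee_fin ger0_norm; last by apply: prodr_ge0 => i _; exact: nint_ge0.
  by apply: prodr_ile1 => i _; rewrite nint_ge0 nint_le1.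
Qed.

End smoothed_density_test.

Section occupation_density_boxes.
Context d (T : measurableType d) (R : realType) (n : nat).
Variables (nu : {sigma_finite_measure set T -> \bar R}) (X : T -> Rvec R n).
Hypothesis mX : measurable_fun setT X.
Hypothesis int1 : nu.-integrable setT (EFin \o (fun=> 1 : R)).
Variables (L : Rvec R n -> R) (e : nat -> R) (M : R).
Hypotheses (mL : measurable_fun setT L) (L0 : forall x, 0 <= L x).
Hypothesis L2 : (\int[lebesgue_n n]_x (L x ^+ 2)%:E < +oo)%E.
Hypotheses (e0 : forall k, 0 < e k) (e_cvg : e @ \oo --> (0 : R)).
Let p k := smoothed_density nu X (e k).
Hypothesis mp : forall k, measurable_fun setT (p k).
Hypothesis pL : forall k,
  (\int[lebesgue_n n]_x ((p k x - L x) ^+ 2)%:E <= (M / 8 ^+ k)%:E)%E.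

Let integrable_sqr (f : Rvec R n -> R) : measurable_fun setT f ->
  (\int[lebesgue_n n]_x (f x ^+ 2)%:E < +oo)%E ->
  (lebesgue_n n).-integrable setT (EFin \o (fun x => f x ^+ 2)).
Proof.
move=> mf fy; apply/integrableP; split.
  by apply/measurable_EFinP; exact: measurable_funX.
by under eq_integral do rewrite /= ger0_norm ?sqr_ge0//.
Qed.

Let cvg_test (f : Rvec R n -> R) : measurable_fun setT f ->
  (\int[lebesgue_n n]_x (f x ^+ 2)%:E < +oo)%E ->
  (\int[lebesgue_n n]_x (f x * p k x)%:E @[k --> \oo] -->
   \int[lebesgue_n n]_x (f x * L x)%:E)%E.
Proof.
move=> mf f2; have if2 := integrable_sqr mf f2.
have iL2 := integrable_sqr mL L2.
have ipL2 k : (lebesgue_n n).-integrable setT (EFin \o (fun x => (p k x - L x) ^+ 2)).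
  apply: integrable_sqr; first exact: measurable_funB.
  exact: le_lt_trans (pL k) (ltry _).
have prodI (g : Rvec R n -> R) : measurable_fun setT g ->
    (lebesgue_n n).-integrable setT (EFin \o (fun x => g x ^+ 2)) ->
    (lebesgue_n n).-integrable setT (EFin \o (fun x => f x * g x)).
  move=> mg ig2; apply: (integrable_dominated _ _ (integrable_EFinD if2 ig2)).
  - exact: measurable_funM.
  - move=> x; rewrite ler_norml; move: (f x) (g x) => a b.
    have := sqr_ge0 (a - b); have := sqr_ge0 (a + b).
    by have := sqr_ge0 a; have := sqr_ge0 b; rewrite !expr2 => *; apply/andP; split; lra.
have ifL := prodI _ mL iL2.
have ifpL k := prodI _ (measurable_funB (mp k) mL) (ipL2 k).
have ifp k : (lebesgue_n n).-integrable setT (EFin \o (fun x => f x * p k x)).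
  have := integrable_EFinD (ifpL k) ifL.
  by congr (_.-integrable _ _); apply/funext => x /=; congr EFin; ring.
under eq_fun do rewrite -Rintegral_EFin//.
rewrite -Rintegral_EFin//; apply: cvg_EFin; first exact: nearW.
pose V := \int[lebesgue_n n]_x (f x ^+ 2).
have V0 : 0 <= V by apply: Rintegral_ge0 => x _; exact: sqr_ge0.
have pLR k : \int[lebesgue_n n]_x ((p k x - L x) ^+ 2) <= M / 8 ^+ k.
  by rewrite -lee_fin Rintegral_EFin.
have M0 : 0 <= M.
  have := pLR 0%N; rewrite expr0 divr1; apply: le_trans.
  by apply: Rintegral_ge0 => x _; exact: sqr_ge0.
have bd k : `|\int[lebesgue_n n]_x (f x * p k x) - \int[lebesgue_n n]_x (f x * L x)|
    <= geometric ((V + M) / 2) 2^-1 k.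
  rewrite -RintegralB//.
  rewrite (_ : \int[_]_x _ = \int[lebesgue_n n]_x (f x * (p k x - L x))); last first.
    by apply: eq_Rintegral => x _; rewrite mulrBr.
  apply: le_trans; first exact: le_normr_Rintegral (ifpL k).
  (* Weighted form of the Cauchy-Schwarz bound. The weights [2^-k] and [2^k] make both terms of
     order [2^-k], the second one being at most [M 4^-k / 2]. *)
  apply: (@le_trans _ _ (\int[lebesgue_n n]_x (2^-1 ^+ k / 2 * f x ^+ 2 +
      2 ^+ k / 2 * (p k x - L x) ^+ 2))).
    apply: le_Rintegral => //.
    - by move/integrable_abse : (ifpL k).
    - by apply: integrable_EFinD; exact: integrable_EFinZ.
    - move=> x _; rewrite normrM -[f x ^+ 2]real_normK ?num_real//.
      rewrite -[(p k x - L x) ^+ 2]real_normK ?num_real//.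
      have q0 : 0 < (2 : R) ^+ k by rewrite exprn_gt0.
      rewrite exprVn; move: (2 ^+ k) q0 `|f x| `|p k x - L x| => q q0 a b.
      rewrite (_ : q^-1 / 2 * a ^+ 2 + q / 2 * b ^+ 2 =
        (a ^+ 2 + (q * b) ^+ 2) / (2 * q)); last by field; rewrite gt_eqF.
      rewrite ler_pdivlMr ?mulr_gt0//.
      by have := sqr_ge0 (a - q * b); rewrite !expr2; lra.
  rewrite RintegralD//; [|exact: integrable_EFinZ..].
  rewrite !RintegralZl// -/V /=.
  apply: (@le_trans _ _ (2^-1 ^+ k / 2 * V + 2 ^+ k / 2 * (M / 8 ^+ k))).
    by rewrite lerD2l ler_wpM2l// divr_ge0// exprn_ge0.
  have q0 : 0 < (2 : R) ^+ k by rewrite exprn_gt0.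
  have q1 : 1 <= (2 : R) ^+ k by rewrite exprn_ege1// ler1n.
  rewrite (_ : 8 ^+ k = (2 ^+ k) ^+ 3); last first.
    by rewrite -exprM mulnC exprM -[(2 : R) ^+ 3]natrX.
  rewrite exprVn; move: (2 ^+ k) q0 q1 => q q0 q1.
  have qi : q^-1 <= 1 by rewrite invf_le1.
  have qi0 : 0 < q^-1 by rewrite invr_gt0.
  rewrite (_ : q / 2 * (M / q ^+ 3) = M / 2 * q^-1 * q^-1); last by field; rewrite gt_eqF.
  have := mulr_ge0 (mulr_ge0 M0 (ltW qi0)) (_ : 0 <= 1 - q^-1).
  rewrite subr_ge0 => /(_ qi); lra.
have g0 : geometric ((V + M) / 2) (2^-1 : R) @ \oo --> (0 : R).
  by apply: cvg_geometric; rewrite ger0_norm// invf_lt1// ltr1n.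
apply/cvgrPdist_le => r r0.
have h : \forall k \near \oo, geometric ((V + M) / 2) 2^-1 k < r.
  exact: cvgr_lt g0 _ r0.
by apply: filterS h => k hk; rewrite distrC (le_trans (bd k))// ltW.
Qed.

Let hatbox (a b : Rvec R n) (k : nat) : Rvec R n -> R :=
  prodfun (fun i => hat k.+1%:R (tnth a i) (tnth b i)).

Let measurable_hatbox a b k : measurable_fun setT (hatbox a b k).
Proof. by apply: measurable_prodfun => i; exact: measurable_hat. Qed.

Let hatbox_ge0 a b k x : 0 <= hatbox a b k x.
Proof. by apply: prodfun_ge0 => i y; exact: hat_ge0. Qed.

Let hatbox_le1 a b k x : hatbox a b k x <= 1.
Proof. by apply: prodfun_le1 => i y; [exact: hat_ge0|exact: hat_le1]. Qed.

Let wide_l (a : Rvec R n) : Rvec R n := [tuple tnth a i - 1 | i < n].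
Let wide_r (b : Rvec R n) : Rvec R n := [tuple tnth b i + 1 | i < n].

Lemma indic_box (a b x : Rvec R n) :
  \1_(box a b) x = \prod_(i < n) \1_`[tnth a i, tnth b i] (tnth x i) :> R.
Proof.
rewrite indicE; have [/set_mem xab|/negP xab] := boolP (x \in _).
  rewrite big1// => i _; rewrite indicE mem_set//= in_itv/=; exact: xab.
have [i xi] : exists i, ~ (tnth a i <= tnth x i <= tnth b i).
  by apply/existsNP => h; apply: xab; rewrite inE.
rewrite (bigD1 i)//= indicE memNset ?mul0r// => h; apply: xi.
Qed.

Let hatbox_le_indic a b k x :
  hatbox a b k x <= \1_(box (wide_l a) (wide_r b)) x.
Proof.
rewrite indic_box; apply: ler_prod => i _; rewrite hat_ge0/= !tnth_mktuple.
by apply: hat_le_indic; rewrite ler1n.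
Qed.

Let hatbox_cvg a b x : hatbox a b k x @[k --> \oo] --> (\1_(box a b) x : R).
Proof.
rewrite indic_box; apply: (@cvg_big R 'I_n *%R 1 predT) => [z|i _].
  by apply: cvgM; [exact: cvg_fst|exact: cvg_snd].
exact: hat_cvg.
Qed.

Let box_finite (a b : Rvec R n) : (lebesgue_n n (box a b) < +oo)%E.
Proof.
have [/forallP ab|] := boolP [forall j, tnth a j <= tnth b j].
  by rewrite lebesgue_n_box// ltry.
rewrite negb_forall => /existsP[j]; rewrite -ltNge => ba.
rewrite (_ : box a b = set0) ?measure0//; apply/seteqP; split => x //= /(_ j).
by move=> /andP[/le_trans h /h]; rewrite leNgt ba.
Qed.

Let hatbox_sqr a b k : (\int[lebesgue_n n]_x (hatbox a b k x ^+ 2)%:E < +oo)%E.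
Proof.
apply: le_lt_trans (box_finite (wide_l a) (wide_r b)).
rewrite -[X in (_ <= lebesgue_n n X)%E]setIT -integral_indic//; last exact: measurable_box.
apply: ge0_le_integral => //.
- by move=> x _; rewrite lee_fin sqr_ge0.
- by apply/measurable_EFinP; exact: measurable_funX.
- by apply/measurable_EFinP/measurable_indic; exact: measurable_box.
- move=> x _; rewrite lee_fin (le_trans _ (hatbox_le_indic a b k x))//.
  by rewrite expr2 ler_piMl.
Qed.

(** The integrals of the hat against the smoothed densities have two limits, one from weak
    convergence to the occupation measure, the other from L^2 convergence to [L]. *)
Let integral_hatbox a b k :
  (\int[nu]_t (hatbox a b k (X t))%:E = \int[lebesgue_n n]_x (hatbox a b k x * L x)%:E)%E.
Proof.
apply: cvg_unique (cvg_test (measurable_hatbox a b k) (hatbox_sqr a b k)) => //.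
apply: cvg_smoothed_prodfun => //.
- by move=> i; exact: measurable_hat.
- by move=> i x; exact: hat_ge0.
- by move=> i x; exact: hat_le1.
- move=> i u; apply/cvgrPdist_le => r r0.
  have k0 : 0 < k.+1%:R :> R by rewrite ltr0n.
  have h : \forall j \near \oo, e j < r / k.+1%:R.
    by apply: cvgr_lt e_cvg _ _; rewrite divr_gt0.
  apply: filterS h => j hj; rewrite distrC.
  apply: le_trans; first by apply: normal_hat_le => //; exact: ltW.
  by rewrite mulrC -ler_pdivlMr// ltW.
Qed.

Lemma occupation_box a b :
  nu (X @^-1` box a b) = (\int[lebesgue_n n]_(x in box a b) (L x)%:E)%E.
Proof.
have mbox := measurable_box.
have mXb : measurable (X @^-1` box a b).
  by rewrite -[_ @^-1` _]setTI; apply: mX => //; exact: measurable_box.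
have lhs : (\int[nu]_t (hatbox a b k (X t))%:E @[k --> \oo] -->
    nu (X @^-1` box a b))%E.
  rewrite -[X in _ --> nu X]setIT -integral_indic//.
  apply: (@dominated_cvg _ _ _ nu setT measurableT _ _ (fun=> 1%E)) => //.
  - by move=> k; apply/measurable_EFinP; exact: measurableT_comp.
  - by move=> t _; apply: cvg_EFin; [exact: nearW|exact: hatbox_cvg].
  - by move=> k t _; rewrite lee_fin ger0_norm.
have rhs : (\int[lebesgue_n n]_x (hatbox a b k x * L x)%:E @[k --> \oo] -->
    \int[lebesgue_n n]_(x in box a b) (L x)%:E)%E.
  rewrite [X in _ --> X]integral_mkcond.
  pose g x := \1_(box (wide_l a) (wide_r b)) x * L x.
  apply: (@dominated_cvg _ _ _ _ setT measurableT _ _ (fun x => (g x)%:E)) => //.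
  - by move=> k; apply/measurable_EFinP; exact: measurable_funM.
  - move=> x _; rewrite [X in _ --> X](_ : _ = (\1_(box a b) x * L x)%:E); last first.
      by rewrite patchE indicE; case: ifPn => _; rewrite ?mul1r ?mul0r.
    apply: cvg_EFin; first exact: nearW.
    by apply: cvgM; [exact: hatbox_cvg|exact: cvg_cst].
  (* On the enlarged box [L <= 1 + L^2], so square integrability and finite volume give
     integrability. *)
  - apply: (@integrable_dominated _ _ _ _ _
      (fun x => \1_(box (wide_l a) (wide_r b)) x + L x ^+ 2)).
    + apply: measurable_funM => //; apply: measurable_indic; exact: measurable_box.
    + move=> x; rewrite /g indicE; have := L0 x; move: (L x) => l l0.
      case: (_ \in _) => /=; rewrite ?mul0r ?mul1r ?normr0 ?addr_ge0 ?sqr_ge0//.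
      by rewrite mulr1n ger0_norm//; have := sqr_ge0 (l - 1);
          have := sqr_ge0 l; rewrite !expr2; lra.
    + apply: integrable_EFinD; last exact: integrable_sqr.
      apply/integrableP; split.
        by apply/measurable_EFinP/measurable_indic; exact: measurable_box.
      under eq_integral do rewrite /= ger0_norm//.
      rewrite integral_indic ?setIT//; last exact: measurable_box.
      exact: box_finite.
  - move=> k x _; rewrite lee_fin ger0_norm ?mulr_ge0//.
    by rewrite ler_wpM2r// hatbox_le_indic.
have lr : (fun k => \int[nu]_t (hatbox a b k (X t))%:E)%E =
    (fun k => \int[lebesgue_n n]_x (hatbox a b k x * L x)%:E)%E.
  by apply/funext => k; exact: integral_hatbox.
rewrite -lr in rhs.
exact: cvg_unique lhs rhs.
Qed.


End occupation_density_boxes.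

Section boxes.
Context {R : realType} (n : nat).

(** No order between [a] and [b] is imposed: empty boxes count, so that intersections of boxes are
    boxes. *)
Definition boxes : set (set (Rvec R n)) :=
  [set A | exists a b : Rvec R n, A = box a b].

Let itv_box (N : nat) (i : 'I_n) (r : R) : set (Rvec R n) :=
  box [tuple if j == i then r else - N%:R | j < n]
      [tuple N%:R | j < n].

Let bounded_tuple (x : Rvec R n) : exists N : nat, forall j, `|tnth x j| <= N%:R.
Proof.
exists (Num.bound (\sum_j `|tnth x j|)) => j.
apply: ltW; apply: le_lt_trans (archi_boundP _); last by apply: sumr_ge0.
by rewrite (bigD1 j)//= lerDl sumr_ge0.
Qed.

Lemma bigcup_boxes :
  \bigcup_N box [tuple - N%:R | j < n] [tuple N%:R | j < n] = [set: Rvec R n].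
Proof.
apply/seteqP; split => // x _; have [N xN] := bounded_tuple x.
by exists N => // j; rewrite !tnth_mktuple -ler_norml.
Qed.

Lemma boxes_setI_closed : setI_closed boxes.
Proof.
move=> _ _ [a [b ->]] [a' [b' ->]].
exists [tuple Num.max (tnth a j) (tnth a' j) | j < n],
  [tuple Num.min (tnth b j) (tnth b' j) | j < n].
apply/seteqP; split => [x [xab xab'] j|x h].
  rewrite !tnth_mktuple ge_max le_min.
  by have /andP[-> ->] := xab j; have /andP[-> ->] := xab' j.
split => j; have := h j; rewrite !tnth_mktuple ge_max le_min => /andP[/andP[? ?] /andP[? ?]];
  exact/andP.
Qed.

(** It is enough that the coordinates are measurable for the sigma-algebra of boxes, and a
    half-space [r <= x_i] is a countable union of bounded boxes. *)
Lemma measurable_sub_boxes (A : set (Rvec R n)) : measurable A -> <<s boxes >> A.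
Proof.
move=> mA.
have mid : measurable_fun setT (id : g_sigma_algebraType boxes -> Rvec R n).
  apply/measurable_fun_tnthP => i.
  apply: (measurability (@RGenCInfty.G R)) => [|/= _ [_] [r] -> <-].
    exact: RGenCInfty.measurableE.
  rewrite setTI (_ : _ @^-1` _ = \bigcup_N itv_box N i r).
    apply: bigcup_measurable => N _; apply: sub_sigma_algebra.
    by eexists; eexists; reflexivity.
  apply/seteqP; split => x /=.
    rewrite in_itv/= andbT => rx; have [N xN] := bounded_tuple x.
    exists N => // j; rewrite !tnth_mktuple.
    have := xN j; rewrite ler_norml => /andP[Nx ->]; rewrite andbT.
    by case: eqP => [->|].
  move=> [N _ /(_ i)]; rewrite !tnth_mktuple eqxx in_itv/= andbT.
  by case/andP.
have := mid measurableT _ mA.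
by rewrite setTI.
Qed.

Lemma measure_eq_boxes (m1 m2 : {measure set (Rvec R n) -> \bar R}) :
  (forall a b, m1 (box a b) = m2 (box a b)) ->
  (forall a b, m1 (box a b) < +oo)%E ->
  forall A, measurable A -> m1 A = m2 A.
Proof.
move=> m12 m1oo A mA.
apply: (@g_sigma_algebra_measure_unique _ _ _ boxes _
  (fun N => box [tuple - N%:R | j < n] [tuple N%:R | j < n])) => //.
- by move=> _ [a [b ->]]; exact: measurable_box.
- by move=> N; eexists; eexists; reflexivity.
- exact: bigcup_boxes.
- exact: boxes_setI_closed.
- by move=> _ [a [b ->]].
- exact: measurable_sub_boxes.
Qed.

End boxes.

Section density_measure.
Context d (T : measurableType d) (R : realType) (mu : {measure set T -> \bar R}).
Variables (f : T -> R) (mf : measurable_fun setT f) (f0 : forall x, 0 <= f x).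

(** The two proofs are arguments so that the measure structure can be attached to the term
    itself. *)
Definition density_measure (_ : measurable_fun setT f) (_ : forall x, 0 <= f x)
    (A : set T) : \bar R := (\int[mu]_(x in A) (f x)%:E)%E.

Let density0 : density_measure mf f0 set0 = 0%E.
Proof. by rewrite /density_measure integral_set0. Qed.

Let density_ge0 A : (0 <= density_measure mf f0 A)%E.
Proof. by apply: integral_ge0 => x _; rewrite lee_fin. Qed.

Let density_sigma_additive : semi_sigma_additive (density_measure mf f0).
Proof.
move=> F mF tF mUF; rewrite /density_measure ge0_integral_bigcup//.
- apply: is_cvg_ereal_nneg_natsum_cond => k _ _.
  exact: density_ge0.
- by apply/measurable_EFinP; exact: measurable_funTS.
- by move=> x _; rewrite lee_fin.
Qed.

HB.instance Definition _ := isMeasure.Build _ _ _ (density_measure mf f0)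
  density0 density_ge0 density_sigma_additive.

End density_measure.

Section occupation_density_existence.
Context d (T : measurableType d) (R : realType) (n : nat).
Variables (nu : {sigma_finite_measure set T -> \bar R}) (X : T -> Rvec R n).
Hypothesis mX : measurable_fun setT X.
Hypothesis int1 : nu.-integrable setT (EFin \o (fun=> 1 : R)).
Notation lbn := (@lebesgue_n R n).

Let c := cos_transform nu X (fun=> 1).
Let s := sin_transform nu X (fun=> 1).

Hypothesis L2cs : (\int[lbn]_y (c y ^+ 2 + s y ^+ 2)%:E < +oo)%E.

Definition is_density (L : Rvec R n -> R) : Prop :=
  [/\ measurable_fun setT L, forall x, 0 <= L x &
    forall A, measurable A -> nu (X @^-1` A) = (\int[lbn]_(x in A) (L x)%:E)%E].

(** Quantitative form of [L] being the L^2 inverse transform of [c + i s]. It sees [L] only up to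
    null sets, which lets it pass from one density to another. *)
Definition L2_transform_bound (L : Rvec R n -> R) : Prop :=
  (\int[lbn]_x (L x ^+ 2)%:E < +oo)%E /\
  forall h1 h2, lbn.-integrable setT (EFin \o h1) ->
    lbn.-integrable setT (EFin \o h2) ->
    (\int[lbn]_x ((ift_re h1 h2 x - L x) ^+ 2 + ift_im h1 h2 x ^+ 2)%:E <=
     (4 * ift_bound R n)%:E *
       \int[lbn]_y ((h1 y - c y) ^+ 2 + (h2 y - s y) ^+ 2)%:E)%E.

Let nu_fin A : measurable A -> (nu A < +oo)%E.
Proof.
move=> mA; apply: (@le_lt_trans _ _ (nu setT)).
  by apply: le_measure; rewrite ?inE.
move/integrableP : int1 => [_].
under eq_integral do rewrite /= normr1.
by rewrite integral_cst// mul1e.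
Qed.

Lemma occupation_density_exists : exists L, is_density L /\ L2_transform_bound L.
Proof.
have [N [L [jN [mL L0] pL L2 bd]]] := occupation_density_L2 mX int1 L2cs.
exists L; split; last by split.
split => // A mA.
have e0 k : 0 < (N k).+1%:R^-1 :> R by rewrite invr_gt0.
have ecvg : (fun k => (N k).+1%:R^-1 : R) @ \oo --> (0 : R).
  apply/cvgrPdist_le => r r0.
  have : \forall k \near \oo, (k.+1%:R^-1 : R) < r.
    have hc : (k.+1%:R^-1 : R) @[k --> \oo] --> (0 : R) by exact: cvg_harmonic.
    exact: cvgr_lt hc _ r0.
  apply: filterS => k kr; rewrite sub0r normrN ger0_norm ?invr_ge0//.
  by apply: le_trans (ltW kr); rewrite lef_pV2 ?posrE// ler_nat ltnS.
have mp k : measurable_fun setT (smoothed_density nu X (N k).+1%:R^-1).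
  apply: measurable_funM => //.
  apply: (@measurable_Rintegral_param _ _ _ _ _ nu
    (fun z => gaussn ((N k).+1%:R^-1)^-1 (vsub (X z.2) z.1))).
  apply: (measurableT_comp (measurable_gaussn _)).
  by apply: measurable_vsub2 => //; exact: (measurableT_comp mX).
have boxE a b := occupation_box mX int1 mL L0 L2 e0 ecvg mp pL a b.
have := @measure_eq_boxes R n (pushforward nu X) (density_measure lbn mL L0).
apply => //.
move=> a b; rewrite /= /pushforward; apply: nu_fin.
by rewrite -[_ @^-1` _]setTI; apply: mX => //; exact: measurable_box.
Qed.

(** Two densities of the same finite measure agree almost everywhere. This is what makes the
    representation hold for every version of the local time. *)
Lemma is_density_L2 (L : Rvec R n -> R) : is_density L -> L2_transform_bound L.
Proof.
move=> [mL L0 dL]; have [L' [[mL' L'0 dL'] [L'2 L'bd]]] := occupation_density_exists.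
have iL : lbn.-integrable setT (EFin \o L).
  apply/integrableP; split; first exact/measurable_EFinP.
  under eq_integral do rewrite /= ger0_norm//.
  by rewrite -dL// nu_fin// preimage_setT.
have LL' : ae_eq lbn setT (EFin \o L) (EFin \o L').
  apply: integral_ae_eq => //; first exact/measurable_EFinP.
  by move=> E _ mE /=; rewrite -dL// -dL'.
have LE : {ae lbn, forall x, L x = L' x}.
  by apply: filterS LL' => x /= /(_ I) [].
split.
  rewrite (ae_eq_integral (fun x => (L' x ^+ 2)%:E))//.
  - by apply/measurable_EFinP; exact: measurable_funX.
  - by apply/measurable_EFinP; exact: measurable_funX.
  - by apply: filterS LE => x /= -> _.
move=> h1 h2 ih1 ih2; apply: le_trans (L'bd _ _ ih1 ih2).
rewrite le_eqVlt; apply/orP; left; apply/eqP; apply: ae_eq_integral => //.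
- apply/measurable_EFinP/measurable_funD; apply: measurable_funX.
    by apply: measurable_funB => //; exact: measurable_ift_re.
  exact: measurable_ift_im.
- apply/measurable_EFinP/measurable_funD; apply: measurable_funX.
    by apply: measurable_funB => //; exact: measurable_ift_re.
  exact: measurable_ift_im.
- by apply: filterS LE => x /= -> _.
Qed.

End occupation_density_existence.

(** * Complex-valued functions and the L^2 inverse Fourier transform *)

Section complex_L2.
Context (R : realType) (n : nat).
Implicit Types h f g : Rvec R n -> R[i].
Notation lbn := (@lebesgue_n R n).
Notation Re := complex.Re.
Notation Im := complex.Im.
Let re h x := Re (h x).
Let im h x := Im (h x).

(** Square of the L^2 norm; it keeps the estimates free of the power 1/2. *)
Definition sqint f : \bar R := (\int[lbn]_x (Re (f x) ^+ 2 + Im (f x) ^+ 2)%:E)%E.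

Lemma sqint_ge0 f : (0 <= sqint f)%E.
Proof. by apply: integral_ge0 => x _; rewrite lee_fin addr_ge0 ?sqr_ge0. Qed.

Lemma normcE (z : R[i]) :
  ComplexField.Normc.normc z = Num.sqrt (Re z ^+ 2 + Im z ^+ 2).
Proof. by case: z. Qed.

Lemma cLnorm2E f : cLnorm 2%:E f = (sqint f `^ 2^-1)%E.
Proof.
rewrite /cLnorm unlock; congr (_ `^ _)%E; apply: eq_integral => x _ /=.
rewrite normcE ger0_norm ?sqrtr_ge0// -[2%R]/(2%:R) powR_mulrn ?sqrtr_ge0//.
by rewrite sqr_sqrtr// addr_ge0 ?sqr_ge0.
Qed.

Lemma cLnorm2_lty f : (cLnorm 2%:E f < +oo)%E <-> (sqint f < +oo)%E.
Proof.
rewrite cLnorm2E; have := sqint_ge0 f; case: (sqint f) => [r|//|//].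
- by rewrite poweR_EFin !ltry.
- by rewrite poweRE eqxx invr_eq0 pnatr_eq0.
Qed.

Lemma cLnorm2_le f (e : R) : 0 < e ->
  (cLnorm 2%:E f <= e%:E)%E <-> (sqint f <= (e ^+ 2)%:E)%E.
Proof.
move=> e0; rewrite cLnorm2E; have := sqint_ge0 f; case: (sqint f) => [r r0|_|//].
- rewrite poweR_EFin !lee_fin; rewrite lee_fin in r0.
  by rewrite powR12_sqrt// -{2}(sqr_sqrtr r0) ler_pXn2r// nnegrE ?sqrtr_ge0 ?ltW.
- by rewrite poweRE eqxx invr_eq0 pnatr_eq0/= !leNgt !ltry.
Qed.

Lemma cLnorm_ge0 p f : (0 <= cLnorm p f)%E.
Proof. exact: Lnorm_ge0. Qed.

Lemma ereal_cvg0_near (u : nat -> \bar R) : (forall k, (0 <= u k)%E) ->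
  (forall e, 0 < e -> \forall k \near \oo, (u k <= e%:E)%E) ->
  (u k @[k --> \oo] --> 0)%E.
Proof.
move=> u0 ue; apply/fine_cvgP; split.
  have := ue 1 ltr01; apply: filterS => k uk.
  by rewrite ge0_fin_numE// (le_lt_trans uk)// ltry.
apply/cvgrPdist_le => e e0; have := ue e e0; apply: filterS => k uk.
have uf : u k \is a fin_num by rewrite ge0_fin_numE// (le_lt_trans uk)// ltry.
rewrite sub0r normrN /= ger0_norm ?fine_ge0//.
by rewrite -lee_fin fineK.
Qed.

Lemma in_cL1_integrable h : in_cLp 1%:E h ->
  lbn.-integrable setT (EFin \o (re h)) /\ lbn.-integrable setT (EFin \o (im h)).
Proof.
move=> [mr mi hy].
have ih : lbn.-integrable setT (EFin \o (fun x => ComplexField.Normc.normc (h x))).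
  apply/integrableP; split.
    apply/measurable_EFinP; under eq_fun do rewrite normcE.
    apply: (@measurableT_comp _ _ _ _ _ _ (@Num.sqrt R)).
      by apply: continuous_measurable_fun; exact: sqrt_continuous.
    by apply: measurable_funD; exact: measurable_funX.
  move: hy; rewrite /cLnorm unlock /= invr1 poweRe1; last first.
    by apply: integral_ge0 => x _; rewrite lee_fin powR_ge0.
  by under eq_integral do rewrite powRr1//.
split; apply: integrable_dominated ih => // x; rewrite normcE /=.
- rewrite -sqrtr_sqr ler_wsqrtr// lerDl sqr_ge0//.
- rewrite -sqrtr_sqr ler_wsqrtr// lerDr sqr_ge0//.
Qed.

Lemma inv_fourierE h x :
  lbn.-integrable setT (EFin \o (re h)) ->
  lbn.-integrable setT (EFin \o (im h)) ->
  inv_fourier h x =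
    (ift_re (re h) (im h) x +i* ift_im (re h) (im h) x)%C.
Proof.
move=> ir ii; have mid : measurable_fun setT (@id (Rvec R n)) by exact: measurable_id.
rewrite /inv_fourier /cintegral /ift_re /ift_im.
rewrite -RintegralD//; [|exact: integrable_cos_mul|exact: integrable_sin_mul].
rewrite -RintegralB//; [|exact: integrable_cos_mul|exact: integrable_sin_mul].
have CE (r a b : R) : (r%:C * (a +i* b))%C = ((r * a)%R +i* (r * b)%R)%C.
  by apply/eqP; rewrite eq_complex /= !mul0r subr0 addr0 !eqxx.
rewrite CE; congr ((_ * _)%R +i* (_ * _)%R)%C; apply: eq_Rintegral => y _.
- by rewrite /re /im; case: (h y) => p q /=; rewrite cosN sinN; ring.
- by rewrite /re /im; case: (h y) => p q /=; rewrite cosN sinN; ring.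
Qed.

End complex_L2.

Section L2_inverse_fourier.
Context d (T : measurableType d) (R : realType) (n : nat).
Variables (nu : {sigma_finite_measure set T -> \bar R}) (X : T -> Rvec R n).
Hypothesis mX : measurable_fun setT X.
Hypothesis int1 : nu.-integrable setT (EFin \o (fun=> 1 : R)).
Notation lbn := (@lebesgue_n R n).

Let c := cos_transform nu X (fun=> 1).
Let s := sin_transform nu X (fun=> 1).

Hypothesis L2cs : (\int[lbn]_y (c y ^+ 2 + s y ^+ 2)%:E < +oo)%E.

(** Integrability of [h k] splits its inverse transform into real integrals; the bound shared by all
    densities then controls the error by the distance from [h k] to the transform. *)
Lemma is_L2_inv_fourier_density (L : Rvec R n -> R) : is_density nu X L ->
  is_L2_inv_fourier (fun y => c y +i* s y)%C (fun x => (L x)%:C)%C.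
Proof.
move=> dL; have [L2 bd] := is_density_L2 mX int1 L2cs dL.
have [mL L0 _] := dL.
pose C := 4 * ift_bound R n.
have C0 : 0 <= C by rewrite mulr_ge0// ift_bound_ge0.
split.
- split; [exact: measurable_cos_transform|exact: measurable_sin_transform|].
  exact/cLnorm2_lty.
- split => //=; apply/cLnorm2_lty; rewrite /sqint.
  by under eq_integral do rewrite /= expr0n addr0.
move=> h hL hf; apply: ereal_cvg0_near => [k|e e0]; first exact: cLnorm_ge0.
(* [C r^2 <= e^2] because [C <= (1 + C)^2]; the added 1 keeps the denominator positive. *)
pose r : R := e / (1 + C).
have C1 : 0 < 1 + C by rewrite addrC ltr_wpDl.
have r0 : 0 < r by rewrite divr_gt0.
have := ereal_cvg0_near_le hf r0; apply: filterS => k.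
move/(cLnorm2_le _ r0) => hk; apply/(cLnorm2_le _ e0).
have [ir ii] := in_cL1_integrable (hL k).1.
apply: (@le_trans _ _ (C * r ^+ 2)%:E); last first.
  rewrite lee_fin /r expr_div_n mulrCA ler_piMr ?sqr_ge0//.
  by rewrite ler_pdivrMr ?exprn_gt0// mul1r; nra.
rewrite EFinM; apply: le_trans (lee_wpmul2l _ hk); last by rewrite lee_fin.
rewrite /sqint.
rewrite (eq_integral (fun x => ((ift_re (fun y => complex.Re (h k y))
    (fun y => complex.Im (h k y)) x - L x) ^+ 2 +
    ift_im (fun y => complex.Re (h k y)) (fun y => complex.Im (h k y)) x ^+ 2)%:E)).
  rewrite [in leRHS](eq_integral (fun y => ((complex.Re (h k y) - c y) ^+ 2 +
    (complex.Im (h k y) - s y) ^+ 2)%:E)); first exact: bd.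
  by move=> y _; case: (h k y).
by move=> x _; rewrite inv_fourierE//= subr0.
Qed.

End L2_inverse_fourier.

(** * Gaussian random variables and increments of the sheet *)

Section density.
Context d (T : measurableType d) (R : realType).
Variables (mu : {sigma_finite_measure set T -> \bar R})
  (nu : {finite_measure set T -> \bar R}) (g : T -> R).
Hypothesis ig : mu.-integrable setT (EFin \o g).
Hypothesis nuE : forall A, measurable A -> nu A = (\int[mu]_(x in A) (g x)%:E)%E.

Let dom : nu `<< mu.
Proof.
apply/null_content_dominatesP => A mA A0; rewrite nuE//.
apply: null_set_integral => //.
exact/measurable_funTS/(measurable_int _ ig).
Qed.

(** [g] agrees almost everywhere with the Radon-Nikodym derivative of [nu], for which the change of
    variables is known. *)
Lemma ge0_integral_density (f : T -> \bar R) : measurable_fun setT f ->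
  (forall x, (0 <= f x)%E) -> (\int[nu]_x f x = \int[mu]_x (f x * (g x)%:E))%E.
Proof.
move=> mf f0; rewrite -(Radon_Nikodym_SigmaFinite.change_of_variables dom)//.
apply: ae_eq_integral => //.
- apply: emeasurable_funM => //.
  exact: measurable_int (Radon_Nikodym_SigmaFinite.f_integrable dom).
- by apply: emeasurable_funM => //; exact: measurable_int ig.
- apply: ae_eqe_mul2l; apply: integral_ae_eq => //.
  + exact: Radon_Nikodym_SigmaFinite.f_integrable.
  + exact: measurable_int ig.
  + move=> E _ mE.
    by rewrite -(Radon_Nikodym_SigmaFinite.f_integral dom)// nuE.
Qed.

Lemma Rintegral_density (f : T -> R) : (forall x, 0 <= g x) ->
  nu.-integrable setT (EFin \o f) ->
  \int[nu]_x f x = \int[mu]_x (f x * g x).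
Proof.
move=> g0 intf; rewrite /Rintegral; congr fine.
have mf := measurable_int _ intf.
rewrite integralE [RHS]integralE.
rewrite !ge0_integral_density//; [|exact: measurable_funeneg|exact: measurable_funepos].
congr (_ - _)%E; apply: eq_integral => x _.
  by rewrite !funeposE -!EFin_max -EFinM maxr_pMl// mul0r.
by rewrite !funenegE -!EFinN -!EFin_max -EFinM maxr_pMl// mul0r mulNr.
Qed.
End density.

Section image_measure.
Context d (T : measurableType d) d2 (T2 : measurableType d2) (R : realType).
Variables (mu : {measure set T -> \bar R}) (nu : {measure set T2 -> \bar R}).
Variable (X : T -> T2).
Hypothesis mX : measurable_fun setT X.
Hypothesis nuE : forall A, measurable A -> mu (X @^-1` A) = nu A.

Lemma ge0_integral_image (f : T2 -> \bar R) : measurable_fun setT f ->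
  (forall x, (0 <= f x)%E) -> (\int[nu]_x f x = \int[mu]_w f (X w))%E.
Proof.
move=> mf f0.
rewrite -[RHS](@ge0_integral_pushforward _ _ _ _ _ _ mX mu setT)//.
by apply: eq_measure_integral => A mA _; rewrite -nuE.
Qed.

Lemma integrable_image (h : T2 -> R) : measurable_fun setT h ->
  mu.-integrable setT (fun w => (h (X w))%:E) -> nu.-integrable setT (EFin \o h).
Proof.
move=> mh /integrableP[_ ih]; apply/integrableP; split.
  exact/measurable_EFinP.
rewrite ge0_integral_image//; apply: measurableT_comp => //.
exact/measurable_EFinP.
Qed.

Lemma Rintegral_image (h : T2 -> R) : measurable_fun setT h ->
  \int[nu]_x h x = \int[mu]_w h (X w).
Proof.
move=> mh; have mh' : measurable_fun setT (EFin \o h) by exact/measurable_EFinP.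
rewrite /Rintegral; congr fine; rewrite integralE [RHS]integralE.
rewrite !ge0_integral_image//;
  [|exact: measurable_funeneg|exact: measurable_funepos].
by congr (_ - _)%E; apply: eq_integral => x _; rewrite ?funeposE ?funenegE.
Qed.
End image_measure.

Section gaussian_cf.
Context (R : realType) (d : measure_display) (T : measurableType d).
Variable P : probability T R.

Lemma Rintegral_dirac d' (T' : measurableType d') (a : T') (h : T' -> R) :
  measurable_fun setT h -> \int[\d_a]_x h x = h a.
Proof.
move=> mh; rewrite /Rintegral integral_dirac//.
  by rewrite diracT mul1e.
exact/measurable_EFinP.
Qed.

Lemma Rintegral_normal_prob (m s : R) (h : R -> R) : s != 0 ->
  (normal_prob m s).-integrable setT (EFin \o h) ->
  \int[normal_prob m s]_x h x =
  \int[@lebesgue_measure R]_x (h x * normal_pdf m s x).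
Proof.
move=> s0 ih.
apply: (@Rintegral_density _ (measurableTypeR R)) => //.
- exact: integrable_normal_pdf.
- by move=> x; exact: normal_pdf_ge0.
Qed.

(** Being Gaussian only provides some [m] and [s]. The moments force [m = 0] and [s^2 = v], and the
    Gaussian transform is then taken at frequency 1; the point mass [s = 0] is a separate case. *)
Lemma gaussian_rv_cos (X : T -> R) v : measurable_fun setT X ->
  gaussian_rv P X -> P.-integrable setT (fun w => (X w ^+ 2)%:E) ->
  \int[P]_w X w = 0 -> \int[P]_w (X w ^+ 2) = v ->
  \int[P]_w cos (X w) = expR (- v / 2).
Proof.
move=> mX [m [s [s0 XE]]] iX2 X0 Xv.
have iX : P.-integrable setT (fun w => (X w)%:E).
  apply: (@integrable_dominated _ T R P _ (fun w => 1 + X w ^+ 2)) => //.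
    move=> w; have := sqr_ge0 (`|X w| - 1); rewrite sqrrB real_normK ?num_real//.
    have := normr_ge0 (X w); have := sqr_ge0 (X w); lra.
  apply: integrable_EFinD => //.
  exact: finite_measure_integrable_cst.
have ic : P.-integrable setT (fun w => (cos (X w))%:E).
  apply: (@integrable_dominated _ T R P _ (fun w => 1)).
  - by apply: measurableT_comp mX; exact: measurable_cos.
  - by move=> w; rewrite ler_norml cos_geN1 cos_le1.
  - exact: finite_measure_integrable_cst.
have msqr : measurable_fun setT (fun x : R => x ^+ 2).
  by apply: measurable_funX; exact: measurable_id.
have [sE|sN0] := eqVneq s 0.
  have PE (h : R -> R) : measurable_fun setT h -> \int[P]_w h (X w) = h m.
    move=> mh; rewrite -[RHS](@Rintegral_dirac _ (measurableTypeR R) m h mh).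
    apply/esym; apply: (@Rintegral_image _ T _ (measurableTypeR R) R P
      (@dirac _ (measurableTypeR R) m R) X mX _ h mh) => A mA.
    by have := XE A mA; rewrite sE eqxx.
  have m0 : m = 0 by rewrite -X0 -(PE id).
  rewrite -Xv (PE (fun x => x ^+ 2))// m0 expr0n /=.
  by rewrite (PE (@cos R)) ?m0 ?cos0 ?oppr0 ?mul0r ?expR0//; exact: measurable_cos.
have s_gt0 : 0 < s by rewrite lt_neqAle eq_sym sN0.
have PE (h : R -> R) : measurable_fun setT h ->
    P.-integrable setT (fun w => (h (X w))%:E) ->
    \int[P]_w h (X w) = \int[@lebesgue_measure R]_x (h x * normal_pdf m s x).
  move=> mh ih.
  have XE' (A : set (measurableTypeR R)) : measurable A -> P (X @^-1` A) = normal_prob m s A.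
    by move=> mA; have := XE A mA; rewrite (negbTE sN0).
  rewrite -Rintegral_normal_prob//.
    by rewrite (@Rintegral_image _ T _ (measurableTypeR R) R P
      (normal_prob m s) X mX XE' h mh).
  exact: (@integrable_image _ T _ (measurableTypeR R) R P
    (normal_prob m s) X mX XE' h mh).
have idX : P.-integrable setT (fun w => (X w - m)%:E).
  by apply: integrable_EFinB => //; exact: finite_measure_integrable_cst.
have ipdf : (@lebesgue_measure R).-integrable setT (EFin \o normal_pdf m s).
  exact: integrable_normal_pdf.
have m0 : m = 0.
  have := PE (fun x => x - m) _ idX; rewrite Rintegral_normal_pdf_lin//.
  rewrite RintegralB//; last exact: finite_measure_integrable_cst.
  rewrite X0 Rintegral_cst// (_ : fine (P setT) = 1); last first.
    by rewrite probability_setT.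
  rewrite mulr1 sub0r => E.
  apply/eqP; rewrite -oppr_eq0; apply/eqP; apply: E.
  exact: measurable_funB.
move: PE; rewrite m0 => PE.
have <- : s ^+ 2 = v.
  rewrite -Xv (PE (fun x => x ^+ 2))// -(Rintegral_normal_pdf_sqr 0 s_gt0).
  by apply: eq_Rintegral => x _; rewrite subr0.
rewrite (PE (@cos R))//; last exact: measurable_cos.
have := Rintegral_normal_pdf_cos 0 s_gt0 0 1.
rewrite cos0 mul1r mulr1 => <-.
by apply: eq_Rintegral => x _; rewrite subr0 mul1r addr0.
Qed.

(** Independence identifies the joint law with the product of the marginal laws on rectangles, hence
    everywhere; the mean of the product is then an integral over a product measure. *)
Lemma Rintegral_indepM (X Y : T -> R) :
  measurable_fun setT X -> measurable_fun setT Y ->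
  P.-integrable setT (EFin \o X) -> P.-integrable setT (EFin \o Y) ->
  (forall A B : set (measurableTypeR R), measurable A -> measurable B ->
    P (X @^-1` A `&` Y @^-1` B) = P (X @^-1` A) * P (Y @^-1` B))%E ->
  \int[P]_w (X w * Y w) = \int[P]_w X w * \int[P]_w Y w.
Proof.
move=> mX mY iX iY XY.
have mX' : measurable_fun setT (X : T -> measurableTypeR R) by [].
have mY' : measurable_fun setT (Y : T -> measurableTypeR R) by [].
pose X' : {mfun T >-> measurableTypeR R} :=
  HB.pack (X : T -> measurableTypeR R) (isMeasurableFun.Build _ _ _ _ _ mX').
pose Y' : {mfun T >-> measurableTypeR R} :=
  HB.pack (Y : T -> measurableTypeR R) (isMeasurableFun.Build _ _ _ _ _ mY').
pose PX := distribution P X'; pose PY := distribution P Y'.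
pose Z w : (measurableTypeR R * measurableTypeR R) := (X w, Y w).
have mZ : measurable_fun setT Z by apply/measurable_fun_pairP.
have ZE A : measurable A -> P (Z @^-1` A) = (PX \x PY)%E A.
  move=> mA.
  apply/esym; apply: (@product_measure_unique _ _ _ _ _ PX PY
    (pushforward P Z)) => //.
have mid : measurable_fun setT (@id (measurableTypeR R)) by exact: measurable_id.
have iX' : PX.-integrable setT (EFin \o @id (measurableTypeR R)).
  by apply: (@integrable_image _ T _ (measurableTypeR R) R P PX X).
have iY' : PY.-integrable setT (EFin \o @id (measurableTypeR R)).
  by apply: (@integrable_image _ T _ (measurableTypeR R) R P PY Y).
transitivity (\int[(PX \x PY)%E]_z (z.1 * z.2)).
  rewrite (Rintegral_image mZ ZE)//.
  by apply: measurable_funM; [exact: measurable_fst|exact: measurable_snd].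
rewrite (Rintegral_prodM iX' iY').
by congr (_ * _); [apply: (@Rintegral_image _ T _ (measurableTypeR R) R P PX X)|
  apply: (@Rintegral_image _ T _ (measurableTypeR R) R P PY Y)].
Qed.
End gaussian_cf.

(** * Variance and characteristic function of the increments *)

Section field_increments.
Context (R : realType) (dO : measure_display) (Omega : measurableType dO).
Context (P : probability Omega R) (N d : nat).
Context (B : Rvec R N -> {RV P >-> Rvec R d}) (H K : 'I_N -> R).
Hypothesis bbs : bifractional_brownian_sheet B H K.

Let cov := @bifractional_cov R N H K.

Lemma measurable_component i t : measurable_fun setT (component B i t).
Proof.
apply: (measurableT_comp (measurable_tnth i)).
exact: measurable_funP (B t).
Qed.

Lemma integrable_component_sqr i t : Rplus R N t ->
  P.-integrable setT (fun w => (component B i t w ^+ 2)%:E).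
Proof.
move=> t0; have := bbs_covariance bbs i t0 t0; rewrite unlock => E.
have mX := measurable_component i t.
apply/integrableP; split.
  by apply/measurable_EFinP; exact: measurable_funX.
under eq_integral do rewrite gee0_abs ?lee_fin ?sqr_ge0//.
by under eq_integral do rewrite expr2; rewrite E ltry.
Qed.

Lemma integrable_mul_of_sqr (X Y : Omega -> R) :
  measurable_fun setT X -> measurable_fun setT Y ->
  P.-integrable setT (fun w => (X w ^+ 2)%:E) ->
  P.-integrable setT (fun w => (Y w ^+ 2)%:E) ->
  P.-integrable setT (fun w => (X w * Y w)%:E).
Proof.
move=> mX mY iX iY.
apply: (@integrable_dominated _ Omega R P _ (fun w => X w ^+ 2 + Y w ^+ 2)).
- exact: measurable_funM.
- move=> w; rewrite normrM -(real_normK (num_real (X w))).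
  rewrite -(real_normK (num_real (Y w))).
  have := sqr_ge0 (`|X w| - `|Y w|); rewrite sqrrB.
  by have := normr_ge0 (X w); have := normr_ge0 (Y w); nra.
- exact: integrable_EFinD.
Qed.

Lemma integrable_of_sqr (X : Omega -> R) : measurable_fun setT X ->
  P.-integrable setT (fun w => (X w ^+ 2)%:E) ->
  P.-integrable setT (EFin \o X).
Proof.
move=> mX iX; have := @integrable_mul_of_sqr X (cst 1) mX _ iX.
rewrite (_ : (fun w => (X w * cst 1 w)%:E) = EFin \o X); last first.
  by apply/funext => w /=; rewrite mulr1.
apply => //; rewrite /= expr1n; exact: finite_measure_integrable_cst.
Qed.

Lemma integrable_component i t : Rplus R N t ->
  P.-integrable setT (EFin \o component B i t).
Proof.
by move=> t0; apply: integrable_of_sqr (integrable_component_sqr i t0);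
  exact: measurable_component.
Qed.

Lemma Rintegral_component i t : Rplus R N t ->
  \int[P]_w component B i t w = 0.
Proof.
by move=> t0; have := bbs_centered bbs i t0; rewrite unlock /Rintegral => ->.
Qed.

Lemma Rintegral_componentM i s t : Rplus R N s -> Rplus R N t ->
  \int[P]_w (component B i s w * component B i t w) = cov s t.
Proof.
move=> s0 t0; have := bbs_covariance bbs i s0 t0.
by rewrite unlock /Rintegral /= => ->.
Qed.

(** The variance of a coordinate of [B(s) - B(t)], common to all coordinates. *)
Definition bbs_variogram (s t : Rvec R N) : R := cov s s + cov t t - 2 * cov s t.

Variables (s t : Rvec R N) (s0 : Rplus R N s) (t0 : Rplus R N t).

Let D i w := component B i s w - component B i t w.

Let mD i : measurable_fun setT (D i).
Proof. by apply: measurable_funB; exact: measurable_component. Qed.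

Let iD2 i : P.-integrable setT (fun w => (D i w ^+ 2)%:E).
Proof.
apply: (@integrable_dominated _ Omega R P _ (fun w =>
  2 * component B i s w ^+ 2 + 2 * component B i t w ^+ 2)).
- exact: measurable_funX.
- move=> w; rewrite /D ger0_norm ?sqr_ge0//.
  by have := sqr_ge0 (component B i s w + component B i t w); nra.
- by apply: integrable_EFinD; apply: integrable_EFinZ;
    exact: integrable_component_sqr.
Qed.

Let D1 i : \int[P]_w D i w = 0.
Proof.
rewrite RintegralB//; [|exact: integrable_component..].
by rewrite !Rintegral_component// subrr.
Qed.

Let D2 i : \int[P]_w (D i w * D i w) = bbs_variogram s t.
Proof.
pose X := component B i s; pose Y := component B i t.
have mX : measurable_fun setT X by exact: measurable_component.
have mY : measurable_fun setT Y by exact: measurable_component.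
have iX : P.-integrable setT (fun w => (X w ^+ 2)%:E).
  exact: integrable_component_sqr.
have iY : P.-integrable setT (fun w => (Y w ^+ 2)%:E).
  exact: integrable_component_sqr.
have iXY := integrable_mul_of_sqr mX mY iX iY.
have iXX := integrable_mul_of_sqr mX mX iX iX.
have iYY := integrable_mul_of_sqr mY mY iY iY.
transitivity (\int[P]_w ((X w * X w + Y w * Y w) - 2 * (X w * Y w))).
  by apply: eq_Rintegral => w _; rewrite /D -/X -/Y; ring.
rewrite RintegralB//; [|exact: integrable_EFinD|exact: integrable_EFinZ].
by rewrite RintegralD// RintegralZl// !Rintegral_componentM.
Qed.

(** Each increment is a function of the marginal of its coordinate at the two times; independence is
    applied to preimages under the difference map [dl], with the whole space for the remaining
    coordinates. *)
Let D0 i j : i != j -> \int[P]_w (D i w * D j w) = 0.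
Proof.
move=> ij; rewrite Rintegral_indepM ?D1 ?mul0r//.
- exact: integrable_of_sqr.
- exact: integrable_of_sqr.
move=> A A' mA mA'.
pose u (k : 'I_2) := if k == 0 then s else t.
pose dl (v : Rvec R 2) : measurableTypeR R := tnth v 0 - tnth v 1.
have mdl : measurable_fun setT dl.
  by apply: measurable_funB; exact: measurable_tnth.
pose C (k : 'I_d) : set (Rvec R 2) :=
  if k == i then dl @^-1` A else if k == j then dl @^-1` A' else setT.
have u0 k : Rplus R N (u k) by rewrite /u; case: ifP.
have mdA (E : set (measurableTypeR R)) : measurable E -> measurable (dl @^-1` E).
  by move=> mE; rewrite -[X in measurable X]setTI; exact: mdl.
have mC k : measurable (C k).
  by rewrite /C; case: ifP => // _; [exact: mdA|case: ifP => // _; exact: mdA].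
have DE k (E : set (measurableTypeR R)) :
    marginal B k u @^-1` (dl @^-1` E) = D k @^-1` E.
  apply/seteqP; split=> w; rewrite /dl /D /marginal /= !tnth_mktuple.
    by [].
  by [].
have := bbs_independent bbs u0 mC.
rewrite (bigD1 i)//= (bigD1 j) 1?eq_sym//= big1 ?mule1; last first.
  move=> k /andP[ki kj].
  by rewrite /C (negbTE ki) (negbTE kj) preimage_setT probability_setT.
rewrite {2 3}/C eqxx (negbTE (_ : j != i)) 1?eq_sym// eqxx !DE => <-.
congr (P _); apply/seteqP; split => w /=.
  move=> [Aw A'w] k _; rewrite /C.
  case: eqVneq => [->|_]; first by rewrite -/(preimage _ _ _) DE.
  by case: eqVneq => [->|_//]; rewrite -/(preimage _ _ _) DE.
move=> h; split.
  by have := h i I; rewrite /C eqxx -/(preimage _ _ _) DE.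
have := h j I.
by rewrite /C (negbTE (_ : j != i)) 1?eq_sym// eqxx -/(preimage _ _ _) DE.
Qed.

Let W (y : Rvec R d) w := \sum_i tnth y i * D i w.

Let WE y w : W y w = dotv (vsub (B s w) (B t w)) y.
Proof.
by rewrite /W /dotv; apply: eq_bigr => i _; rewrite tnth_vsub mulrC.
Qed.

Let iD1 i : P.-integrable setT (EFin \o D i).
Proof. exact: integrable_of_sqr. Qed.

Let iDD i j : P.-integrable setT (fun w => (D i w * D j w)%:E).
Proof. exact: integrable_mul_of_sqr. Qed.

Lemma integrable_Rintegral_sum (I : eqType) (r : seq I) (a : I -> R)
    (f : I -> Omega -> R) :
  (forall i, P.-integrable setT (EFin \o f i)) ->
  P.-integrable setT (EFin \o (fun w => \sum_(i <- r) a i * f i w)) /\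
  \int[P]_w (\sum_(i <- r) a i * f i w) = \sum_(i <- r) a i * \int[P]_w f i w.
Proof.
move=> intf; elim: r => [|i r [IHi IHe]].
  split.
    under eq_fun do rewrite big_nil.
    exact: finite_measure_integrable_cst.
  under eq_Rintegral do rewrite big_nil.
  by rewrite Rintegral_cst// mul0r big_nil.
have ii : P.-integrable setT (EFin \o (fun w => a i * f i w)).
  exact: integrable_EFinZ.
split.
  under eq_fun do rewrite big_cons.
  exact: integrable_EFinD.
under eq_Rintegral do rewrite big_cons.
by rewrite RintegralD// RintegralZl// IHe big_cons.
Qed.

Let W1 y : \int[P]_w W y w = 0.
Proof.
rewrite (integrable_Rintegral_sum _ _ iD1).2.
by rewrite big1// => i _; rewrite D1 mulr0.
Qed.

Let W2 y : P.-integrable setT (fun w => (W y w ^+ 2)%:E) /\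
  \int[P]_w (W y w ^+ 2) = bbs_variogram s t * \sum_i tnth y i ^+ 2.
Proof.
have E w : W y w ^+ 2 = \sum_(p <- index_enum ('I_d * 'I_d)%type)
    (tnth y p.1 * tnth y p.2) * (D p.1 w * D p.2 w).
  rewrite expr2 /W big_distrlr /= pair_big /=.
  by apply: eq_bigr => -[i j] _ /=; rewrite mulrACA.
have [h1 h2] := @integrable_Rintegral_sum _ (index_enum ('I_d * 'I_d)%type)
  (fun p => tnth y p.1 * tnth y p.2) (fun p w => D p.1 w * D p.2 w)
  (fun p => iDD p.1 p.2).
split; first by under eq_fun do rewrite E; exact: h1.
under eq_Rintegral do rewrite E; rewrite h2.
rewrite -(pair_big xpredT xpredT (fun i j =>
  tnth y i * tnth y j * \int[P]_w (D i w * D j w))) /=.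
rewrite mulr_sumr; apply: eq_bigr => i _.
rewrite (bigD1 i)//= big1 ?addr0 => [|j ji]; last by rewrite D0 1?eq_sym// mulr0.
by rewrite D2 expr2 mulrC.
Qed.

Lemma bbs_variogram_ge0 : (0 < d)%N -> 0 <= bbs_variogram s t.
Proof.
move=> d0; rewrite -(D2 (Ordinal d0)); apply: Rintegral_ge0 => w _.
by rewrite -expr2 sqr_ge0.
Qed.

(** The pairing of [y] with [B(s) - B(t)] combines the field with vectors [y] at [s] and [-y] at
    [t], so it is Gaussian; since distinct coordinates are uncorrelated, its variance is the
    variogram times [|y|^2]. *)
Lemma Rintegral_cos_increment (y : Rvec R d) : (0 < d)%N ->
  \int[P]_w cos (dotv (vsub (B s w) (B t w)) y) =
  gaussn (Num.sqrt (bbs_variogram s t)) y.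
Proof.
move=> d0; have [i2 e2] := W2 y.
have mW : measurable_fun setT (W y).
  by apply: integrable_measurable; exact: (integrable_Rintegral_sum _ _ iD1).1.
have gW : gaussian_rv P (W y).
  pose u (k : 'I_2) := if k == 0 then s else t.
  pose c (k : 'I_2) : Rvec R d := if k == 0 then y else [tuple - tnth y i | i < d].
  have u0 k : Rplus R N (u k) by rewrite /u; case: ifP.
  have := bbs_gaussian bbs c u0.
  rewrite (_ : (fun w => _) = W y)//; apply/funext => w.
  rewrite big_ord_recl big_ord1 /u /c /= /dotv -big_split /=.
  apply: eq_bigr => i _; rewrite tnth_mktuple /D /component; ring.
transitivity (\int[P]_w cos (W y w)).
  by apply: eq_Rintegral => w _; rewrite WE.
rewrite (gaussian_rv_cos mW gW i2 (W1 y) e2) /gaussn -expR_sum; congr expR.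
rewrite -mulr_suml; congr (_ / 2); rewrite sumrN mulr_sumr; congr (- _).
by apply: eq_bigr => i _; rewrite exprMn sqr_sqrtr// bbs_variogram_ge0.
Qed.
End field_increments.

(** * Lower bounds on the variogram *)

Section powR_inequalities.
Context {R : realType}.
Implicit Types x y a K : R.

Lemma ger1_powR_le x K : 0 <= x <= 1 -> K <= 1 -> 0 < K -> x <= x `^ K.
Proof.
move=> /andP[x0 x1] K1 K0; have [->|xN0] := eqVneq x 0.
  by rewrite powR_ge0.
by apply: ger1_powR => //; rewrite x1 lt_neqAle eq_sym xN0 x0.
Qed.

(** After division by [x + y], each fraction in [[0, 1]] is at most its power of exponent [K <= 1],
    and the fractions sum to 1. *)
Lemma powR_subadditive x y K : 0 <= x -> 0 <= y -> 0 < K -> K <= 1 ->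
  (x + y) `^ K <= x `^ K + y `^ K.
Proof.
move=> x0 y0 K0 K1; have [s0|sN0] := eqVneq (x + y) 0.
  by rewrite s0 powR0 ?gt_eqF// addr_ge0 ?powR_ge0.
have s_gt0 : 0 < x + y by rewrite lt_neqAle eq_sym sN0 addr_ge0.
have fr z : 0 <= z -> z <= x + y -> (x + y) `^ K * (z / (x + y)) <= z `^ K.
  have S0 := ltW s_gt0; move=> z0 zs.
  rewrite -[in leRHS](divfK sN0 z) powRM ?divr_ge0//.
  rewrite [leRHS]mulrC ler_wpM2l ?powR_ge0// ger1_powR_le//.
  by rewrite divr_ge0//= ler_pdivrMr// mul1r.
apply: le_trans (lerD (fr x x0 _) (fr y y0 _)); rewrite ?lerDl ?lerDr//.
by rewrite -mulrDr -mulrDl divff// mulr1.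
Qed.

(** With [q = x / y] in [[r, 1]], [1 - q^h <= 1 - q = (1 - q)^h (1 - q)^(1 - h)]. Subadditivity
    alone would give the factor 1; the factor [(1 - r)^(1 - h)], below 1 when [r > 0] and [h < 1],
    is what creates a gap. *)
Lemma powR_sub_le x y h r : 0 < x -> x <= y -> 0 < h -> h <= 1 -> r * y <= x ->
  y `^ h - x `^ h <= (y - x) `^ h * (1 - r) `^ (1 - h).
Proof.
move=> x0 xy h0 h1 rx; have y0 := lt_le_trans x0 xy.
have [x0' y0'] := (ltW x0, ltW y0).
have q0 : 0 <= x / y <= 1.
  by rewrite divr_ge0//= ler_pdivrMr// mul1r.
have E1 : x `^ h = y `^ h * (x / y) `^ h.
  by rewrite -powRM ?divr_ge0// mulrC divfK// gt_eqF.
have E2 : (y - x) `^ h = y `^ h * (1 - x / y) `^ h.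
  case/andP: q0 => _ q1; rewrite -powRM ?subr_ge0//.
  by rewrite mulrBr mulr1 mulrC divfK// gt_eqF.
rewrite E1 E2 -{1}[y `^ h]mulr1 -mulrBr -mulrA ler_wpM2l ?powR_ge0//.
apply: (@le_trans _ _ (1 - x / y)).
  by rewrite lerB// ger1_powR_le.
case/andP: q0 => q0 q1; have [E|qN] := eqVneq (1 - x / y) 0.
  by rewrite E mulr_ge0 ?powR_ge0.
rewrite [leLHS](_ : _ = (1 - x / y) `^ h * (1 - x / y) `^ (1 - h)); last first.
  by rewrite -powRD ?qN ?implybT// (_ : h + (1 - h) = 1) ?powRr1 ?subr_ge0//; ring.
rewrite ler_wpM2l ?powR_ge0// ge0_ler_powR ?subr_ge0 ?nnegrE ?subr_ge0//.
  by rewrite (le_trans _ q1)// ler_pdivlMr.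
by rewrite lerB// ler_pdivlMr.
Qed.

End powR_inequalities.

Section bifractional_kernel.
Context {R : realType}.
Variables (h k : R).
Hypotheses (h0 : 0 < h) (h1 : h < 1) (k0 : 0 < k) (k1 : k <= 1).

Definition bifractional_cov1 (x y : R) : R :=
  (2 `^ k)^-1 * ((x `^ (2 * h) + y `^ (2 * h)) `^ k - `|y - x| `^ (2 * h * k)).

Lemma bifractional_cov1C x y : bifractional_cov1 x y = bifractional_cov1 y x.
Proof. by rewrite /bifractional_cov1 (addrC (x `^ _)) distrC. Qed.

Lemma bifractional_cov1xx x : 0 <= x -> bifractional_cov1 x x = (x `^ (h * k)) ^+ 2.
Proof.
move=> x0; rewrite /bifractional_cov1 subrr normr0.
rewrite powR0 ?subr0; last by rewrite !mulf_neq0 ?gt_eqF.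
rewrite (_ : _ + _ = 2 * x `^ (2 * h)) ?powRM ?powR_ge0//; last by ring.
rewrite mulKf ?gt_eqF ?powR_gt0// -powRrM.
by rewrite -powR_mulrn ?powR_ge0// -powRrM; congr (_ `^ _); ring.
Qed.

(** Nonnegative factors are what allows products over coordinates to be compared factor by
    factor. *)
Lemma bifractional_cov1_ge0 x y : 0 <= x -> 0 <= y -> 0 <= bifractional_cov1 x y.
Proof.
wlog xy : x y / x <= y.
  by move=> H x0 y0; have [/H|/ltW/H] := leP x y; [exact|rewrite bifractional_cov1C; exact].
move=> x0 y0; rewrite mulr_ge0 ?invr_ge0 ?powR_ge0// subr_ge0.
have [h0' k0'] := (ltW h0, ltW k0).
rewrite powRrM ge0_ler_powR ?nnegrE ?addr_ge0 ?powR_ge0//.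
rewrite ger0_norm ?subr_ge0//.
apply: (@le_trans _ _ (y `^ (2 * h))); last by rewrite lerDr powR_ge0.
by rewrite ge0_ler_powR ?nnegrE ?mulr_ge0 ?subr_ge0 ?gerBl.
Qed.

(** Here [r] bounds the ratio of two coordinates from below; the gap degenerates to 0 with [r], that
    is, towards the axes. *)
Definition bifractional_gap (r : R) : R :=
  (2 `^ k)^-1 * (1 - (1 - r) `^ (2 * k * (1 - h))).

Lemma bifractional_gap_gt0 r : 0 < r -> r < 1 -> 0 < bifractional_gap r.
Proof.
move=> r0 r1; rewrite mulr_gt0 ?invr_gt0 ?powR_gt0// subr_gt0.
have q0 : 0 < 2 * k * (1 - h) by rewrite !mulr_gt0 ?subr_gt0.
have E : 1 = 1 `^ (2 * k * (1 - h)) :> R by rewrite powR1.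
rewrite [ltRHS]E.
rewrite gt0_ltr_powR ?nnegrE ?subr_ge0 ?(ltW r1)//.
by rewrite gtrBl.
Qed.

(* x^{2h} + y^{2h} = 2 x^h y^h + (y^h - x^h)^2 and t^k is subadditive; then
   [powR_sub_le] bounds y^h - x^h by a fraction of (y - x)^h. *)
Lemma bifractional_cov1_gap x y r : 0 < x -> 0 < y -> 0 <= r -> r <= 1 ->
  r * y <= x -> r * x <= y ->
  bifractional_gap r * `|x - y| `^ (2 * h * k) <=
    x `^ (h * k) * y `^ (h * k) - bifractional_cov1 x y.
Proof.
wlog xy : x y / x <= y.
  move=> H x0 y0 r0 r1 a b; have [xy|/ltW xy] := leP x y; first exact: H.
  by rewrite bifractional_cov1C distrC [X in _ <= X - _]mulrC H.
move=> x0 y0 r0 r1 ryx _; have [x0' y0'] := (ltW x0, ltW y0).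
have [h0' k0'] := (ltW h0, ltW k0).
set X := x `^ h; set Y := y `^ h.
have X0 : 0 <= X by exact: powR_ge0.
have Y0 : 0 <= Y by exact: powR_ge0.
have XY : X <= Y by rewrite ge0_ler_powR ?nnegrE.
have sq z : 0 < z -> z `^ (2 * h) = (z `^ h) ^+ 2.
  by move=> z0; rewrite mulrC powRrM powR_mulrn ?powR_ge0.
pose Q := (y - x) `^ h * (1 - r) `^ (1 - h).
have Q0 : 0 <= Q by rewrite mulr_ge0 ?powR_ge0.
have XYQ : Y - X <= Q by apply: powR_sub_le => //; exact: ltW.
have EQ : (Q ^+ 2) `^ k = (y - x) `^ (2 * h * k) * (1 - r) `^ (2 * k * (1 - h)).
  rewrite -powR_mulrn// -powRrM /Q powRM ?powR_ge0// -!powRrM.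
  by congr (_ `^ _ * _ `^ _); ring.
have main : (x `^ (2 * h) + y `^ (2 * h)) `^ k <= 2 `^ k * (X * Y) `^ k + (Q ^+ 2) `^ k.
  rewrite !sq// -/X -/Y (_ : X ^+ 2 + Y ^+ 2 = 2 * (X * Y) + (Y - X) ^+ 2); last by ring.
  apply: le_trans (powR_subadditive _ _ k0 k1) _; rewrite ?sqr_ge0//.
    by rewrite !mulr_ge0.
  rewrite powRM ?mulr_ge0// lerD2l ge0_ler_powR ?nnegrE ?sqr_ge0//.
  by rewrite ler_sqr ?nnegrE ?subr_ge0.
rewrite /bifractional_gap /bifractional_cov1 distrC ger0_norm ?subr_ge0//.
have -> : x `^ (h * k) * y `^ (h * k) = (X * Y) `^ k.
  by rewrite powRM// -!powRrM.
have p2 : 0 < 2 `^ k :> R by rewrite powR_gt0.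
move: main; rewrite -(ler_pM2l (_ : 0 < (2 `^ k)^-1)) ?invr_gt0// EQ.
rewrite mulrDr mulKf ?gt_eqF//.
set U := (_ - _) `^ _; set V := (1 - r) `^ _; set Z := (_ + _) `^ k.
by set S := (X * Y) `^ k; set i := (2 `^ k)^-1; lra.
Qed.

End bifractional_kernel.

Section variogram_lower_bound.
Context {R : realType}.

(** Each [r i] with [i != j] is raised to [p i], so a gap in one coordinate survives in the whole
    product. *)
Lemma prodB_ge (I : finType) (p r : I -> R) (j : I) :
  (forall i, 0 <= r i <= p i) ->
  (p j - r j) * \prod_(i | i != j) p i <= \prod_i p i - \prod_i r i.
Proof.
move=> pr; rewrite [\prod_i p i](bigD1 j)//= [\prod_i r i](bigD1 j)//= mulrBl.
rewrite lerB// ler_wpM2l//; first by case/andP: (pr j).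
by apply: ler_prod => i _; exact: pr.
Qed.

Context (N : nat) (H K : 'I_N -> R).
Hypotheses (H01 : forall j, 0 < H j < 1) (K01 : forall j, 0 < K j <= 1).
Variables (a b : Rvec R N).
Hypothesis ab : forall j, 0 < tnth a j < tnth b j.

(** With [S] and [T] the coordinatewise standard deviations, the variogram is [(prod S - prod T)^2 +
    2 (prod (S T) - prod q)]. The square is dropped, [prodB_ge] isolates coordinate [j], and the
    other factors are at least their values at the corner [a]. *)
Lemma bbs_variogram_box_ge j : exists2 c, 0 < c & forall s t,
  box a b s -> box a b t ->
  c * `|tnth s j - tnth t j| `^ (2 * H j * K j) <= bbs_variogram H K s t.
Proof.
pose al i := tnth a i `^ (H i * K i).
have al0 i : 0 < al i by rewrite powR_gt0//; case/andP: (ab i).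
(* The smallest ratio of two [i]-th coordinates inside the box. *)
pose r i := tnth a i / tnth b i.
have b0 i : 0 < tnth b i by case/andP: (ab i) => /lt_trans; exact.
have r0 i : 0 < r i by rewrite divr_gt0//; case/andP: (ab i).
have r1 i : r i < 1 by rewrite ltr_pdivrMr// mul1r; case/andP: (ab i).
have [hj0 hj1] := andP (H01 j); have [kj0 kj1] := andP (K01 j).
exists (2 * (bifractional_gap (H j) (K j) (r j) * \prod_(i | i != j) al i ^+ 2)).
  apply: mulr_gt0 => //; apply: mulr_gt0; first exact: bifractional_gap_gt0.
  by apply: prodr_gt0 => i _; rewrite exprn_gt0.
move=> s t sab tab.
have s0 i : 0 < tnth s i.
  by case/andP: (ab i) => /lt_le_trans + _; apply; case/andP: (sab i).
have t0 i : 0 < tnth t i.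
  by case/andP: (ab i) => /lt_le_trans + _; apply; case/andP: (tab i).
pose S i := tnth s i `^ (H i * K i); pose T i := tnth t i `^ (H i * K i).
pose p i := S i * T i.
pose q i := bifractional_cov1 (H i) (K i) (tnth s i) (tnth t i).
have rle i x y : tnth a i <= x -> y <= tnth b i -> r i * y <= x.
  move=> ax yb; apply: le_trans ax.
  have bN0 : tnth b i != 0 by rewrite gt_eqF.
  rewrite -[leRHS](divfK bN0 (tnth a i)).
  by rewrite ler_wpM2l// (ltW (r0 i)).
have gap i : bifractional_gap (H i) (K i) (r i) *
    `|tnth s i - tnth t i| `^ (2 * H i * K i) <= p i - q i.
  have [hi0 hi1] := andP (H01 i); have [ki0 ki1] := andP (K01 i).
  have [as_ sb] := andP (sab i); have [at_ tb] := andP (tab i).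
  by apply: bifractional_cov1_gap => //; [exact: ltW|exact: ltW|exact: rle..].
have q01 i : 0 <= q i <= p i.
  have [hi0 hi1] := andP (H01 i); have [ki0 ki1] := andP (K01 i).
  apply/andP; split.
    by apply: bifractional_cov1_ge0 => //; exact: ltW.
  rewrite -subr_ge0; apply: le_trans (gap i).
  by rewrite mulr_ge0 ?powR_ge0// ltW// bifractional_gap_gt0.
have covE (u v : Rvec R N) : bifractional_cov H K u v =
  \prod_i bifractional_cov1 (H i) (K i) (tnth u i) (tnth v i) by [].
have diag (u : Rvec R N) (u0 : forall i, 0 < tnth u i) :
    bifractional_cov H K u u = (\prod_i tnth u i `^ (H i * K i)) ^+ 2.
  rewrite covE -prodrXl; apply: eq_bigr => i _.
  have [hi0 hi1] := andP (H01 i); have [ki0 ki1] := andP (K01 i).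
  by rewrite bifractional_cov1xx// (ltW (u0 i)).
have lb : 2 * (\prod_i p i - \prod_i q i) <= bbs_variogram H K s t.
  rewrite /bbs_variogram !diag// covE -/(\prod_i q i) big_split /=.
  have := sqr_ge0 (\prod_i S i - \prod_i T i).
  by rewrite /S /T; nra.
apply: le_trans lb; rewrite -[leLHS]mulrA ler_pM2l//.
apply: le_trans (prodB_ge j q01); rewrite mulrAC.
apply: ler_pM => //.
- by rewrite mulr_ge0 ?powR_ge0// ltW// bifractional_gap_gt0.
- by apply: prodr_ge0 => i _; rewrite sqr_ge0.
apply: ler_prod => i _; rewrite sqr_ge0 /=.
have [hi0 hi1] := andP (H01 i); have [ki0 ki1] := andP (K01 i).
have [as_ sb] := andP (sab i); have [at_ tb] := andP (tab i).
rewrite expr2 ler_pM ?(ltW (al0 i))//; rewrite ge0_ler_powR ?nnegrE//.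
- by rewrite mulr_ge0// ltW.
- by case/andP: (ab i) => /ltW.
- exact: ltW.
- by rewrite mulr_ge0// ltW.
- by case/andP: (ab i) => /ltW.
- exact: ltW.
Qed.
End variogram_lower_bound.

(** * The singular kernel *)

Section singular_kernel.
Context {R : realType}.

Lemma prod_powR (I : finType) (x : R) (e : I -> R) : 0 < x ->
  \prod_i x `^ e i = x `^ (\sum_i e i).
Proof.
move=> x0; rewrite /powR gt_eqF// mulr_suml expR_sum.
by apply: eq_bigr => i _.
Qed.

Lemma gaussn_massE (s : R) : 0 < s -> gaussn_mass s = gaussn_mass 1 / s.
Proof.
move=> s0; rewrite /gaussn_mass /normal_peak !invrK invr1 expr1n mul1r.
rewrite -mulrnAr sqrtrM ?sqr_ge0// sqrtr_sqr ger0_norm ?invr_ge0 ?ltW//.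
by rewrite mulrC.
Qed.

Context (N d : nat) (H K : 'I_N -> R).
Hypotheses (N0 : (0 < N)%N) (d0 : (0 < d)%N).
Hypotheses (H01 : forall j, 0 < H j < 1) (K01 : forall j, 0 < K j <= 1).
Variables (a b : Rvec R N).
Hypothesis ab : forall j, 0 < tnth a j < tnth b j.

Definition sheet_index := \sum_(j < N) (H j * K j)^-1.

Let HK0 j : 0 < H j * K j.
Proof. by have [? _] := andP (H01 j); have [? _] := andP (K01 j); rewrite mulr_gt0. Qed.

Lemma sheet_index_gt0 : 0 < sheet_index.
Proof.
rewrite /sheet_index (bigD1 (Ordinal N0))//= ltr_pwDl ?invr_gt0//.
by apply: sumr_ge0 => j _; rewrite invr_ge0 ltW.
Qed.

(* The coordinates must differ: [0 `^ (- be)] is 0, not +oo. *)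
Lemma gaussn_mass_variogram_le : exists2 C, 0 <= C & forall s t,
  box a b s -> box a b t -> (forall j, tnth s j != tnth t j) ->
  0 < bbs_variogram H K s t /\
  gaussn_mass (Num.sqrt (bbs_variogram H K s t)) ^+ d <=
  C * \prod_(j < N) `|tnth s j - tnth t j| `^ (- (d%:R / sheet_index)).
Proof.
have [c c0 cV] : exists2 c : 'I_N -> R, forall j, 0 < c j & forall j s t,
    box a b s -> box a b t ->
    c j * `|tnth s j - tnth t j| `^ (2 * H j * K j) <= bbs_variogram H K s t.
  have /choice[c cP] : forall j, exists c, 0 < c /\ forall s t,
    box a b s -> box a b t ->
    c * `|tnth s j - tnth t j| `^ (2 * H j * K j) <= bbs_variogram H K s t.
    by move=> j; have [c ? ?] := bbs_variogram_box_ge H01 K01 ab j; exists c.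
  by exists c => j; [exact: (cP j).1|exact: (cP j).2].
(* These weights sum to [d / 2], and [2 H_j K_j e_j = d / sheet_index] for every [j], whence one
   common exponent. *)
pose e j := d%:R / 2 * ((H j * K j)^-1 / sheet_index).
have e0 j : 0 < e j.
  by rewrite mulr_gt0 ?divr_gt0 ?invr_gt0 ?ltr0n ?sheet_index_gt0.
pose C := gaussn_mass 1 ^+ d * \prod_j c j `^ (- e j).
exists C.
  rewrite mulr_ge0 ?exprn_ge0 ?(ltW (gaussn_mass_gt0 _))//.
  by apply: prodr_ge0 => j _; exact: powR_ge0.
move=> s t sab tab st; set V := bbs_variogram H K s t.
have x0 j : 0 < `|tnth s j - tnth t j| by rewrite normr_gt0 subr_eq0.
have lb0 j : 0 < c j * `|tnth s j - tnth t j| `^ (2 * H j * K j).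
  by rewrite mulr_gt0 ?powR_gt0.
have V0 : 0 < V by apply: lt_le_trans (lb0 (Ordinal N0)) _; exact: cV.
split=> //.
rewrite gaussn_massE ?sqrtr_gt0// expr_div_n /C -mulrA ler_wpM2l//.
  by rewrite exprn_ge0// ltW// gaussn_mass_gt0.
have -> : (Num.sqrt V ^+ d)^-1 = V `^ (\sum_j - e j).
  have -> : \sum_j - e j = - (2^-1 * d%:R).
    rewrite sumrN; congr (- _); rewrite -mulr_sumr -mulr_suml divff ?mulr1.
      by rewrite mulrC.
    by rewrite gt_eqF// sheet_index_gt0.
  by rewrite powRN powRrM powR12_sqrt ?ltW// powR_mulrn ?sqrtr_ge0.
rewrite -prod_powR// -big_split; apply: ler_prod => j _ /=.
rewrite powR_ge0 /=.
have -> : `|tnth s j - tnth t j| `^ (- (d%:R / sheet_index)) =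
    (`|tnth s j - tnth t j| `^ (2 * H j * K j)) `^ (- e j).
  rewrite -powRrM; congr (_ `^ _); rewrite /e.
  have := HK0 j; have S0 := sheet_index_gt0; move: S0; set S := sheet_index => S0 hk0.
  have [h0 k0] : 0 < H j /\ 0 < K j by case/andP: (H01 j) (K01 j) => ? _ /andP[].
  by field; rewrite !gt_eqF.
rewrite -powRM ?powR_ge0 ?(ltW (c0 j))// !powRN lef_pV2 ?posrE ?powR_gt0//.
rewrite ge0_ler_powR ?nnegrE ?(ltW (e0 j)) ?(ltW (lb0 j)) ?(ltW V0)//.
exact: cV.
Qed.

End singular_kernel.

Lemma integral_indicM d (T : measurableType d) (R : realType)
    (mu : {measure set T -> \bar R}) (A : set T) (f : T -> R) : measurable A ->
  (\int[mu]_t (\1_A t * f t)%:E = \int[mu]_(t in A) (f t)%:E)%E.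
Proof.
move=> mA; rewrite [RHS]integral_mkcond; apply: eq_integral => t _.
by rewrite patchE indicE; case: ifP; rewrite ?mul1r ?mul0r.
Qed.

Section singular_integral.
Context {R : realType}.
Notation mu := (@lebesgue_measure R).

Lemma integral_itv_is_derive (F f : R -> R) (u v : R) : u < v ->
  (forall x, u <= x <= v -> is_derive x (1 : R) F (f x)) ->
  {within `[u, v], continuous f} ->
  (\int[mu]_(x in `[u, v]) (f x)%:E)%E = (F v - F u)%:E.
Proof.
move=> uv dF cf.
have cF x : u <= x <= v -> {for x, continuous F}.
  move=> uxv; apply/differentiable_continuous/derivable1_diffP.
  by have [] := dF x uxv.
rewrite EFinB (@continuous_FTC2 _ f F)//.
- split.
  + move=> x; rewrite in_itv/= => /andP[ux xv].
    by have [] := dF x; rewrite ?ltW.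
  + by apply: cvg_at_right_filter; apply: cF; rewrite lexx ltW.
  + by apply: cvg_at_left_filter; apply: cF; rewrite lexx ltW.
- move=> x; rewrite in_itv/= => /andP[ux xv].
  by rewrite derive1E; have [|_ ->//] := dF x; rewrite ?ltW.
Qed.

Variables (x L be : R).
Hypotheses (L0 : 0 < L) (be0 : 0 < be) (be1 : be < 1).

(* sg = 1 and sg = -1 treat the half-lines to the right and to the left of x. *)
Let is_derive_aux (sg t : R) : sg ^+ 2 = 1 -> 0 < sg * (t - x) ->
  is_derive t (1 : R) (fun t => sg / (1 - be) * (sg * (t - x)) `^ (1 - be))
    ((sg * (t - x)) `^ (- be)).
Proof.
move=> sg2 t0.
have d1 : is_derive t (1 : R) (fun t => sg * (t - x)) sg.
  by apply: is_derive_eq; rewrite subr0; exact: mulr1.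
have d2 := @is_derive1_comp _ (fun z => z `^ (1 - be)) (fun t => sg * (t - x)) t _ _
  (is_derive1_powR (1 - be) t0) d1.
have d3 := @is_deriveZ _ _ _ _ (sg / (1 - be)) t 1 _ d2.
apply: is_derive_eq.
rewrite /GRing.scale /= (_ : 1 - be - 1 = - be); last by ring.
have b1 : 1 - be != 0 by rewrite gt_eqF// subr_gt0.
set Z := _ `^ _; transitivity (sg ^+ 2 * Z); last by rewrite sg2 mul1r.
by field.
Qed.

(** On an interval on one side of [x], at distance at most [L] and not touching [x], the primitive
    has constant sign and size at most [L^(1 - be) / (1 - be)]. *)
Let integral_half (sg u v : R) : sg ^+ 2 = 1 -> u < v ->
  (forall t, u <= t <= v -> 0 < sg * (t - x) /\ sg * (t - x) <= L) ->
  (\int[mu]_(t in `[u, v]) (`|x - t| `^ (- be))%:E <=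
    (L `^ (1 - be) / (1 - be))%:E)%E.
Proof.
move=> sg2 uv uvx.
have b1 : 0 < 1 - be by rewrite subr_gt0.
have nE t : u <= t <= v -> `|x - t| = sg * (t - x).
  move=> /uvx[t0 _]; rewrite -sqrtr_sqr.
  rewrite (_ : (x - t) ^+ 2 = (sg * (t - x)) ^+ 2).
    by rewrite sqrtr_sqr gtr0_norm.
  by rewrite exprMn sg2 mul1r -sqrrN opprB.
have -> : (\int[mu]_(t in `[u, v]) (`|x - t| `^ (- be))%:E =
    \int[mu]_(t in `[u, v]) ((sg * (t - x)) `^ (- be))%:E)%E.
  by apply: eq_integral => t; rewrite inE /= in_itv /= => /nE ->.
rewrite (integral_itv_is_derive uv (fun t ut => is_derive_aux sg2 (uvx t ut).1)).
  rewrite lee_fin.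
  have Z t : u <= t <= v ->
      0 <= (sg * (t - x)) `^ (1 - be) <= L `^ (1 - be).
    move=> /uvx[t0 tL]; rewrite powR_ge0 /=.
    by rewrite ge0_ler_powR ?nnegrE ?(ltW b1) ?(ltW t0) ?(ltW L0).
  have [|zu0 zu1] := andP (Z u _); first by rewrite lexx ltW.
  have [|zv0 zv1] := andP (Z v _); first by rewrite lexx ltW.
  rewrite -mulrBr mulrAC ler_wpM2r ?invr_ge0 ?(ltW b1)//.
  move: zu0 zu1 zv0 zv1; set zu := (sg * (u - x)) `^ _.
  set zv := (sg * (v - x)) `^ _; move=> zu0 zu1 zv0 zv1.
  by move/eqP: sg2; rewrite sqrf_eq1 => /predU1P[E|/eqP E];
    rewrite {1}E ?mul1r ?mulN1r; lra.
apply: derivable_within_continuous => t; rewrite in_itv/= => /uvx[t0 _].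
have d1 : is_derive t (1 : R) (fun t => sg * (t - x)) sg.
  by apply: is_derive_eq; rewrite subr0; exact: mulr1.
by have [] := @is_derive1_comp _ (fun z => z `^ (- be)) (fun t => sg * (t - x)) t _ _
  (is_derive1_powR (- be) t0) d1.
Qed.

(** The singularity is cut out by a gap of width [ep k] on each side; the bound of [integral_half]
    does not depend on the gap, and Fatou's lemma closes it. *)
Lemma integral_itv_dist_powR :
  (\int[mu]_t (\1_`[x - L, x + L] t * `|x - t| `^ (- be))%:E <=
    (2 * (L `^ (1 - be) / (1 - be)))%:E)%E.
Proof.
(* The divisor [k.+2] keeps [ep k < L], so both intervals are nondegenerate. *)
pose ep k : R := L / k.+2%:R.
have ep0 k : 0 < ep k by rewrite divr_gt0.
have epL k : ep k < L by rewrite ltr_pdivrMr// ltr_pMr// ltr1n.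
pose A k : set (measurableTypeR R) := [set` `[x - L, x - ep k]].
pose B k : set (measurableTypeR R) := [set` `[x + ep k, x + L]].
pose f_ k t : \bar R := ((\1_(A k) t + \1_(B k) t) * `|x - t| `^ (- be))%:E.
have mp : measurable_fun setT (fun t : R => `|x - t| `^ (- be)).
  apply: (measurableT_comp (measurable_powR _)).
  by apply: measurableT_comp => //; exact: measurable_funB.
have mA k : measurable (A k) by exact: measurable_itv.
have mB k : measurable (B k) by exact: measurable_itv.
apply: (@fatou_cvg_le _ (measurableTypeR R) R mu f_).
- move=> k; apply/measurable_EFinP/measurable_funM => //.
  by apply: measurable_funD; exact: measurable_indic.
- by move=> k t; rewrite lee_fin mulr_ge0 ?powR_ge0// addr_ge0.
- move=> t; apply/fine_cvgP; split; first exact: nearW.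
  (* At [t = x] both sides are 0, since a negative power of 0 is 0 by convention. *)
  rewrite /f_ /=; have [<-|tx] := eqVneq x t.
    rewrite subrr normr0 powR0 ?oppr_eq0 ?gt_eqF// mulr0.
    by under eq_fun do rewrite mulr0; exact: cvg_cst.
  apply: cvg_near_cst; near=> k; congr (_ * _).
  have ek : ep k < `|x - t|.
    rewrite /ep ltr_pdivrMr// -ltr_pdivrMl ?normr_gt0 ?subr_eq0//.
    apply: (@lt_trans _ _ k%:R); last by rewrite ltr_nat.
    by near: k; exact: nbhs_infty_gtr.
  have ekp := ep0 k; have eL := epL k.
  rewrite !indicE /A /B !mem_setE !in_itv /=.
  have [xt|xt] := lerP x t.
    have := ek; rewrite distrC ger0_norm ?subr_ge0// => ek'.
    rewrite (_ : (t <= x - ep k) = false) ?andbF ?add0r; last first.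
      by apply/negbTE; rewrite -ltNge; lra.
    rewrite (_ : (x + ep k <= t) = true); last by lra.
    by rewrite (_ : (x - L <= t) = true)//; lra.
  have := ek; rewrite gtr0_norm ?subr_gt0// => ek'.
  rewrite (_ : (x + ep k <= t) = false) ?addr0; last first.
    by apply/negbTE; rewrite -ltNge; lra.
  rewrite (_ : (t <= x - ep k) = true); last by lra.
  by rewrite (_ : (t <= x + L) = true)//; lra.
- move=> k; rewrite /f_.
  under eq_integral do rewrite mulrDl EFinD.
  rewrite ge0_integralD//.
  + rewrite !integral_indicM// (_ : 2 * _ = L `^ (1 - be) / (1 - be) +
      L `^ (1 - be) / (1 - be)); last by ring.
    have ekp := ep0 k; have eL := epL k.
    rewrite EFinD leeD//.
      apply: (@integral_half (-1)); first by rewrite sqrrN expr1n.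
        lra.
      by move=> t /andP[? ?]; split; lra.
    apply: (@integral_half 1); first by rewrite expr1n.
      lra.
    by move=> t /andP[? ?]; split; lra.
  + by apply/measurable_EFinP/measurable_funM => //; exact: measurable_indic.
  + by apply/measurable_EFinP/measurable_funM => //; exact: measurable_indic.
Unshelve. all: by end_near. Qed.

End singular_integral.

(** * Lebesgue measure on the box, and clamped times *)

Section box_measure.
Context {R : realType} (N : nat) (a b : Rvec R N).
Hypothesis ab : forall j, 0 < tnth a j < tnth b j.
Notation lbN := (@lebesgue_n R N).

Lemma lebesgue_n_box_lty : (lbN (box a b) < +oo)%E.
Proof.
rewrite lebesgue_n_box ?ltry// => j; by case/andP: (ab j) => _ /ltW.
Qed.

(** A finite measure on the whole space, so that results stated over [setT] apply to times in the
    box. *)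
Definition box_measure : {finite_measure set (Rvec R N) -> \bar R} :=
  mfrestr (measurable_box a b) lebesgue_n_box_lty.

Lemma ge0_integral_box_measure (f : Rvec R N -> \bar R) :
  measurable_fun setT f -> (forall x, (0 <= f x)%E) ->
  (\int[box_measure]_x f x = \int[lbN]_(x in box a b) f x)%E.
Proof.
move=> mf f0; have mB := measurable_box a b.
rewrite (@ge0_negligible_integral _ _ _ _ setT (~` box a b))//.
- rewrite setTD setCK; apply: eq_measure_integral => A mA AB.
  transitivity (lbN (A `&` box a b)) => //.
  by rewrite setIidl.
- exact: measurableC.
- transitivity (lbN (~` box a b `&` box a b)) => //.
  by rewrite setICl measure0.
Qed.

Lemma Rintegral_box_measure (f : Rvec R N -> R) : measurable_fun setT f ->
  \int[box_measure]_x f x = \int[lbN]_(x in box a b) f x.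
Proof.
move=> mf; have mf' : measurable_fun setT (EFin \o f) by exact/measurable_EFinP.
rewrite /Rintegral; congr fine; rewrite integralE [RHS]integralE.
by rewrite !ge0_integral_box_measure//;
  [exact: measurable_funeneg|exact: measurable_funepos].
Qed.

Lemma prode_le_EFin (I : finType) (x : I -> \bar R) (r : I -> R) :
  (forall i, (0 <= x i <= (r i)%:E)%E) ->
  (\prod_i x i <= (\prod_i r i)%:E)%E.
Proof.
move=> xr; suff : (0 <= \prod_i x i)%E /\ (\prod_i x i <= (\prod_i r i)%:E)%E by case.
apply: (big_ind2 (fun x y => (0 <= x)%E /\ (x <= y%:E)%E)) => //.
  move=> x1 y1 x2 y2 [x10 xy1] [x20 xy2]; split; first exact: mule_ge0.
  by rewrite EFinM lee_pmul.
by move=> i _; case/andP: (xr i).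
Qed.

Definition singular_bound (be : R) : R :=
  \prod_(j < N) (2 * ((tnth b j - tnth a j) `^ (1 - be) / (1 - be))).

Lemma measurable_dist_powR (be x : R) :
  measurable_fun setT (fun t : R => `|x - t| `^ be).
Proof.
apply: (measurableT_comp (measurable_powR _)).
by apply: measurableT_comp => //; exact: measurable_funB.
Qed.

(** Each side is enlarged to the interval of half-length [b_j - a_j] centered at [s_j]; the integral
    then factors, with a bound independent of [s]. *)
Lemma integral_box_dist_powR (be : R) (s : Rvec R N) : 0 < be -> be < 1 ->
  box a b s ->
  (\int[lbN]_(t in box a b) (\prod_(j < N) `|tnth s j - tnth t j| `^ (- be))%:E
   <= (singular_bound be)%:E)%E.
Proof.
move=> be0 be1 sab.
pose g (j : 'I_N) (t : R) : R := \1_`[tnth s j - (tnth b j - tnth a j),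
  tnth s j + (tnth b j - tnth a j)] t * `|tnth s j - t| `^ (- be).
have mg j : measurable_fun setT (g j).
  apply: measurable_funM; last exact: measurable_dist_powR.
  exact: measurable_indic.
have g0 j t : 0 <= g j t by rewrite mulr_ge0 ?powR_ge0.
apply: (@le_trans _ _ (\int[lbN]_t (\prod_j g j (tnth t j))%:E)%E).
  rewrite integral_mkcond; apply: ge0_le_integral => //.
  - by move=> t _; rewrite patchE; case: ifP => // _;
      rewrite lee_fin prodr_ge0// => j _; rewrite powR_ge0.
  - apply/(measurable_restrictT _ (measurable_box a b))/measurable_funTS.
    apply/measurable_EFinP/measurable_prod => j _.
    by apply: (measurableT_comp (measurable_dist_powR _ _)); exact: measurable_tnth.
  - apply/measurable_EFinP/measurable_prod => j _.
    by apply: (measurableT_comp (mg j)); exact: measurable_tnth.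
  - move=> t _; rewrite patchE; case: ifPn => [|_]; last by rewrite lee_fin prodr_ge0.
    rewrite inE => tab; rewrite lee_fin; apply: ler_prod => j _.
    rewrite powR_ge0 /= /g indicE mem_setE in_itv /=.
    have /andP[sa sb] := sab j; have /andP[ta tb] := tab j.
    rewrite (_ : _ <= tnth t j = true); last by lra.
    by rewrite (_ : tnth t j <= _ = true) ?mul1r//; lra.
rewrite integral_lebesgue_n_prod//; apply: prode_le_EFin => j.
apply/andP; split; first by apply: integral_ge0 => t _; rewrite lee_fin.
apply: integral_itv_dist_powR => //.
by rewrite subr_gt0; case/andP: (ab j).
Qed.

(** The indicator is a product of one-variable functions; the [j]-th integral is 0, which
    annihilates the product even though the others are infinite. *)
Lemma lebesgue_n_hyperplane (j : 'I_N) (x : R) :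
  lbN [set t | tnth t j = x] = 0%E.
Proof.
pose f (i : 'I_N) (u : R) : R := if i == j then \1_[set x] u else 1.
have mS : measurable ([set t | tnth t j = x] : set (Rvec R N)).
  rewrite (_ : [set _ | _] = (@tnth N R)^~ j @^-1` [set x]) //.
  by rewrite -[X in measurable X]setTI; exact: measurable_tnth.
rewrite -[LHS]mul1e -integral_cst// integral_mkcond.
rewrite (_ : (\int[_]_t _)%E = (\int[lbN]_t (\prod_i f i (tnth t i))%:E)%E); last first.
  apply: eq_integral => t _; rewrite patchE (bigD1 j)//= big1 ?mulr1; last first.
    by move=> i /negbTE ij; rewrite /f ij.
  rewrite /f eqxx indicE; have [tj|/eqP tj] := eqVneq (tnth t j) x.
    by rewrite !mem_set.
  by rewrite !memNset.
rewrite integral_lebesgue_n_prod.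
- rewrite (bigD1 j)//= /f eqxx integral_indic// setIT.
  by rewrite [X in (X * _)%E]lebesgue_measure_set1 mul0e.
- by move=> i; rewrite /f; have [_|_] := eqVneq i j; [exact: measurable_indic|].
- by move=> i u; rewrite /f; case: ifP.
Qed.

Lemma ae_neq_tnth (s : Rvec R N) :
  {ae lbN, forall t, forall j, tnth s j != tnth t j}.
Proof.
(* Indices become natural numbers below [N], to use a countable intersection of sets of full
   measure. *)
suff : {ae lbN, forall t, forall k (kN : (k < N)%N),
    tnth s (Ordinal kN) != tnth t (Ordinal kN)}.
  by apply: filterS => t h j; have := h _ (ltn_ord j); rewrite !(tnth_nth 0).
apply: ae_foralln => k.
have [kN|kN] := pselect (k < N)%N; last by apply: aeW.
exists [set t | tnth t (Ordinal kN) = tnth s (Ordinal kN)]; split.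
- rewrite (_ : [set _ | _] =
    (@tnth N R)^~ (Ordinal kN) @^-1` [set tnth s (Ordinal kN)]) //.
  by rewrite -[X in measurable X]setTI; exact: measurable_tnth.
- exact: lebesgue_n_hyperplane.
- by move=> t /= /existsNP[kN'] /negP; rewrite negbK (bool_irrelevance kN' kN) => /eqP ->.

Qed.

(* Projecting times onto the box gives a field that is jointly measurable on all
   of R^N and unchanged on the box. *)
Definition clamp (s : Rvec R N) : Rvec R N :=
  [tuple Num.min (Num.max (tnth s j) (tnth a j)) (tnth b j) | j < N].

Lemma clamp_box s : box a b (clamp s).
Proof.
move=> j; rewrite tnth_mktuple le_min ge_min lexx orbT andbT.
by case/andP: (ab j) => _ /ltW ->; rewrite le_max lexx orbT.
Qed.

Lemma clamp_id s : box a b s -> clamp s = s.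
Proof.
move=> sab; apply: eq_from_tnth => j; rewrite tnth_mktuple.
by have /andP[sa sb] := sab j; rewrite (max_idPl sa) (min_idPl sb).
Qed.

Lemma clamp_Rplus s : Rplus R N (clamp s).
Proof.
move=> j; have /andP[+ _] := clamp_box s j; apply: le_trans.
by case/andP: (ab j) => /ltW.
Qed.

Lemma measurable_clamp : measurable_fun setT clamp.
Proof.
apply/measurable_fun_tnthP => j.
rewrite (_ : _ \o _ = fun s => Num.min (Num.max (tnth s j) (tnth a j)) (tnth b j)).
  apply: measurable_minr => //; apply: measurable_maxr => //.
  exact: measurable_tnth.
by apply/funext => s; rewrite /= tnth_mktuple.
Qed.
End box_measure.

(** * Almost sure square integrability of the transform *)

Section clamped_field.
Context (R : realType) (dO : measure_display) (Omega : measurableType dO).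
Context (P : probability Omega R) (N d : nat).
Context (B : Rvec R N -> {RV P >-> Rvec R d}) (H K : 'I_N -> R).
Hypothesis bbs : bifractional_brownian_sheet B H K.
Hypotheses (N0 : (0 < N)%N) (d0 : (0 < d)%N).
Hypotheses (H01 : forall j, 0 < H j < 1) (K01 : forall j, 0 < K j <= 1).
Hypothesis dHK : d%:R < sheet_index H K.
Variables (a b : Rvec R N).
Hypothesis ab : forall j, 0 < tnth a j < tnth b j.
Notation nu := (box_measure ab).
Notation nu2 := (measure_square nu).
Notation clamp := (clamp a b).

Definition clamped_path (w : Omega) (s : Rvec R N) : Rvec R d := B (clamp s) w.

Lemma measurable_clamped_field :
  measurable_fun setT (fun p : Rvec R N * Omega => clamped_path p.2 p.1).
Proof.
have mRplus : measurable (Rplus R N).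
  rewrite (_ : Rplus R N =
      \bigcap_(j in [set: 'I_N]) ((@tnth N _)^~ j @^-1` `[0, +oo[)).
    apply: fin_bigcap_measurable => // j _.
    by rewrite -[_ @^-1` _]setTI; apply: measurable_tnth.
  apply/seteqP; split => [t t0 j _|t t0 j].
    by rewrite /= in_itv /= t0.
  by have := t0 j I; rewrite /= in_itv /= andbT.
have mE : measurable (Rplus R N `*` [set: Omega]) by exact: measurableX.
apply: (measurable_comp mE _ (bbs_measurable bbs)
  (g := fun p : Rvec R N * Omega => (clamp p.1, p.2))).
  by move=> _ [p _ <-]; split => //; exact: clamp_Rplus.
apply/measurable_fun_pairP; split; last exact: measurable_snd.
exact: (measurableT_comp (measurable_clamp a b) measurable_fst).
Qed.

Lemma measurable_clamped_path w : measurable_fun setT (clamped_path w).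
Proof.
apply: (measurableT_comp measurable_clamped_field
  (f := fun p : Rvec R N * Omega => _) (g := fun s => (s, w))).
exact: pair2_measurable.
Qed.

Definition clamped_char (z : Rvec R N * Rvec R N) (y : Rvec R d) : R :=
  gaussn (Num.sqrt (bbs_variogram H K (clamp z.1) (clamp z.2))) y.

Let phase (p : (Rvec R N * Rvec R N) * Rvec R d * Omega) : R :=
  dotv (vsub (clamped_path p.2 p.1.1.1) (clamped_path p.2 p.1.1.2)) p.1.2.

Let measurable_phase : measurable_fun setT phase.
Proof.
apply: measurable_dotv2; last by exact: (measurableT_comp measurable_snd measurable_fst).
apply: measurable_vsub2.
- apply: (measurableT_comp measurable_clamped_field
    (g := fun p : (Rvec R N * Rvec R N) * Rvec R d * Omega => (p.1.1.1, p.2))).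
  apply/measurable_fun_pairP; split; last exact: measurable_snd.
  exact: (measurableT_comp measurable_fst (measurableT_comp measurable_fst measurable_fst)).
- apply: (measurableT_comp measurable_clamped_field
    (g := fun p : (Rvec R N * Rvec R N) * Rvec R d * Omega => (p.1.1.2, p.2))).
  apply/measurable_fun_pairP; split; last exact: measurable_snd.
  exact: (measurableT_comp measurable_snd (measurableT_comp measurable_fst measurable_fst)).
Qed.

Let clamped_charE z y : clamped_char z y = \int[P]_w cos (phase (z, y, w)).
Proof.
by rewrite /clamped_char -(Rintegral_cos_increment bbs)//; exact: clamp_Rplus.
Qed.

(** Joint measurability is read off from the expectation of a jointly measurable phase rather than
    from the covariance formula. *)
Lemma measurable_clamped_char :
  measurable_fun setT (fun p : (Rvec R N * Rvec R N) * Rvec R d => clamped_char p.1 p.2).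
Proof.
rewrite (_ : (fun _ => _) = fun p => \int[P]_w cos (phase (p, w))); last first.
  by apply/funext => -[z y]; rewrite /= clamped_charE.
apply: (@measurable_Rintegral_param _ _ _ _ _ P (fun p => cos (phase p))).
exact: (measurableT_comp measurable_cos measurable_phase).
Qed.

Let be := d%:R / sheet_index H K.

Let be0 : 0 < be.
Proof. by rewrite divr_gt0 ?ltr0n// sheet_index_gt0. Qed.

Let be1 : be < 1.
Proof. by rewrite ltr_pdivrMr ?mul1r// sheet_index_gt0. Qed.

(** Equal to [(2 pi)^(d/2) V^(-d/2)] where the variogram [V] is positive, and infinite on the
    diagonal, hence the extended reals. *)
Let F z := (\int[@lebesgue_n R d]_y (clamped_char z y)%:E)%E.

Let mF : measurable_fun setT F.
Proof.
apply: (measurable_fun_fubini_tonelli_F (fun p => (clamped_char p.1 p.2)%:E)).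
  by apply/measurable_EFinP; exact: measurable_clamped_char.
by move=> p; rewrite lee_fin gaussn_ge0.
Qed.

Let F0 z : (0 <= F z)%E.
Proof. by apply: integral_ge0 => y _; rewrite lee_fin gaussn_ge0. Qed.

Let mF1 s : measurable_fun setT (fun t => F (s, t)).
Proof. by apply: (measurableT_comp mF); exact: pair1_measurable. Qed.

Lemma integral_clamped_char_bound : exists2 M : R, 0 <= M & forall s,
  (\int[nu]_t F (s, t) <= M%:E)%E.
Proof.
have [C C0 CV] := gaussn_mass_variogram_le N0 d0 H01 K01 ab.
have S0 : 0 <= singular_bound a b be.
  apply: prodr_ge0 => j _; rewrite mulr_ge0// divr_ge0 ?powR_ge0//.
  by rewrite subr_ge0 ltW.
exists (C * singular_bound a b be); first exact: mulr_ge0.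
move=> s; rewrite (ge0_integral_box_measure ab (mF1 s) (fun t => F0 (s, t))).
set s' := clamp s; have sab : box a b s' by exact: clamp_box.
have mp : measurable_fun setT
    (fun t : Rvec R N => \prod_(j < N) `|tnth s' j - tnth t j| `^ (- be)).
  apply: measurable_prod => j _.
  by apply: (measurableT_comp (measurable_dist_powR _ _)); exact: measurable_tnth.
have p0 (t : Rvec R N) : 0 <= \prod_(j < N) `|tnth s' j - tnth t j| `^ (- be).
  by apply: prodr_ge0 => j _; exact: powR_ge0.
apply: (@le_trans _ _ (\int[lebesgue_n N]_(t in box a b)
    (C * \prod_(j < N) `|tnth s' j - tnth t j| `^ (- be))%:E)%E).
  apply: ae_ge0_le_integral.
  - exact: measurable_box.
  - by move=> t _.
  - exact: (measurable_funTS (mF1 s)).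
  - by move=> t _; rewrite lee_fin mulr_ge0.
  - by apply/measurable_funTS/measurable_EFinP/measurable_funM.
  (* The kernel bound is only available when [s'] and [t] differ in every coordinate; the other [t]
     form a null set. *)
  apply: filterS (ae_neq_tnth s') => t st tab.
  have [V0 VC] := CV s' t sab tab st.
  rewrite /F /clamped_char /= -/s' (clamp_id tab).
  have := integral_gaussn_vsub [tuple 0 | _ < d] (_ : 0 < Num.sqrt (bbs_variogram H K s' t)).
  rewrite sqrtr_gt0 => /(_ V0).
  under eq_integral do rewrite vsub0.
  by move=> ->; rewrite lee_fin.
under eq_integral do rewrite EFinM.
rewrite ge0_integralZl//; last 2 first.
- by apply/measurable_funTS/measurable_EFinP.
- by move=> t _; rewrite lee_fin.
rewrite EFinM; apply: lee_wpmul2l; first by rewrite lee_fin.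
  exact: integral_box_dist_powR.
exact: measurable_box.
Qed.

Lemma integral_clamped_char_lty : (\int[nu2]_z F z < +oo)%E.
Proof.
have [M M0 FM] := integral_clamped_char_bound.
rewrite /measure_square fubini_tonelli1//.
apply: (@le_lt_trans _ _ (\int[nu]_s M%:E)%E); last first.
  rewrite integral_cst//; apply: lte_mul_pinfty => //.
  exact: fin_num_fun_lty.
apply: ge0_le_integral => //.
- by move=> s _; exact: integral_ge0.
- exact: (@measurable_fun_fubini_tonelli_F _ _ _ _ _ nu F mF F0).
- by move=> s _; exact: FM.
Qed.

Let int1 : nu.-integrable setT (EFin \o (fun=> 1 : R)).
Proof. exact: finite_measure_integrable_cst. Qed.

Let int11 : nu2.-integrable setT (EFin \o (fun=> 1 : R)).
Proof.
have := integrable_diff_pair int1.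
by under eq_fun do rewrite mulr1.
Qed.

Let Q (w : Omega) (y : Rvec R d) :=
  cos_transform nu (clamped_path w) (fun=> 1) y ^+ 2 +
  sin_transform nu (clamped_path w) (fun=> 1) y ^+ 2.

Let QE w y : Q w y = \int[nu2]_z cos (phase (z, y, w)).
Proof.
rewrite /Q (sqr_cos_sin_transform (measurable_clamped_path w) int1).
by apply: eq_Rintegral => z _; rewrite !mulr1.
Qed.

Let Q0 w y : 0 <= Q w y.
Proof. by rewrite addr_ge0 ?sqr_ge0. Qed.

Let mphase_swap : measurable_fun setT
  (fun q : Omega * Rvec R d * (Rvec R N * Rvec R N) => cos (phase (q.2, q.1.2, q.1.1))).
Proof.
apply: (measurableT_comp measurable_cos).
apply: (measurableT_comp measurable_phase
  (g := fun q : Omega * Rvec R d * (Rvec R N * Rvec R N) => (q.2, q.1.2, q.1.1))).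
apply/measurable_fun_pairP; split.
  apply/measurable_fun_pairP; split; first exact: measurable_snd.
  exact: (measurableT_comp measurable_snd measurable_fst).
exact: (measurableT_comp measurable_fst measurable_fst).
Qed.

Let mQ : measurable_fun setT (fun q : Omega * Rvec R d => Q q.1 q.2).
Proof.
rewrite (_ : (fun _ => _) =
    fun q => \int[nu2]_z cos (phase (z, q.2, q.1))); last first.
  by apply/funext => -[w y]; exact: QE.
exact: (@measurable_Rintegral_param _ _ _ _ _ (measure_square nu)
  (fun p => cos (phase (p.2, p.1.2, p.1.1)))).
Qed.

(** Fubini applies because the cosine is bounded and both measures are finite. *)
Let expected_Q y : (\int[P]_w (Q w y)%:E = \int[nu2]_z (clamped_char z y)%:E)%E.
Proof.
have m2 : measurable_fun setT
    (fun p : Omega * (Rvec R N * Rvec R N) => cos (phase (p.2, y, p.1))).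
  apply: (measurableT_comp mphase_swap
    (g := fun p : Omega * (Rvec R N * Rvec R N) => (p.1, y, p.2))).
  apply/measurable_fun_pairP; split; last exact: measurable_snd.
  by apply/measurable_fun_pairP; split; [exact: measurable_fst|exact: measurable_cst].
have ip : (P \x nu2)%E.-integrable setT
    (EFin \o (fun p : Omega * (Rvec R N * Rvec R N) => cos (phase (p.2, y, p.1)))).
  apply: (@integrable_prod_dominated _ _ _ _ _ _ _ _ (fun=> 1) (fun=> 1)) => //.
  - by move=> w z; rewrite mulr1 ler_norml cos_geN1 cos_le1.
  - exact: finite_measure_integrable_cst.
have iQ := integrable_Rintegral1 ip.
have iC := integrable_Rintegral2 ip.
transitivity ((\int[P]_w \int[nu2]_z cos (phase (z, y, w)))%:E).
  rewrite Rintegral_EFin; last exact: iQ.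
  by apply: eq_integral => w _; rewrite QE.
rewrite (Rintegral_fubini ip) Rintegral_EFin; last exact: iC.
by apply: eq_integral => z _; rewrite clamped_charE.
Qed.

(** By Tonelli the mean of the squared L^2 norm is the integral of [F] over pairs of times, which is
    finite; a nonnegative variable with finite mean is almost surely finite. *)
Lemma ae_transform_L2 : {ae P, forall w,
  (\int[@lebesgue_n R d]_y (cos_transform nu (clamped_path w) (fun=> 1%R) y ^+ 2 +
    sin_transform nu (clamped_path w) (fun=> 1%R) y ^+ 2)%:E < +oo)%E}.
Proof.
have mQE : measurable_fun setT (fun q : Omega * Rvec R d => (Q q.1 q.2)%:E).
  exact/measurable_EFinP.
have QE0 q : (0 <= (Q q.1 q.2)%:E)%E by rewrite lee_fin.
have mC : measurable_fun setT (fun p : (Rvec R N * Rvec R N) * Rvec R d =>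
    (clamped_char p.1 p.2)%:E).
  by apply/measurable_EFinP; exact: measurable_clamped_char.
have C0 p : (0 <= (clamped_char p.1 p.2)%:E)%E by rewrite lee_fin gaussn_ge0.
pose G w := (\int[@lebesgue_n R d]_y (Q w y)%:E)%E.
have mG : measurable_fun setT G.
  exact: (@measurable_fun_fubini_tonelli_F _ _ _ _ _ (lebesgue_n d)
    (fun q => (Q q.1 q.2)%:E) mQE QE0).
have G0 w : (0 <= G w)%E by apply: integral_ge0 => y _; rewrite lee_fin.
have iG : P.-integrable setT G.
  apply/integrableP; split => //.
  under eq_integral do rewrite gee0_abs//.
  rewrite (@fubini_tonelli _ _ _ _ _ P (lebesgue_n d) _ mQE QE0)/=.
  under eq_integral do rewrite expected_Q.
  have := @fubini_tonelli _ _ _ _ _ (measure_square nu) (lebesgue_n d) _ mC C0.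
  by move=> <-; exact: integral_clamped_char_lty.
have := integrable_ae measurableT iG; apply: filterS => w /(_ I).
by rewrite ge0_fin_numE.
Qed.

End clamped_field.

(** * Existence of the local time and its L^2 representation *)

Local Open Scope complex_scope.

Theorem theorem4p9 (R : realType) (dO : measure_display)
    (Omega : measurableType dO) (P : probability Omega R) (N d : nat)
    (H K : 'I_N -> R) (B : Rvec R N -> {RV P >-> Rvec R d}) :
  (1 <= N)%N -> (1 <= d)%N ->
  (forall j, 0 < H j < 1) -> (forall j, 0 < K j <= 1) ->
  bifractional_brownian_sheet B H K ->
  d%:R < \sum_(j < N) (H j * K j)^-1 ->
  forall a b : Rvec R N, (forall j, 0 < tnth a j < tnth b j) ->
    (exists L : Rvec R d -> Omega -> R, is_local_time B (box a b) L) /\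
    (forall L : Rvec R d -> Omega -> R, is_local_time B (box a b) L ->
      {ae P, forall w,
        is_L2_inv_fourier
          (fun y => cintegral (lebesgue_n N) (box a b)
                      (fun s => expi (dotv y (B s w))))
          (fun x => (L x w)%:C)}).
Proof.
move=> N0 d0 H01 K01 bbs dHK a b ab.
pose nu := box_measure ab; pose X := clamped_path B a b.
have mX w : measurable_fun setT (X w) by exact: (measurable_clamped_path bbs ab w).
have int1 : nu.-integrable setT (EFin \o (fun=> 1 : R)).
  exact: finite_measure_integrable_cst.
have L2 := ae_transform_L2 bbs N0 d0 H01 K01 dHK ab.
(* On the box the clamped path is the path itself, so the occupation measure is an image of [nu]. *)
have occE w A : measurable A ->
    occupation_measure B (box a b) w A = nu (X w @^-1` A).
  move=> mA; have mXA : measurable (X w @^-1` A).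
    by rewrite -[X in measurable X]setTI; exact: mX.
  rewrite (_ : nu _ = (\int[nu]_s (\1_(X w @^-1` A) s)%:E)%E); last first.
    by rewrite integral_indic// setIT.
  rewrite ge0_integral_box_measure//; last first.
    exact/measurable_EFinP/measurable_indic.
  apply: eq_integral => s; rewrite inE => sab.
  have -> : B s w = X w s by rewrite /X /clamped_path clamp_id.
  by rewrite !indicE; congr ((nat_of_bool _)%:R%:E); apply/idP/idP; rewrite !inE.
split.
  (* Densities are chosen path by path, with the zero function where the transform is not square
     integrable; [is_local_time] asks for measurability in [x] at fixed [w]. *)
  have /choice[L LP] : forall w, exists L,
      (\int[lebesgue_n d]_y (cos_transform nu (X w) (fun=> 1%R) y ^+ 2 +
        sin_transform nu (X w) (fun=> 1%R) y ^+ 2)%:E < +oo)%E ->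
      is_density nu (X w) L.
    move=> w; have [h|h] := pselect (\int[lebesgue_n d]_y
      (cos_transform nu (X w) (fun=> 1%R) y ^+ 2 +
        sin_transform nu (X w) (fun=> 1%R) y ^+ 2)%:E < +oo)%E.
      by have [L [dL _]] := occupation_density_exists (mX w) int1 h; exists L.
    by exists (fun=> 0).
  exists (fun x w => L w x); apply: filterS L2 => w /LP[mL L0 dL].
  by split => // A mA; rewrite occE// dL.
(* Almost surely, a given local time is a density of the occupation measure of the clamped path, so
   the representation applies to it. *)
move=> L locL; apply: filterS2 L2 locL => w h [mL L0 dL].
have dw : is_density nu (X w) (L ^~ w).
  by split => // A mA; rewrite -dL// occE.
have := is_L2_inv_fourier_density (mX w) int1 h dw.
rewrite (_ : (fun y => cos_transform _ _ _ y +i* _) =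
  (fun y => cintegral (lebesgue_n N) (box a b) (fun s => expi (dotv y (B s w)))))//.
apply/funext => y; rewrite /cintegral /expi /=.
have mdot : measurable_fun setT (fun s => dotv (X w s) y).
  by apply: measurable_dotv2.
have mc : measurable_fun setT (fun s => cos (dotv (X w s) y) * 1).
  by apply: measurable_funM => //; exact: (measurableT_comp (@measurable_cos R)).
have ms : measurable_fun setT (fun s => sin (dotv (X w s) y) * 1).
  by apply: measurable_funM => //; exact: (measurableT_comp (@measurable_sin R)).
rewrite /cos_transform /sin_transform /nu !Rintegral_box_measure//.
congr (_ +i* _); apply: eq_Rintegral => s; rewrite inE => sab.
  by rewrite mulr1 /X /clamped_path clamp_id// dotvC.
by rewrite mulr1 /X /clamped_path clamp_id// dotvC.
Qed.
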